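(* Let $p,q:\mathbb{R}_+\to\mathbb{R}$ be functions in $L^2(\mathbb{R}_+)$, where $\mathbb{R}_+=[0,+\infty)$, and let $Q=\begin{pmatrix}-q & p \\ p & q\end{pmatrix}$ and $J=\begin{pmatrix}0&1\\-1&0\end{pmatrix}$. For $\lambda\in\mathbb{R}$ let $f=f(\cdot,\lambda):\mathbb{R}_+\to\mathbb{C}^2$ be the solution of $$Jf'(t)+Q(t)f(t)=\lambda f(t),\quad t\in\mathbb{R}_+,\qquad f(0)=\begin{pmatrix}1\\0\end{pmatrix}.$$ Then for almost every $\lambda\in\mathbb{R}$ (with respect to Lebesgue measure) the solution $f$ is bounded in the $L^2$-Cesàro sense, i.e. $$\sup_{r>0}\left(\frac1r\int_0^r|f(t,\lambda)|^2\,dt\right)<\infty .$$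
   Context: The solution of the differential equation is understood as the unique locally absolutely continuous function satisfying the equation for almost every $t$ together with the initial condition; $|\cdot|$ is the Euclidean norm on $\mathbb{C}^2$. *)

(* Defs.v *)
(* MathComp-Analysis; C is R[i] from mathcomp-real-closed. *)
From HB Require Import structures.
From mathcomp Require Import all_boot all_order all_algebra.
From mathcomp Require Import complex.
From mathcomp Require Import all_classical all_reals all_analysis.
Set Implicit Arguments.
Unset Strict Implicit.
Unset Printing Implicit Defensive.
Import Order.TTheory GRing.Theory Num.Theory.
Import numFieldNormedType.Exports.
Local Open Scope classical_set_scope.
Local Open Scope ring_scope.
Local Open Scope complex_scope.

(* Functions on R_+ are total functions on R of which only the values on
   [0, +oo[ matter. *)

(* Euclidean norm; the norm the library puts on matrices is the sup norm. *)
Definition enorm (R : realType) (v : 'cV[R[i]]_2) : R :=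
  Num.sqrt (\sum_(k < 2) ComplexField.Normc.normc (v k ord0) ^+ 2).

(* The completed measure makes this Lebesgue, rather than Borel,
   measurability. *)
Definition L2_Rplus (R : realType) (g : R -> R) : Prop :=
  g \_ `[0, +oo[ \in Lfun (@completed_lebesgue_measure R) 2%:E.

Definition abs_continuous_on (R : realType) (a b : R)
    (f : R -> 'cV[R[i]]_2) : Prop :=
  forall e : R, 0 < e -> exists2 d : R, 0 < d &
    forall (n : nat) (s t : 'I_n -> R),
      (forall i, [/\ a <= s i, s i < t i & t i <= b]) ->
      trivIset setT (fun i : 'I_n => `]s i, t i[%classic) ->
      \sum_(i < n) (t i - s i) < d ->
      \sum_(i < n) enorm (f (t i) - f (s i)) < e.

Definition loc_abs_continuous (R : realType) (f : R -> 'cV[R[i]]_2) : Prop :=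
  forall b : R, 0 < b -> abs_continuous_on 0 b f.

(* f'(t) = v.  R[i] has no normed module structure over R in the library,
   whence the explicit difference quotient with real increments. *)
Definition has_derivative (R : realType) (f : R -> 'cV[R[i]]_2) (t : R)
    (v : 'cV[R[i]]_2) : Prop :=
  enorm ((h^-1)%:C *: (f (t + h) - f t) - v) @[h --> 0^'] --> (0 : R).

Definition Jmx (R : realType) : 'M[R[i]]_2 :=
  \matrix_(i < 2, j < 2)
    (if (i == 0) && (j == 1) then 1 else
     if (i == 1) && (j == 0) then -1 else 0).

Definition Qmx (R : realType) (p q : R -> R) (t : R) : 'M[R[i]]_2 :=
  \matrix_(i < 2, j < 2)
    (if i != j then p t else if i == 0 then - q t else q t)%:C.

Definition init_vec (R : realType) : 'cV[R[i]]_2 :=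
  \col_(i < 2) (if i == 0 then 1 else 0).

(* A two-sided derivative is harmless at t = 0, a null set. *)
Definition is_solution (R : realType) (p q : R -> R) (lam : R)
    (f : R -> 'cV[R[i]]_2) : Prop :=
  [/\ loc_abs_continuous f,
      {ae @lebesgue_measure R, forall t : R, 0 <= t ->
        exists2 v, has_derivative f t v &
          Jmx R *m v + Qmx p q t *m f t = lam%:C *: f t}
    & f 0 = init_vec R].

Definition L2_cesaro_bounded (R : realType) (f : R -> 'cV[R[i]]_2) : Prop :=
  (ereal_sup [set (r^-1)%:E *
      \int[@lebesgue_measure R]_(t in `[0%R, r]) ((enorm (f t) ^+ 2)%R)%:E
    | r in [set r : R | (0 < r)%R]] < +oo)%E.

(* Main.v *)
(* With a = p + i q, the combinations P = f_1 + i f_2 and M = f_1 - i f_2 satisfy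
   P' = i lambda P + a M and M' = - i lambda M + conj(a) P.  Replacing a by its
   integrals over cells of length h turns this system into the Szego recursion
   at zeta = e^{2 i h lambda}.

   The (2,2) entry alpha(zeta) of the transfer matrix over N cells is a
   polynomial with alpha(0) = 1 and |alpha|^2 >= prod (1 - |gamma_k|^2) on the
   closed disc.  Hence the mean of |1/alpha - 1|^2 over the circle is at most a
   multiple of h ||a||_2^2, and by the Hardy-Littlewood maximal inequality its
   Poisson integral is small, so that |alpha((1 - 1/(2n)) zeta)| <= 2 for all
   1 <= n <= N, outside a set of lambda of measure O(||a||_2^2).  At a point of
   modulus 1 - 1/(2n) the energy identity (Christoffel-Darboux) converts this
   into a bound O(n) for the sum of the first n squared norms of solutions, and
   a Gronwall argument carries the bound over to zeta itself.

   Letting h -> 0 gives a Cesaro bound for the differential equation on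
   [T, +oo[ off a set of measure O(||a||_{L^2(T, +oo)}^2); this tends to 0 as
   T -> +oo. *)
Require Import Defs.
From HB Require Import structures.
From mathcomp Require Import all_boot all_order all_algebra.
From mathcomp Require Import complex ring lra.
From mathcomp Require Import all_classical all_reals all_analysis.
From mathcomp Require Import measurable_realfun.
Set Implicit Arguments.
Unset Strict Implicit.
Unset Printing Implicit Defensive.
Import Order.TTheory GRing.Theory Num.Theory.
Import numFieldNormedType.Exports.
Local Open Scope classical_set_scope.
Local Open Scope ring_scope.

(** * The Szego recursion *)

(** The scales fit because one turn of zeta takes an interval of lambda of length pi / h, while the
    mean square of 1/alpha - 1 is O(h ||a||_2^2): the powers of h cancel, and the exceptional set
    has a size independent of h and of the number N of cells.

    On the circle itself 1/alpha is controlled only in mean square. The maximal function dominates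
    its Poisson integrals at all radii 1 - 1/(2n) simultaneously, so one exceptional set serves
    every n. Depth 1/(2n) is the right one: there the energy identity loses a factor of order n,
    which is exactly the growth that a Cesaro bound allows, while |z|^n is still at least 1/2, so
    that solutions at z form a well-conditioned basis for n steps and moving to the circle costs a
    constant factor.

    That constant is absolute, and the solution enters the bound only through its value at T. Hence
    the schemes need to converge only for each fixed lambda, with no uniformity, and a bound along
    infinitely many step sizes suffices. Convergence itself rests on a one-sided increment
    inequality for real absolutely continuous functions. *)

(* [R[i]] carries several convertible but syntactically different algebraic
   structures; fixing one instance keeps rewriting predictable. *)
Definition Cx (R : realType) : numClosedFieldType := R[i]%C.

(** * Real and imaginary parts, conjugation and modulus *)

Section Modulus.
Context {R : realType}.
Implicit Types z w : Cx R.

Definition re z : R := complex.Re z.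
Definition im z : R := complex.Im z.
Definition cx (a b : R) : Cx R := (a +i* b)%C.
Definition cj z : Cx R := conjc z.
Definition nc z : R := ComplexField.Normc.normc z.

Lemma cxE z : z = cx (re z) (im z).
Proof. by case: z. Qed.

Lemma cxP z w : re z = re w -> im z = im w -> z = w.
Proof. by rewrite [z]cxE [w]cxE /= /re /im /= => -> ->. Qed.

Lemma re_cx a b : re (cx a b) = a. Proof. by []. Qed.
Lemma im_cx a b : im (cx a b) = b. Proof. by []. Qed.
Lemma reD z w : re (z + w) = re z + re w. Proof. by case: z w => ? ? []. Qed.
Lemma imD z w : im (z + w) = im z + im w. Proof. by case: z w => ? ? []. Qed.
Lemma reN z : re (- z) = - re z. Proof. by case: z. Qed.
Lemma imN z : im (- z) = - im z. Proof. by case: z. Qed.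
Lemma reM z w : re (z * w) = re z * re w - im z * im w.
Proof. by case: z w => ? ? []. Qed.
Lemma imM z w : im (z * w) = re z * im w + im z * re w.
Proof. by case: z w => ? ? []. Qed.
Lemma re0 : re 0 = 0. Proof. by []. Qed.
Lemma im0 : im 0 = 0. Proof. by []. Qed.
Lemma re1 : re 1 = 1. Proof. by []. Qed.
Lemma im1 : im 1 = 0. Proof. by []. Qed.
Lemma re_cj z : re (cj z) = re z. Proof. by case: z. Qed.
Lemma im_cj z : im (cj z) = - im z. Proof. by case: z. Qed.

Definition reimE := (reD, imD, reN, imN, reM, imM, re0, im0, re1, im1, re_cj,
  im_cj, re_cx, im_cx).

Lemma cjM z w : cj (z * w) = cj z * cj w.
Proof. by apply: cxP; rewrite !reimE; ring. Qed.

Lemma cjD z w : cj (z + w) = cj z + cj w.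
Proof. by apply: cxP; rewrite !reimE; ring. Qed.

Lemma cjK z : cj (cj z) = z.
Proof. by apply: cxP; rewrite !reimE // opprK. Qed.

Lemma cj1 : cj 1 = 1.
Proof. by apply: cxP; rewrite !reimE ?oppr0. Qed.

Lemma cjN z : cj (- z) = - cj z.
Proof. by apply: cxP; rewrite !reimE. Qed.

Lemma nc_ge0 z : 0 <= nc z.
Proof. by case: z => a b; exact: sqrtr_ge0. Qed.

Lemma nc_sqr z : nc z ^+ 2 = re z ^+ 2 + im z ^+ 2.
Proof. by case: z => a b; rewrite sqr_sqrtr // addr_ge0 // sqr_ge0. Qed.

Lemma ncM z w : nc (z * w) = nc z * nc w.
Proof. exact: ComplexField.Normc.normcM. Qed.

Lemma ncD z w : nc (z + w) <= nc z + nc w.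
Proof. exact: le_normcD. Qed.

Lemma ncN z : nc (- z) = nc z.
Proof. exact: normcN. Qed.

Lemma nc_cj z : nc (cj z) = nc z.
Proof. by case: z => a b; rewrite /nc /= sqrrN. Qed.

Lemma ncV z : nc z^-1 = (nc z)^-1.
Proof. exact: ComplexField.Normc.normcV. Qed.

Lemma nc_real (x : R) : nc (cx x 0) = `|x|.
Proof. by rewrite /nc /= expr0n addr0 sqrtr_sqr. Qed.

Lemma nc0 : nc 0 = 0.
Proof. exact: ComplexField.Normc.normc0. Qed.

Lemma nc1 : nc 1 = 1.
Proof. exact: ComplexField.Normc.normc1. Qed.

Lemma nc_eq0 z : (nc z == 0) = (z == 0).
Proof.
apply/eqP/eqP => [|->]; last exact: nc0.
exact: ComplexField.Normc.eq0_normc.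
Qed.

Lemma nc_gt0 z : (0 < nc z) = (z != 0).
Proof. by rewrite lt_def nc_eq0 nc_ge0 andbT. Qed.

Lemma ncX z n : nc (z ^+ n) = nc z ^+ n.
Proof. by elim: n => [|n IH]; rewrite ?expr0 ?nc1 // !exprS ncM IH. Qed.

Lemma re_le_nc z : re z <= nc z.
Proof.
have [h|h] := leP (re z) 0; first exact: le_trans h (nc_ge0 z).
rewrite -(@ler_pXn2r _ 2) ?nnegrE ?nc_ge0 ?(ltW h) // nc_sqr.
by rewrite lerDl sqr_ge0.
Qed.

Lemma ncB z w : nc (z - w) <= nc z + nc w.
Proof. by rewrite -(ncN w) ncD. Qed.

Lemma ncC z w : nc (z - w) = nc (w - z).
Proof. by rewrite -ncN opprB. Qed.

Lemma mul_cj z : z * cj z = cx (nc z ^+ 2) 0.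
Proof. by apply: cxP; rewrite !reimE ?nc_sqr; ring. Qed.

Lemma nc_i : nc (cx 0 1) = 1.
Proof. by apply/eqP; rewrite -(@eqrXn2 _ 2) ?nc_ge0 // nc_sqr !reimE; apply/eqP; ring. Qed.

Lemma nc_cx_le (a b : R) : nc (cx a b) <= `|a| + `|b|.
Proof.
have -> : cx a b = cx a 0 + cx 0 1 * cx b 0.
  by apply: cxP; rewrite !reimE; ring.
by apply: le_trans (ncD _ _) _; rewrite ncM !nc_real nc_i mul1r.
Qed.

End Modulus.

Arguments cj : simpl never.

Section SzegoRecursion.
Context {R : realType}.
Implicit Types (g : nat -> Cx R) (z : Cx R) (x : Cx R * Cx R).

(** The step matrix is [[1, g], [cj g, 1]] diag(z, 1), without the usual normalisation by (1 -
    |g|^2)^(-1/2). It is therefore polynomial in [z], and the missing factors are collected in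
    [defect]. *)
Fixpoint szego g z x n : Cx R * Cx R :=
  if n is m.+1 then
    let y := szego g z x m in
    (z * y.1 + g m * y.2, y.2 + cj (g m) * (z * y.1))
  else x.

Definition defect g n : R := \prod_(k < n) (1 - nc (g k) ^+ 2).

Lemma szego_comb g z x y (a b : Cx R) n :
  szego g z (a * x.1 + b * y.1, a * x.2 + b * y.2) n =
  (a * (szego g z x n).1 + b * (szego g z y n).1,
   a * (szego g z x n).2 + b * (szego g z y n).2).
Proof.
by elim: n => [//|n IH] /=; rewrite IH /=; congr (_, _); ring.
Qed.

(** The matrix [[1, c], [cj c, 1]] multiplies the indefinite form |v|^2 - |u|^2 by 1 - |c|^2; the
    factor |z|^2 comes from diag(z, 1). *)
Lemma szego_step_form (c z u v : Cx R) :
  nc (v + cj c * (z * u)) ^+ 2 - nc (z * u + c * v) ^+ 2 =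
  (1 - nc c ^+ 2) * (nc v ^+ 2 - nc z ^+ 2 * nc u ^+ 2).
Proof.
by rewrite !nc_sqr !reimE; ring.
Qed.

Lemma defectS g n : defect g n.+1 = (1 - nc (g n) ^+ 2) * defect g n.
Proof. by rewrite /defect big_ord_recr /= mulrC. Qed.

Lemma defect_ge0 g n : (forall k, nc (g k) <= 1) -> 0 <= defect g n.
Proof.
move=> hg; apply: prodr_ge0 => k _.
by rewrite subr_ge0 expr_le1 // nc_ge0.
Qed.

Lemma defect_le g m n : (forall k, nc (g k) <= 1) -> (m <= n)%N ->
  defect g n <= defect g m.
Proof.
move=> hg; elim: n => [|n IH]; first by rewrite leqn0 => /eqP ->.
rewrite leq_eqVlt => /orP[/eqP -> //|]; rewrite ltnS => /IH h.
rewrite defectS; apply: le_trans h.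
rewrite ler_piMl ?defect_ge0 // lerBlDr lerDl sqr_ge0 //.
Qed.

Lemma defect_ge g n : (forall k, nc (g k) <= 1) ->
  1 - \sum_(k < n) nc (g k) ^+ 2 <= defect g n.
Proof.
move=> hg; elim: n => [|n IH].
  by rewrite /defect !big_ord0 subr0.
rewrite defectS big_ord_recr /=.
have h1 : defect g n <= 1.
  by rewrite -[leRHS](_ : defect g 0 = 1) ?defect_le // /defect big_ord0.
have h0 := defect_ge0 n hg.
have hs : 0 <= nc (g n) ^+ 2 by exact: sqr_ge0.
nra.
Qed.

Definition energy (y : Cx R * Cx R) : R := nc y.2 ^+ 2 - nc y.1 ^+ 2.

(** Each step turns the energy X into (1 - |g|^2) (X + (1 - |z|^2) |u|^2). With normalised steps
    this telescopes to the Christoffel-Darboux identity; here the factors 1 - |g|^2 leave a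
    two-sided estimate instead. The assumption on [x] makes the initial energy nonnegative. *)
Lemma szego_energy g z x n : (forall k, nc (g k) <= 1) -> nc z <= 1 ->
  nc x.1 <= nc x.2 ->
  let S := energy x +
    (1 - nc z ^+ 2) * \sum_(k < n) nc (szego g z x k).1 ^+ 2 in
  (defect g n * S <= energy (szego g z x n)) /\ (energy (szego g z x n) <= S).
Proof.
move=> hg hz hx; pose X k := energy (szego g z x k).
have z0 : 0 <= 1 - nc z ^+ 2 by rewrite subr_ge0 expr_le1 // nc_ge0.
elim: n => [|n IH] /=.
  by rewrite /defect !big_ord0 mulr0 addr0 mul1r lexx.
rewrite -/(szego g z x n.+1) -/(X n.+1).
have hc : 0 <= 1 - nc (g n) ^+ 2 <= 1.
  rewrite subr_ge0 expr_le1 ?nc_ge0 // ?hg //=.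
  by rewrite lerBlDr lerDl sqr_ge0.
have XS : X n.+1 = (1 - nc (g n) ^+ 2) *
    (X n + (1 - nc z ^+ 2) * nc (szego g z x n).1 ^+ 2).
  by rewrite /X /energy /= szego_step_form; ring.
have X0 : 0 <= X 0%N.
  by rewrite /X /= subr_ge0 ler_pXn2r // nnegrE nc_ge0.
move: IH; rewrite -/(X n) -/(X 0%N); set S := X 0%N + _ => /= -[h1 h2].
rewrite XS defectS big_ord_recr /=.
set t := (1 - nc z ^+ 2) * nc (szego g z x n).1 ^+ 2.
have -> : X 0%N + (1 - nc z ^+ 2) * (\sum_(k < n) nc (szego g z x k).1 ^+ 2 +
    nc (szego g z x n).1 ^+ 2) = S + t by rewrite /S /t mulrDr addrA.
have t0 : 0 <= t by rewrite mulr_ge0 // sqr_ge0.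
have S0 : 0 <= S.
  by rewrite addr_ge0 // mulr_ge0 // sumr_ge0 // => k _; exact: sqr_ge0.
have d0 := defect_ge0 n hg.
have d1 : defect g n <= 1.
  by rewrite -[leRHS](_ : defect g 0 = 1) ?defect_le // /defect big_ord0.
case/andP: hc => hc0 hc1.
have Xn0 : 0 <= X n by apply: le_trans h1; rewrite mulr_ge0.
split.
  rewrite -mulrA; apply: ler_wpM2l => //.
  rewrite mulrDr lerD //; by rewrite ler_piMl.
apply: (@le_trans _ _ (X n + t)); last by rewrite lerD2r.
by rewrite ler_piMl // addr_ge0.
Qed.

(* Transposition: the matrix products are also contractive for the indefinite
   form when acting on row vectors. *)
Lemma szego_row g z (c d : Cx R) n : (forall k, nc (g k) <= 1) -> nc z <= 1 ->
  nc c <= nc d ->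
  exists c' d', nc c' <= nc d' /\ forall x,
    c * (szego g z x n).1 + d * (szego g z x n).2 = c' * x.1 + d' * x.2.
Proof.
move=> hg hz; elim: n c d => [|n IH] c d hcd; first by exists c, d.
have h : nc (z * (c + d * cj (g n))) <= nc (c * g n + d).
  rewrite -(@ler_pXn2r _ 2) ?nnegrE ?nc_ge0 //.
  apply: (@le_trans _ _ (nc (c + d * cj (g n)) ^+ 2)).
    by rewrite ncM exprMn ler_piMl ?sqr_ge0 // expr_le1 // nc_ge0.
  rewrite -subr_ge0.
  have -> : nc (c * g n + d) ^+ 2 - nc (c + d * cj (g n)) ^+ 2 =
      (1 - nc (g n) ^+ 2) * (nc d ^+ 2 - nc c ^+ 2).
    by rewrite !nc_sqr !reimE; ring.
  rewrite mulr_ge0 ?subr_ge0 ?expr_le1 ?nc_ge0 // ler_pXn2r ?nnegrE ?nc_ge0 //.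
have [c' [d' [hcd' E]]] := IH _ _ h.
exists c', d'; split => // x; rewrite -E /=; ring.
Qed.

(** This compares the entries of the second row of the transfer matrix, so that control of its (2,2)
    entry alone bounds the second component of every solution. *)
Lemma szego_row_le g z n : (forall k, nc (g k) <= 1) -> nc z <= 1 ->
  nc (szego g z (1, 0) n).2 <= nc (szego g z (0, 1) n).2.
Proof.
move=> hg hz.
have h : nc (0 : Cx R) <= nc (1 : Cx R) by rewrite nc0 nc_ge0.
have [c' [d' [hcd E]]] := szego_row n hg hz h.
have := E (1, 0); rewrite mul0r add0r mul1r mulr1 mulr0 addr0 => ->.
by have := E (0, 1); rewrite mul0r add0r mul1r mulr1 mulr0 add0r => ->.
Qed.

(** The second component changes only by a multiple of [z], so its value at 0 stays 1. *)
Lemma szego_poly g n : exists p : {poly Cx R}, p.[0] = 1 /\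
  forall z, p.[z] = (szego g z (0, 1) n).2.
Proof.
suff [p [q [q0 h]]] : exists p q : {poly Cx R}, q.[0] = 1 /\
    forall z, szego g z (0, 1) n = (p.[z], q.[z]).
  by exists q; split => // z; rewrite h.
elim: n => [|n [p [q [q0 h]]]].
  exists 0, 1; split=> [|z]; first exact: hornerC.
  by rewrite /= horner0 hornerC.
exists ('X * p + g n *: q), (q + cj (g n) *: ('X * p)).
split => [|z].
  by rewrite hornerD hornerZ hornerM hornerX mul0r mulr0 addr0.
by rewrite /= h /= !hornerE.
Qed.

(** The column (0, 1) has energy 1, and |alpha|^2 dominates the final energy. *)
Lemma szego_alpha_ge g z n : (forall k, nc (g k) <= 1) -> nc z <= 1 ->
  defect g n <= nc (szego g z (0, 1) n).2 ^+ 2.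
Proof.
move=> hg hz.
have h01 : nc (0 : Cx R) <= nc (1 : Cx R) by rewrite nc0 nc_ge0.
have [h _] := @szego_energy g z (0, 1) n hg hz h01.
have d0 := defect_ge0 n hg.
have z0 : 0 <= 1 - nc z ^+ 2 by rewrite subr_ge0 expr_le1 // nc_ge0.
have hS : 0 <= (1 - nc z ^+ 2) *
    \sum_(k < n) nc (szego g z (0, 1) k).1 ^+ 2.
  by rewrite mulr_ge0 // sumr_ge0 // => k _; exact: sqr_ge0.
have e1 : energy ((0, 1) : Cx R * Cx R) = 1.
  by rewrite /energy [X in X - _](_ : _ = nc (1 : Cx R) ^+ 2) //
     [X in _ - X](_ : _ = nc (0 : Cx R) ^+ 2) // nc0 nc1 expr1n expr0n subr0.
rewrite e1 in h.
apply: (@le_trans _ _ (energy (szego g z (0, 1) n))); last first.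
  by rewrite /energy lerBlDr lerDl sqr_ge0.
by apply: le_trans h; rewrite ler_peMr // lerDl.
Qed.

End SzegoRecursion.

(** * From a bound on alpha inside the disc to Cesaro bounds on the circle *)

Section Gronwall.
Context {R : realType}.
Implicit Types (g : nat -> Cx R) (z : Cx R) (x : Cx R * Cx R).

Lemma ler_sum_ord (F : nat -> R) m n : (forall k, 0 <= F k) -> (m <= n)%N ->
  \sum_(k < m) F k <= \sum_(k < n) F k.
Proof.
move=> F0; elim: n => [|n IH]; first by rewrite leqn0 => /eqP ->.
rewrite leq_eqVlt => /orP[/eqP -> //|]; rewrite ltnS => /IH h.
by rewrite big_ord_recr /= (le_trans h) // lerDl.
Qed.

Lemma szego_split g z x n :
  szego g z x n =
  (x.1 * (szego g z (1, 0) n).1 + x.2 * (szego g z (0, 1) n).1,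
   x.1 * (szego g z (1, 0) n).2 + x.2 * (szego g z (0, 1) n).2).
Proof.
rewrite -szego_comb; congr (szego g z _ n).
by case: x => a b; congr (_, _); rewrite !(mulr1, mulr0, addr0, add0r).
Qed.

Definition msize x : R := nc x.1 + nc x.2.

Lemma msize_ge0 x : 0 <= msize x.
Proof. by rewrite addr_ge0 // nc_ge0. Qed.

Lemma msize_step g z x n : (forall k, nc (g k) <= 1) -> nc z <= 1 ->
  msize (szego g z x n.+1) <= 2 * msize (szego g z x n).
Proof.
move=> hg hz; rewrite /msize /=.
set u := (szego g z x n).1; set v := (szego g z x n).2.
have h1 := ncD (z * u) (g n * v).
have h2 := ncD v (cj (g n) * (z * u)).
have zu : nc (z * u) <= nc u by rewrite ncM ler_piMl // nc_ge0.
have gv : nc (g n * v) <= nc v by rewrite ncM ler_piMl // nc_ge0.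
have gzu : nc (cj (g n) * (z * u)) <= nc u.
  by rewrite ncM nc_cj (le_trans _ zu) // ler_piMl // nc_ge0.
lra.
Qed.

(** Unimodular initial entries have energy 0, so the energy at step N is comparable to (1 - |z|^2)
    times the sum of |u_k|^2. Since 1 - |z|^2 is at least 1/(2n), bounding the last energy bounds
    that sum by O(n). *)
Lemma szego_interior_sum g z x n N : (forall k, nc (g k) <= 1) ->
  (0 < n <= N)%N -> 2^-1 <= defect g N -> nc z = 1 - (2 * n%:R)^-1 ->
  nc (szego g z (0, 1) N).2 <= 2 -> nc x.1 = 1 -> nc x.2 = 1 ->
  \sum_(k < n) msize (szego g z x k) ^+ 2 <= 320 * n%:R.
Proof.
move=> hg /andP[n0 nN] hd zE ha x1 x2.
have nR : 1 <= n%:R :> R by rewrite ler1n.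
set r := (2 * n%:R)^-1 in zE.
have rn : r * (2 * n%:R) = 1 by rewrite mulVf // lt0r_neq0 //; lra.
have r0 : 0 < r by rewrite invr_gt0; lra.
have r1 : r <= 2^-1 by rewrite lef_pV2 ?posrE //; lra.
have hz : nc z <= 1 by rewrite zE; lra.
have hx : nc x.1 <= nc x.2 by rewrite x1 x2.
have e0 : energy x = 0 by rewrite /energy x1 x2 subrr.
(* Both initial entries have modulus 1, so the second component is at most the sum of the second-row
   entries, and [szego_row_le] bounds each by 2. *)
have vN : nc (szego g z x N).2 <= 4.
  rewrite szego_split /= (le_trans (ncD _ _)) // !ncM x1 x2 !mul1r.
  by have := szego_row_le N hg hz; lra.
set c := 1 - nc z ^+ 2.
have cr : r <= c by rewrite /c zE; nra.
pose U k := nc (szego g z x k).1 ^+ 2.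
have U0 k : 0 <= U k by exact: sqr_ge0.
set S := \sum_(k < N) U k.
have S0 : 0 <= S by apply: sumr_ge0 => k _.
(* The final energy is at most 4^2 = 16 and [defect] is at least 1/2. *)
have cS : c * S <= 32.
  have [h _] := szego_energy N hg hz hx.
  rewrite e0 add0r -/c -/S in h.
  have v0 := nc_ge0 (szego g z x N).2.
  have u0 : 0 <= nc (szego g z x N).1 ^+ 2 by exact: sqr_ge0.
  have : energy (szego g z x N) <= 16 by rewrite /energy; nra.
  have : 0 <= c * S by apply: mulr_ge0 => //; lra.
  move: h; set t := c * S => h t0 e16; nra.
have SN : S <= 64 * n%:R.
  have h : r * S <= 32 by apply: le_trans cS; apply: ler_wpM2r.
  have -> : S = (r * S) * (2 * n%:R) by rewrite mulrAC rn mul1r.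
  by nra.
(* The upper half of the energy estimate recovers the second component from the first at every
   intermediate step. *)
have V k : (k < n)%N -> nc (szego g z x k).2 ^+ 2 <= U k + 32.
  move=> kn; have [_ h] := szego_energy k hg hz hx.
  rewrite e0 add0r -/c in h.
  have : c * \sum_(j < k) U j <= 32.
    apply: le_trans cS; apply: ler_wpM2l; first lra.
    by apply: ler_sum_ord => //; rewrite (leq_trans (ltnW kn)).
  by move: h; rewrite /energy /U; lra.
apply: (@le_trans _ _ (\sum_(k < n) (4 * U k + 64))).
  apply: ler_sum => k _; rewrite /msize.
  have := V k (ltn_ord k); rewrite -/(U k) /U.
  by set a := nc _; set b := nc _ => h; nra.
rewrite big_split /= sumr_const card_ord -mulr_sumr -mulr_natr.
have : \sum_(k < n) U k <= S by exact: ler_sum_ord.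
by lra.
Qed.

Definition wronskian x y : Cx R := x.1 * y.2 - x.2 * y.1.

Lemma nc_wronskian x y : nc (wronskian x y) <= msize x * msize y.
Proof.
rewrite /wronskian /msize (le_trans (ncB _ _)) // !ncM.
have := nc_ge0 x.1; have := nc_ge0 x.2; have := nc_ge0 y.1; have := nc_ge0 y.2.
nra.
Qed.

(** One step has determinant z (1 - |g|^2). *)
Lemma wronskian_szego g z x y n : (forall k, nc (g k) <= 1) ->
  nc (wronskian (szego g z x n) (szego g z y n)) =
  nc z ^+ n * defect g n * nc (wronskian x y).
Proof.
move=> hg; elim: n => [|n IH].
  by rewrite /defect big_ord0 expr0 !mul1r.
rewrite defectS exprS.
have -> : wronskian (szego g z x n.+1) (szego g z y n.+1) =
    z * (1 - g n * cj (g n)) * wronskian (szego g z x n) (szego g z y n).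
  by rewrite /wronskian /=; ring.
rewrite !ncM IH mul_cj.
have -> : nc (1 - cx (nc (g n) ^+ 2) 0) = 1 - nc (g n) ^+ 2.
  rewrite (_ : 1 - _ = cx (1 - nc (g n) ^+ 2) 0); last first.
    by apply: cxP; rewrite !reimE // subr0.
  by rewrite nc_real ger0_norm // subr_ge0 expr_le1 // nc_ge0.
ring.
Qed.

Lemma cramer x y w : wronskian x y != 0 ->
  w.1 = wronskian w y / wronskian x y * x.1 +
        wronskian x w / wronskian x y * y.1 /\
  w.2 = wronskian w y / wronskian x y * x.2 +
        wronskian x w / wronskian x y * y.2.
Proof. by rewrite /wronskian => h; split; field. Qed.

Lemma bernoulli (r : R) n : 0 <= r <= 1 -> 1 - n%:R * r <= (1 - r) ^+ n.
Proof.
move=> /andP[r0 r1]; elim: n => [|n IH]; first by rewrite expr0 mul0r subr0.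
rewrite exprS -natr1.
have h : (1 - r) * (1 - n%:R * r) <= (1 - r) * (1 - r) ^+ n.
  by apply: ler_wpM2l => //; lra.
have : 0 <= n%:R * (r * r) by rewrite !mulr_ge0.
by lra.
Qed.

(** Here 1280 n bounds the sum of the squared sizes of the interior basis ([hm] below), and 5120 = 4
    * 1280 is the resulting Gronwall exponent; it is squared because squared sizes are summed. *)
Definition cesaro_const : R := 1280 * expR 5120 ^+ 2.

Lemma cesaro_const_ge0 : 0 <= cesaro_const.
Proof. by apply: mulr_ge0; [exact: ler0n|exact: sqr_ge0]. Qed.

(* A discrete Gronwall argument: the solution at [zeta] is expanded in a basis
   of solutions at the interior point [(1 - 1/(2n)) zeta]. *)
Lemma szego_cesaro g zeta x n N : (forall k, nc (g k) <= 1) ->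
  (0 < n <= N)%N -> 2^-1 <= defect g N -> nc zeta = 1 ->
  nc (szego g (cx (1 - (2 * n%:R)^-1) 0 * zeta) (0, 1) N).2 <= 2 ->
  \sum_(k < n) msize (szego g zeta x k) ^+ 2 <=
    cesaro_const * msize x ^+ 2 * n%:R.
Proof.
move=> hg nN hd hzeta.
set r := (2 * n%:R)^-1; set z := (X in szego g X) => ha.
have nR : 1 <= n%:R :> R by case/andP: nN => ? _; rewrite ler1n.
have n0 : n%:R != 0 :> R by rewrite gt_eqF // (lt_le_trans ltr01).
have rn : r * (2 * n%:R) = 1 by rewrite mulVf // lt0r_neq0 //; lra.
have r0 : 0 < r by rewrite invr_gt0; lra.
have r1 : r <= 2^-1 by rewrite lef_pV2 ?posrE //; lra.
have zE : nc z = 1 - r by rewrite ncM hzeta nc_real mulr1 ger0_norm //; lra.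
have hz : nc z <= 1 by rewrite zE; lra.
have r01 : 0 <= r <= 1 by lra.
have nr : n%:R * r = 2^-1 by move: rn; clear; lra.
(* A basis of solutions at [z] whose initial entries are all unimodular, as [szego_interior_sum]
   requires; its initial Wronskian is -2. *)
pose e := szego g z (1, 1); pose d := szego g z (1, -1).
have he : \sum_(k < n) msize (e k) ^+ 2 <= 320 * n%:R.
  exact: (szego_interior_sum (x := (1, 1)) hg nN hd zE ha nc1 nc1).
have hdd : \sum_(k < n) msize (d k) ^+ 2 <= 320 * n%:R.
  apply: (szego_interior_sum (x := (1, -1)) hg nN hd zE ha nc1).
  by rewrite ncN; exact: nc1.
pose m k := msize (e k) + msize (d k).
have m0 k : 0 <= m k by rewrite addr_ge0 // msize_ge0.
have hm : \sum_(k < n) m k ^+ 2 <= 1280 * n%:R.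
  apply: (@le_trans _ _ (\sum_(k < n) (2 * msize (e k) ^+ 2 +
                                       2 * msize (d k) ^+ 2))).
    apply: ler_sum => k _; rewrite /m.
    set a := msize (e k); set b := msize (d k).
    have -> : 2 * a ^+ 2 + 2 * b ^+ 2 = (a + b) ^+ 2 + (a - b) ^+ 2 by ring.
    by rewrite lerDl sqr_ge0.
  by rewrite big_split /= -!mulr_sumr; lra.
(* The bound is 2 * (1/2) * (1/2): Bernoulli gives (1 - r)^n >= 1 - n r = 1/2, and [defect]
   contributes the other half. *)
have W k : (k <= n)%N -> 2^-1 <= nc (wronskian (e k) (d k)).
  move=> kn; rewrite /e /d wronskian_szego //.
  have -> : nc (wronskian ((1, 1) : Cx R * Cx R) (1, -1)) = 2.
    rewrite /wronskian (_ : _ - _ = cx (-2) 0); last first.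
      by apply: cxP; rewrite !reimE; ring.
    by rewrite nc_real normrN ger0_norm.
  have h1 : 2^-1 <= nc z ^+ k.
    rewrite zE; apply: (@le_trans _ _ ((1 - r) ^+ n)).
      apply: le_trans (bernoulli n r01); rewrite nr; clear; lra.
    by apply: ler_wiXn2l => //; move: r0 r1; clear; lra.
  have h2 : 2^-1 <= defect g k.
    by apply: le_trans hd _; apply: defect_le => //;
      case/andP: nN => _; exact: leq_trans.
  by move: h1 h2; clear; nra.
pose y := szego g zeta x.
(* Variation of constants: [a] and [b] are the coordinates of the solution at [zeta] in the basis at
   [z]. In one step |a| + |b| grows at most by the factor 1 + (4 / n) m_k^2, and the product of
   these factors is bounded by the exponential. *)
have key k : (k <= n)%N -> exists a b : Cx R,
    [/\ (y k).1 = a * (e k).1 + b * (d k).1,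
        (y k).2 = a * (e k).2 + b * (d k).2 &
        nc a + nc b <= msize x * expR (\sum_(j < k) 4 / n%:R * m j ^+ 2)].
  elim: k => [_|k IH kn].
    exists ((x.1 + x.2) / 2), ((x.1 - x.2) / 2); split.
    - by rewrite /y /e /d /=; field.
    - by rewrite /y /e /d /=; field.
    - rewrite big_ord0 expR0 mulr1 !ncM ncV.
      have -> : nc (2 : Cx R) = 2.
        rewrite (_ : (2 : Cx R) = cx 2 0) ?nc_real ?ger0_norm //.
        by apply: cxP; rewrite !reimE ?addr0.
      have := ncD x.1 x.2; have := ncB x.1 x.2; rewrite /msize; clear; lra.
  have [a [b [y1 y2 hab]]] := IH (ltnW kn).
  have Wk := W _ kn.
  have W0 : wronskian (e k.+1) (d k.+1) != 0 by rewrite -nc_gt0 (lt_le_trans _ Wk) // invr_gt0.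
  (* Replacing [z] by [zeta] in one step adds [(zeta - z) * (y k).1] times this vector; Cramer's
     rule distributes it over the basis. *)
  pose w : Cx R * Cx R := (1, cj (g k)).
  have [c1 c2] := cramer w W0.
  set W1 := wronskian (e k.+1) (d k.+1) in Wk W0 c1 c2.
  pose t := (zeta - z) * (y k).1.
  pose a' := t * (wronskian w (d k.+1) / W1).
  pose b' := t * (wronskian (e k.+1) w / W1).
  exists (a + a'), (b + b'); split.
  - have -> : (y k.+1).1 = a * (e k.+1).1 + b * (d k.+1).1 + t * w.1.
      rewrite /y /= -/(y k) /t y1 y2 /e /d /=; ring.
    rewrite c1 /a' /b'; ring.
  - have -> : (y k.+1).2 = a * (e k.+1).2 + b * (d k.+1).2 + t * w.2.
      rewrite /y /= -/(y k) /t y1 y2 /e /d /=; ring.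
    rewrite c2 /a' /b'; ring.
  have ht : nc t <= r * ((nc a + nc b) * m k).
    rewrite /t ncM (_ : zeta - z = cx r 0 * zeta); last first.
      by rewrite /z; apply: cxP; rewrite !reimE; ring.
    rewrite ncM nc_real hzeta mulr1 (ger0_norm (ltW r0)).
    apply: ler_wpM2l; first exact: ltW.
    rewrite y1 (le_trans (ncD _ _)) // !ncM /m /msize.
    have := nc_ge0 (e k).1; have := nc_ge0 (e k).2; have := nc_ge0 (d k).1.
    have := nc_ge0 (d k).2; have := nc_ge0 a; have := nc_ge0 b.
    by clear; nra.
  have mw : msize w <= 2.
    rewrite (_ : msize w = nc 1 + nc (cj (g k))) // nc_cj nc1.
    by have := hg k; clear; lra.
  have Wi : 0 <= (nc W1)^-1 <= 2.
    rewrite invr_ge0 nc_ge0 /= -[leRHS]invrK lef_pV2 ?posrE ?invr_gt0 //.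
    by rewrite (lt_le_trans _ Wk) // invr_gt0.
  have mk : m k.+1 <= 2 * m k.
    rewrite /m; have := msize_step (1, 1) k hg hz.
    have := msize_step (1, -1) k hg hz; rewrite /e /d; clear; lra.
  have ha' : nc a' <= nc t * (4 * msize (d k.+1)).
    rewrite ncM; apply: ler_wpM2l; first exact: nc_ge0.
    rewrite ncM ncV; have := nc_wronskian w (d k.+1).
    have := msize_ge0 (d k.+1); have := msize_ge0 w.
    have := nc_ge0 (wronskian w (d k.+1)).
    move: Wi mw; set p := nc (wronskian _ _); set q := _^-1.
    by clear=> /andP[q0 q1] mw p0 w0 D0 h; nra.
  have hb' : nc b' <= nc t * (4 * msize (e k.+1)).
    rewrite ncM; apply: ler_wpM2l; first exact: nc_ge0.
    rewrite ncM ncV; have := nc_wronskian (e k.+1) w.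
    have := msize_ge0 (e k.+1); have := msize_ge0 w.
    have := nc_ge0 (wronskian (e k.+1) w).
    move: Wi mw; set p := nc (wronskian _ _); set q := _^-1.
    by clear=> /andP[q0 q1] mw p0 w0 D0 h; nra.
  have hs : nc a' + nc b' <= (nc a + nc b) * (4 / n%:R * m k ^+ 2).
    apply: (@le_trans _ _ (nc t * (4 * m k.+1))).
      by rewrite /m; move: ha' hb'; clear; lra.
    apply: (@le_trans _ _ (nc t * (8 * m k))).
      apply: ler_wpM2l; first exact: nc_ge0.
      by move: mk; clear; lra.
    have -> : 4 / n%:R = 8 * r by rewrite /r; clear -n0; field.
    have -> : (nc a + nc b) * (8 * r * m k ^+ 2) =
      r * ((nc a + nc b) * m k) * (8 * m k) by ring.
    by apply: ler_wpM2r => //; rewrite mulr_ge0.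
  rewrite big_ord_recr /= expRD mulrA.
  set q := 4 / n%:R * m k ^+ 2 in hs *.
  have q0 : 0 <= q by rewrite mulr_ge0 ?sqr_ge0 // divr_ge0 //; lra.
  apply: (@le_trans _ _ ((nc a + nc b) * (1 + q))).
    by move: hs (ncD a a') (ncD b b'); clear; lra.
  apply: ler_pM => //; first by rewrite addr_ge0 // nc_ge0.
    by rewrite addr_ge0.
  exact: expR_ge1Dx.
set Q := msize x * expR 5120.
have hk k : (k < n)%N -> msize (y k) <= Q * m k.
  move=> kn; have [a [b [y1 y2 hab]]] := key k (ltnW kn).
  apply: (@le_trans _ _ ((nc a + nc b) * m k)).
    have h1 := ncD (a * (e k).1) (b * (d k).1).
    have h2 := ncD (a * (e k).2) (b * (d k).2).
    rewrite -y1 !ncM in h1; rewrite -y2 !ncM in h2.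
    have h3 : 0 <= nc a * msize (d k) by rewrite mulr_ge0 ?nc_ge0 ?msize_ge0.
    have h4 : 0 <= nc b * msize (e k) by rewrite mulr_ge0 ?nc_ge0 ?msize_ge0.
    by rewrite /m; move: h1 h2 h3 h4; rewrite /msize; clear; lra.
  apply: ler_wpM2r => //; apply: le_trans hab _.
  apply: ler_wpM2l; first exact: msize_ge0.
  rewrite ler_expR -mulr_sumr.
  have : \sum_(j < k) m j ^+ 2 <= 1280 * n%:R.
    apply: le_trans hm; apply: (ler_sum_ord (F := fun j => m j ^+ 2)).
      by move=> j; exact: sqr_ge0.
    exact: ltnW.
  move=> h; apply: (@le_trans _ _ (4 / n%:R * (1280 * n%:R))).
    by apply: ler_wpM2l => //; rewrite divr_ge0 //; lra.
  have -> : 4 / n%:R * (1280 * n%:R) = 5120 :> R.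
    by rewrite mulrCA divfK // -natrM.
  by [].
apply: (@le_trans _ _ (\sum_(k < n) Q ^+ 2 * m k ^+ 2)).
  apply: ler_sum => k _; rewrite -exprMn.
  rewrite ler_pXn2r ?nnegrE ?msize_ge0 ?hk //.
  by rewrite mulr_ge0 // mulr_ge0 ?msize_ge0 ?expR_ge0.
rewrite -mulr_sumr (le_trans (ler_wpM2l (sqr_ge0 _) hm)) //.
by rewrite /Q exprMn /cesaro_const le_eqVlt; apply/orP; left; apply/eqP; ring.
Qed.

End Gronwall.

(** * Poisson integrals on the circle *)

Section DiscAlgebra.
Context {R : realType}.
Implicit Types (f g : Cx R -> Cx R) (p q : {poly Cx R}) (z r : Cx R).

(** Membership in the disc algebra. The mean value property of polynomials passes to such limits,
    which is all the function theory needed for 1/alpha. *)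
Definition disc_approx f := forall e : R, 0 < e -> exists p,
  forall z, nc z <= 1 -> nc (f z - p.[z]) <= e.

Lemma disc_bounded_poly p : exists2 B : R, 0 <= B &
  forall z, nc z <= 1 -> nc p.[z] <= B.
Proof.
elim/poly_ind: p => [|p c [B B0 hB]].
  by exists 0 => // z _; rewrite horner0 nc0.
exists (B + nc c) => [|z hz]; first by rewrite addr_ge0 // nc_ge0.
rewrite hornerMXaddC (le_trans (ncD _ _)) // lerD2r ncM.
by apply: le_trans (hB z hz); rewrite ler_piMr // nc_ge0.
Qed.

Lemma disc_bounded f : disc_approx f -> exists2 B : R, 0 <= B &
  forall z, nc z <= 1 -> nc (f z) <= B.
Proof.
move=> /(_ 1 ltr01)[p hp]; have [B B0 hB] := disc_bounded_poly p.
exists (1 + B) => [|z hz]; first by rewrite addr_ge0.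
rewrite -[f z](subrK p.[z]) (le_trans (ncD _ _)) //.
by rewrite lerD ?hp ?hB.
Qed.

Lemma disc_approx_poly p : disc_approx (fun z => p.[z]).
Proof. by move=> e e0; exists p => z _; rewrite subrr nc0 ltW. Qed.

Lemma disc_approx_cst c : disc_approx (fun=> c).
Proof. by move=> e e0; exists c%:P => z _; rewrite hornerC subrr nc0 ltW. Qed.

Lemma disc_approxD f g : disc_approx f -> disc_approx g ->
  disc_approx (fun z => f z + g z).
Proof.
move=> hf hg e e0; have e20 : 0 < e / 2 by rewrite divr_gt0.
have [p hp] := hf _ e20; have [q hq] := hg _ e20.
exists (p + q) => z hz; rewrite hornerD opprD addrACA.
by rewrite (le_trans (ncD _ _)) // [leRHS]splitr lerD ?hp ?hq.
Qed.

Lemma disc_approxM f g : disc_approx f -> disc_approx g ->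
  disc_approx (fun z => f z * g z).
Proof.
move=> hf hg e e0; have [B B0 hB] := disc_bounded hf.
have e1 : 0 < e / 2 / (B + 1) by rewrite !divr_gt0 // ltr_wpDl.
have [q hq] := hg _ e1; have [D D0 hD] := disc_bounded_poly q.
have e2 : 0 < e / 2 / (D + 1) by rewrite !divr_gt0 // ltr_wpDl.
have [p hp] := hf _ e2; exists (p * q) => z hz.
have -> : f z * g z - (p * q).[z] =
    f z * (g z - q.[z]) + (f z - p.[z]) * q.[z] by rewrite hornerM; ring.
rewrite (le_trans (ncD _ _)) // [leRHS]splitr !ncM lerD //.
  apply: (@le_trans _ _ (B * (e / 2 / (B + 1)))).
    by apply: ler_pM; rewrite ?nc_ge0 ?hB ?hq.
  rewrite mulrA ler_pdivrMr ?ltr_wpDl // mulrC ler_wpM2l ?lerDl //.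
  by rewrite divr_ge0 // ltW.
apply: (@le_trans _ _ (e / 2 / (D + 1) * D)).
  by apply: ler_pM; rewrite ?nc_ge0 ?hp ?hD.
rewrite mulrAC ler_pdivrMr ?ltr_wpDl // ler_wpM2l ?lerDl //.
by rewrite divr_ge0 // ltW.
Qed.

Lemma eq_disc_approx f g : (forall z, nc z <= 1 -> f z = g z) ->
  disc_approx f -> disc_approx g.
Proof.
by move=> fg hf e e0; have [p hp] := hf e e0; exists p => z hz; rewrite -fg ?hp.
Qed.

Lemma exprn_small (s e : R) : 0 <= s < 1 -> 0 < e -> exists n, s ^+ n <= e.
Proof.
move=> /andP[s0 s1] e0; have /cvg_expr h : `|s| < 1 by rewrite ger0_norm.
have /cvgrPdist_le /(_ e e0) [n _ hn] := h.
exists n; have := hn n (leqnn n).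
by rewrite /= sub0r normrN ger0_norm // exprn_ge0.
Qed.

(** Truncating the geometric series of 1/(z - r) after n terms leaves the error (z/r)^n / (z - r),
    and |z - r| >= |r| - 1 on the disc. *)
Lemma disc_approx_pole r : 1 < nc r -> disc_approx (fun z => ('X - r%:P).[z]^-1).
Proof.
move=> hr e e0.
have r0 : 0 < nc r by apply: lt_trans hr.
have rn0 : r != 0 by rewrite -nc_gt0.
have s1 : 0 <= (nc r)^-1 < 1 by rewrite invr_ge0 ltW //= invf_lt1.
have d0 : 0 < nc r - 1 by rewrite subr_gt0.
have [n hn] := exprn_small s1 (mulr_gt0 e0 d0).
exists (- r^-1 *: \sum_(j < n) (r^-1) ^+ j *: 'X^j) => z hz.
have dz : nc r - 1 <= nc (z - r).
  rewrite lerBlDr ncC; have := ncD (r - z) z; rewrite subrK => h.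
  by apply: le_trans h _; rewrite lerD2l.
have zr : z - r != 0 by rewrite -nc_gt0 (lt_le_trans d0).
rewrite !hornerE horner_sum.
have -> : \sum_(i < n) ((r^-1) ^+ i *: 'X^i).[z] = \sum_(i < n) (z / r) ^+ i.
  by apply: eq_bigr => i _; rewrite hornerZ hornerXn mulrC exprMn.
have hx : (z / r) ^+ n - 1 = (z / r - 1) * \sum_(i < n) (z / r) ^+ i.
  exact: subrX1.
have hS : (z - r) * (r^-1 * \sum_(i < n) (z / r) ^+ i) = (z / r) ^+ n - 1.
  rewrite hx mulrA; congr (_ * _); by field.
have -> : (z - r)^-1 - - r^-1 * \sum_(i < n) (z / r) ^+ i =
    (z / r) ^+ n / (z - r).
  apply: (mulfI zr); rewrite mulrBr mulNr mulrN opprK hS mulfV //.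
  by rewrite mulrCA mulfV // mulr1 subrKC.
rewrite ncM ncV ncX ncM ncV ler_pdivrMr; last exact: lt_le_trans dz.
apply: (@le_trans _ _ (e * (nc r - 1))); last by rewrite ler_pM2l.
apply: le_trans hn; apply: lerXn2r;
  rewrite ?nnegrE ?mulr_ge0 ?invr_ge0 ?nc_ge0 //.
by rewrite ler_piMl // invr_ge0 nc_ge0.
Qed.

(** All roots of [p] lie outside the closed disc, so 1/p is a constant times a product of simple
    poles covered by [disc_approx_pole]. *)
Lemma disc_approxV p : (forall z, nc z <= 1 -> p.[z] != 0) ->
  disc_approx (fun z => p.[z]^-1).
Proof.
move=> p0; have [rs E] := closed_field_poly_normal p.
have lp0 : lead_coef p != 0.
  apply/eqP => l0; have := p0 0; rewrite nc0 ler01 E l0 scale0r horner0 eqxx.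
  by move=> /(_ isT).
have hrs r : r \in rs -> 1 < nc r.
  move=> rin; rewrite ltNge; apply/negP => /p0 /eqP; apply.
  rewrite E hornerZ (_ : (\prod_(z <- rs) _).[r] = 0) ?mulr0 //.
  by apply/eqP; rewrite -/(root _ r) root_prod_XsubC.
rewrite {}E {p0}; move: (lead_coef p) lp0 => a a0.
apply: (@eq_disc_approx (fun z => a^-1 * (\prod_(r <- rs) ('X - r%:P)).[z]^-1)).
  by move=> z _; rewrite hornerZ invfM.
apply: disc_approxM; first exact: disc_approx_cst.
elim: rs hrs => [_|r rs IH hrs].
  apply: (@eq_disc_approx (fun=> 1)); last exact: disc_approx_cst.
  by move=> z _; rewrite big_nil hornerC invr1.
apply: (@eq_disc_approx (fun z => ('X - r%:P).[z]^-1 *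
    (\prod_(r <- rs) ('X - r%:P)).[z]^-1)).
  by move=> z _; rewrite big_cons hornerM invfM.
apply: disc_approxM; first by apply: disc_approx_pole; rewrite hrs ?mem_head.
by apply: IH => s hs; rewrite hrs // in_cons hs orbT.
Qed.

End DiscAlgebra.

(** * Integrals of continuous functions over segments *)

Section ContinuousIntegral.
Context {R : realType}.
Local Notation mu := (@lebesgue_measure R).
Implicit Types (f g F : R -> R) (a b c : R).

Definition sint a b f : R := (\int[mu]_(t in `[a, b]) f t)%R.

Lemma continuous_itv_integrable f a b : continuous f ->
  mu.-integrable `[a, b] (EFin \o f).
Proof.
move=> cf; apply: continuous_compact_integrable; first exact: segment_compact.
exact/continuous_subspaceT.
Qed.

Lemma eq_sint f g a b : (forall t, f t = g t) -> sint a b f = sint a b g.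
Proof. by move=> fg; congr (sint a b _); apply/funext. Qed.

Lemma sintD f g a b : continuous f -> continuous g ->
  sint a b (fun t => f t + g t) = sint a b f + sint a b g.
Proof. by move=> cf cg; apply: RintegralD => //; exact: continuous_itv_integrable. Qed.

Lemma sintZ f c a b : continuous f ->
  sint a b (fun t => c * f t) = c * sint a b f.
Proof. by move=> cf; apply: RintegralZl => //; exact: continuous_itv_integrable. Qed.

Lemma le_sint f g a b : continuous f -> continuous g ->
  (forall t, f t <= g t) -> sint a b f <= sint a b g.
Proof.
move=> cf cg fg; apply: le_Rintegral => //; exact: continuous_itv_integrable.
Qed.

Lemma sint_cst c a b : a <= b -> sint a b (fun=> c) = c * (b - a).
Proof.
rewrite /sint Rintegral_cst //= lebesgue_measure_itv /= lte_fin le_eqVlt.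
by case/orP => [/eqP ->|->] //; rewrite ltxx subrr.
Qed.

Lemma sint_FTC F f a b : a < b -> continuous f ->
  (forall x : R, is_derive x 1 F (f x)) -> sint a b f = F b - F a.
Proof.
move=> ab cf dF.
have cF : continuous F.
  move=> x; apply/differentiable_continuous/derivable1_diffP.
  by case: (dF x).
rewrite /sint /Rintegral (@continuous_FTC2 _ f F) //.
- exact/continuous_subspaceT.
- split; first by move=> x _; case: (dF x).
    exact/cvg_at_right_filter/cF.
  exact/cvg_at_left_filter/cF.
- by move=> x _; rewrite derive1E; case: (dF x).
Qed.

End ContinuousIntegral.

(** * Continuity of complex functions and the unimodular exponential *)

Section ComplexContinuity.
Context {R : realType}.
Implicit Types (f g : R -> Cx R).

Definition ccont f := continuous (fun t => re (f t) : R) /\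
  continuous (fun t => im (f t) : R).

Lemma ccont_cst c : ccont (fun=> c).
Proof. by split; apply: cst_continuous. Qed.

Lemma ccontD f g : ccont f -> ccont g -> ccont (fun t => f t + g t).
Proof.
move=> [f1 f2] [g1 g2]; split.
  under eq_fun do rewrite reD.
  by move=> t; apply: cvgD; [exact: f1|exact: g1].
under eq_fun do rewrite imD.
by move=> t; apply: cvgD; [exact: f2|exact: g2].
Qed.

Lemma ccontM f g : ccont f -> ccont g -> ccont (fun t => f t * g t).
Proof.
move=> [f1 f2] [g1 g2]; split.
  under eq_fun do rewrite reM.
  by move=> t; apply: cvgB; apply: cvgM; [exact: f1|exact: g1|exact: f2|exact: g2].
under eq_fun do rewrite imM.
by move=> t; apply: cvgD; apply: cvgM; [exact: f1|exact: g2|exact: f2|exact: g1].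
Qed.

Lemma ccont_nc2 f : ccont f -> continuous (fun t => nc (f t) ^+ 2 : R).
Proof.
move=> [f1 f2]; under eq_fun do rewrite nc_sqr.
by move=> t; apply: cvgD; apply: (cvgM (f := fun t => _) (g := fun t => _));
  [exact: f1|exact: f1|exact: f2|exact: f2].
Qed.

Lemma invE (z : Cx R) : z != 0 ->
  z^-1 = cx (re z / nc z ^+ 2) (- im z / nc z ^+ 2).
Proof.
move=> z0; apply: (mulfI z0); rewrite mulfV //.
have h : re z ^+ 2 + im z ^+ 2 != 0.
  by rewrite -nc_sqr expf_eq0 /= nc_eq0.
by apply: cxP; rewrite !reimE nc_sqr; field.
Qed.

Lemma ccontV f : (forall t, f t != 0) -> ccont f -> ccont (fun t => (f t)^-1).
Proof.
move=> f0 cf; have c2 := ccont_nc2 cf; case: cf => f1 f2.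
have h t : nc (f t) ^+ 2 != 0 by rewrite expf_eq0 /= nc_eq0.
have cv : continuous (fun t => (nc (f t) ^+ 2)^-1 : R).
  by move=> t; apply: cvgV => //; exact: c2.
split.
  rewrite (_ : (fun t => re _) = fun t => re (f t) * (nc (f t) ^+ 2)^-1).
    by move=> t; apply: cvgM; [exact: f1|exact: cv].
  by apply/funext => t; rewrite invE.
rewrite (_ : (fun t => im _) = fun t => - im (f t) * (nc (f t) ^+ 2)^-1).
  by move=> t; apply: cvgM; [apply: cvgN; exact: f2|exact: cv].
by apply/funext => t; rewrite invE.
Qed.

Lemma ccont_horner (p : {poly Cx R}) f : ccont f -> ccont (fun t => p.[f t]).
Proof.
move=> cf; elim/poly_ind: p => [|p c IH].
  by under eq_fun do rewrite horner0; exact: ccont_cst.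
under eq_fun do rewrite hornerMXaddC.
by apply: ccontD; [apply: ccontM|exact: ccont_cst].
Qed.

Definition cexp (t : R) : Cx R := cx (cos t) (sin t).

Lemma nc_cexp t : nc (cexp t) = 1.
Proof.
apply/eqP; rewrite -(@eqrXn2 _ 2) ?nc_ge0 // expr1n nc_sqr.
by rewrite cos2Dsin2.
Qed.

Lemma cexpD s t : cexp (s + t) = cexp s * cexp t.
Proof. by apply: cxP; rewrite !reimE ?cosD ?sinD //; ring. Qed.

Lemma cexp0 : cexp 0 = 1.
Proof. by apply: cxP; rewrite !reimE ?cos0 ?sin0. Qed.

Lemma cexp_neq0 t : cexp t != 0.
Proof. by rewrite -nc_gt0 nc_cexp. Qed.

Lemma cexpX t n : cexp t ^+ n = cexp (n%:R * t).
Proof.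
elim: n => [|n IH]; first by rewrite mul0r cexp0.
by rewrite exprS IH -natr1 mulrDl mul1r addrC cexpD mulrC.
Qed.

Lemma ccont_cexp (k : R) : ccont (fun t => cexp (k * t)).
Proof.
have h : continuous (fun t : R => k * t) by exact: mulrl_continuous.
split=> t; rewrite /=.
  apply: continuous_comp; [exact: h|exact: continuous_cos].
apply: continuous_comp; [exact: h|exact: continuous_sin].
Qed.

End ComplexContinuity.

(** * Mean values and the Poisson formula on the circle *)

Section CircleMean.
Context {R : realType}.
Context (kappa : R) (kappa0 : 0 < kappa).
Implicit Types (p q : {poly Cx R}) (c : Cx R) (f : Cx R -> Cx R).

Let A : R := pi / kappa.
Let z (t : R) : Cx R := cexp (kappa * t).

Let A0 : 0 < A.
Proof. by rewrite divr_gt0 // pi_gt0. Qed.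

Let AA : - A <= A.
Proof. by rewrite ge0_cp // ltW. Qed.

Let cz : ccont z.
Proof. exact: ccont_cexp. Qed.

Lemma sin_natpi n : sin (n%:R * pi) = 0 :> R.
Proof.
elim: n => [|n IH]; first by rewrite mul0r sin0.
by rewrite -natr1 mulrDl mul1r sinD IH sinpi mul0r mulr0 addr0.
Qed.

Lemma is_derive_sin_lin (m x : R) :
  is_derive x 1 (fun t => sin (m * t)) (m * cos (m * x)).
Proof.
have h : is_derive x 1 (fun t : R => m * t) m.
  by apply: is_derive_eq; rewrite /GRing.scale /= mulr1.
rewrite mulrC.
exact: (is_derive1_comp (f := sin) (g := fun t => m * t) _ h).
Qed.

Lemma is_derive_cos_lin (m x : R) :
  is_derive x 1 (fun t => cos (m * t)) (- m * sin (m * x)).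
Proof.
have h : is_derive x 1 (fun t : R => m * t) m.
  by apply: is_derive_eq; rewrite /GRing.scale /= mulr1.
rewrite mulNr mulrC -mulNr.
exact: (is_derive1_comp (f := cos) (g := fun t => m * t) _ h).
Qed.

Lemma circle_moment c n :
  sint (- A) A (fun t => re (c * z t ^+ n)) = if n == 0%N then 2 * A * re c else 0.
Proof.
case: n => [|n] /=.
  rewrite (@eq_sint _ _ (fun=> re c)); last by move=> t; rewrite expr0 mulr1.
  by rewrite sint_cst // opprK; ring.
set m : R := n.+1%:R * kappa.
have m0 : m != 0 by rewrite mulf_neq0 // ?gt_eqF // pnatr_eq0.
have zE t : re (c * z t ^+ n.+1) = re c * cos (m * t) - im c * sin (m * t).
  by rewrite /z cexpX !reimE mulrA.
pose F (t : R) : R := m^-1 * re c * sin (m * t) + m^-1 * im c * cos (m * t).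
have cf : continuous (fun t => re (c * z t ^+ n.+1)).
  rewrite (_ : (fun t => re _) = fun t => re (c%:P * 'X^(n.+1)).[z t]).
    exact: (ccont_horner _ cz).1.
  by apply/funext => t; rewrite hornerM hornerC hornerXn.
have dF (x : R) : is_derive x 1 F (re (c * z x ^+ n.+1)).
  have hs := is_derive_sin_lin m x; have hc := is_derive_cos_lin m x.
  have := is_deriveD (is_deriveZ (m^-1 * re c) hs) (is_deriveZ (m^-1 * im c) hc).
  by move=> /is_derive_eq; apply; rewrite zE /GRing.scale /=; field.
have NA : - A < A by rewrite gtrN.
rewrite (sint_FTC NA cf dF).
have mA : m * A = n.+1%:R * pi by rewrite /m /A; field; rewrite gt_eqF.
by rewrite /F mulrN sinN cosN mA sin_natpi; ring.
Qed.

Lemma circle_mean_poly p : sint (- A) A (fun t => re p.[z t]) = 2 * A * re p.[0].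
Proof.
(* The induction peels off the constant coefficient and shifts the rest by one power of [z], so the
   statement must allow an arbitrary factor z^k. *)
suff h k : sint (- A) A (fun t => re (z t ^+ k * p.[z t])) =
    if k == 0%N then 2 * A * re p.[0] else 0.
  have /= <- := h 0%N; apply: eq_sint => t; by rewrite expr0 mul1r.
elim/poly_ind: p k => [|p c IH] k.
  rewrite (@eq_sint _ _ (fun=> 0)); last by move=> t; rewrite horner0 mulr0 re0.
  by rewrite sint_cst // mul0r horner0 re0 mulr0; case: ifP.
rewrite (@eq_sint _ _ (fun t => re (z t ^+ k.+1 * p.[z t]) + re (c * z t ^+ k))).
  have hX j q : continuous (fun t => re (z t ^+ j * q.[z t])).
    rewrite (_ : (fun t => re _) = fun t => re ('X^j * q).[z t]).
      exact: (ccont_horner _ cz).1.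
    by apply/funext => t; rewrite hornerM hornerXn.
  have hc : continuous (fun t => re (c * z t ^+ k)).
    rewrite (_ : (fun t => re _) = fun t => re (z t ^+ k * (c%:P).[z t])) //.
    by apply/funext => t; rewrite hornerC mulrC.
  rewrite sintD ?IH ?circle_moment //= add0r hornerMXaddC mulr0 add0r //.
move=> t; rewrite hornerMXaddC -reD; congr re; rewrite exprS; ring.
Qed.

Lemma circle_mean_disc f : disc_approx f -> ccont (f \o z) ->
  sint (- A) A (fun t => re (f (z t))) = 2 * A * re (f 0).
Proof.
move=> hf cf; apply/eqP; rewrite -subr_eq0 -normr_le0.
apply/ler_addgt0Pr => e e0; rewrite add0r.
have e1 : 0 < e / (4 * A) by rewrite divr_gt0 // mulr_gt0.
(* An approximation within e / (4 A) costs e / 2 in the integral over length 2 A and another e / 2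
   at the centre. *)
have [p hp] := hf _ e1.
have cp : ccont (fun t => p.[z t]) by exact: ccont_horner.
have hre t : `|re (f (z t)) - re p.[z t]| <= e / (4 * A).
  have hz : nc (z t) <= 1 by rewrite nc_cexp.
  rewrite -reN -reD ler_norml; apply/andP; split; last first.
    exact: le_trans (re_le_nc _) (hp _ hz).
  rewrite lerNl -reN; apply: le_trans (re_le_nc _) _.
  by rewrite ncN hp.
have h0 : `|re (f 0) - re p.[0]| <= e / (4 * A).
  have hz : nc (0 : Cx R) <= 1 by rewrite nc0.
  rewrite -reN -reD ler_norml; apply/andP; split; last first.
    exact: le_trans (re_le_nc _) (hp _ hz).
  rewrite lerNl -reN; apply: le_trans (re_le_nc _) _.
  by rewrite ncN hp.
have cpe (s : R) : continuous (fun t => re p.[z t] + s).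
  by move=> t; apply: cvgD; [exact: cp.1|exact: cvg_cst].
have up : sint (- A) A (fun t => re (f (z t))) <=
    2 * A * re p.[0] + (e / (4 * A)) * (2 * A).
  rewrite -circle_mean_poly.
  have -> : e / (4 * A) * (2 * A) = sint (- A) A (fun=> e / (4 * A)).
    by rewrite sint_cst // opprK; ring.
  rewrite -sintD; [|exact: cp.1|exact: cst_continuous].
  apply: le_sint => [||t]; [exact: cf.1|exact: cpe|].
  have := hre t; rewrite ler_norml => /andP[_ h].
  by rewrite -lerBlDl.
have dn : 2 * A * re p.[0] - (e / (4 * A)) * (2 * A) <=
    sint (- A) A (fun t => re (f (z t))).
  rewrite -circle_mean_poly.
  have -> : - (e / (4 * A) * (2 * A)) = sint (- A) A (fun=> - (e / (4 * A))).
    by rewrite sint_cst // opprK; ring.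
  rewrite -sintD; [|exact: cp.1|exact: cst_continuous].
  apply: le_sint => [||t]; [exact: cpe|exact: cf.1|].
  have := hre t; rewrite ler_norml => /andP[h _].
  by rewrite lerBlDr -lerBlDl -lerN2 opprB.
have E : e / (4 * A) * (2 * A) = e / 2 by field; rewrite gt_eqF.
have h0' : `|2 * A * re (f 0) - 2 * A * re p.[0]| <= e / 2.
  have A20 : 0 < 2 * A by apply: mulr_gt0.
  rewrite -mulrBr normrM (gtr0_norm A20) -E mulrC.
  by apply: ler_wpM2r => //; exact: ltW.
rewrite E in up dn; move: h0'; rewrite !ler_norml => /andP[h1 h2].
apply/andP; split; lra.
Qed.

Definition poisson (rho theta : R) : R :=
  (1 - rho ^+ 2) / (1 - 2 * rho * cos theta + rho ^+ 2).

Lemma poisson_den_gt0 (rho theta : R) : 0 <= rho < 1 ->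
  0 < 1 - 2 * rho * cos theta + rho ^+ 2.
Proof.
move=> /andP[r0 r1]; apply: (@lt_le_trans _ _ ((1 - rho) ^+ 2)).
  by rewrite exprn_gt0 // subr_gt0.
have := cos_le1 theta; nra.
Qed.

Lemma poisson_ge0 (rho theta : R) : 0 <= rho < 1 -> 0 <= poisson rho theta.
Proof.
move=> h; rewrite divr_ge0 ?(ltW (poisson_den_gt0 _ h)) //.
by case/andP: h => h0 h1; nra.
Qed.

(** The kernel splits into a part analytic in [s] and a part analytic in [cj s]; [poisson_formula]
    treats the two separately. *)
Lemma poisson_cexp (rho theta : R) (s : Cx R) : 0 <= rho < 1 ->
  s = cx rho 0 * cexp theta ->
  (1 - s)^-1 + cj s / (1 - cj s) = cx (poisson rho theta) 0.
Proof.
move=> hr hs; have D0 := poisson_den_gt0 theta hr.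
have E : (1 - s) * (1 - cj s) = cx (1 - 2 * rho * cos theta + rho ^+ 2) 0.
  apply: cxP; rewrite hs /cexp !reimE; last by ring.
  by have := cos2Dsin2 theta; set C := cos _; set S := sin _ => h; nra.
have n0 : (1 - s) * (1 - cj s) != 0.
  by rewrite E -nc_gt0 nc_real normr_gt0 gt_eqF.
have /andP[s1 s2] : (1 - s != 0) && (1 - cj s != 0) by rewrite -negb_or -mulf_eq0.
apply: (mulfI n0); rewrite [LHS](_ : _ = 1 - s * cj s); last by field; rewrite s1 s2.
rewrite E mul_cj hs ncM nc_real nc_cexp mulr1; apply: cxP; rewrite !reimE.
  rewrite /poisson real_normK ?num_real // mul0r subr0 mulrCA mulfV ?mulr1 //.
  by rewrite gt_eqF.
by rewrite mulr0 mul0r addr0 oppr0 addr0.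
Qed.

(** On the circle the integrand is the real part of a function [G] of the disc algebra with G(0) = c
    / p(z0), so the formula reduces to the mean value property. *)
Lemma poisson_formula p c (rho x : R) : (forall w, nc w <= 1 -> p.[w] != 0) ->
  0 < rho < 1 ->
  sint (- A) A (fun t => poisson rho (kappa * (t - x)) * re (c / p.[z t])) =
  2 * A * re (c / p.[cx rho 0 * z x]).
Proof.
move=> hp /andP[r0 r1]; set z0 := cx rho 0 * z x.
have nz0 : nc z0 = rho by rewrite ncM nc_real nc_cexp mulr1 gtr0_norm.
have p0 : p.[z0] != 0 by apply: hp; rewrite nz0 ltW.
have [q hq] : exists q, p - p.[z0]%:P = q * ('X - z0%:P).
  have : root (p - p.[z0]%:P) z0 by rewrite /root hornerD hornerN hornerC subrr.
  by move/factor_theorem.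
have qE w : p.[w] - p.[z0] = q.[w] * (w - z0).
  by have := congr1 (fun r => r.[w]) hq; rewrite !hornerE.
pose d : {poly Cx R} := 1 - cj z0 *: 'X.
have dE w : d.[w] = 1 - cj z0 * w by rewrite /d !hornerE.
have d0 w : nc w <= 1 -> d.[w] != 0.
  move=> hw; rewrite dE subr_eq0; apply/eqP => /(congr1 nc).
  rewrite nc1 ncM nc_cj nz0 => h.
  by have := nc_ge0 w; nra.
pose g0 := c / p.[z0].
(* The three terms replace (c / p(w)) / (1 - s), z0 (c / p(w) - g0) / (w - z0) and g0 z0 / (w - z0),
   where s = cj z0 * w. The pole in the second cancels against [q]. The third is antianalytic on the
   circle and is exchanged for its conjugate, which has the same real part. *)
pose G w := c * (p.[w]^-1 * d.[w]^-1) + ((- z0 * g0)%:P * q).[w] * p.[w]^-1 +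
  ((cj g0 * cj z0)%:P * 'X).[w] * d.[w]^-1.
have hG : disc_approx G.
  apply: disc_approxD; first apply: disc_approxD.
  - apply: disc_approxM; first exact: disc_approx_cst.
    by apply: disc_approxM; exact: disc_approxV.
  - by apply: disc_approxM; [exact: disc_approx_poly|exact: disc_approxV].
  - by apply: disc_approxM; [exact: disc_approx_poly|exact: disc_approxV].
have z1 t : nc (z t) <= 1 by rewrite nc_cexp.
have cpV : ccont (fun t => p.[z t]^-1).
  by apply: ccontV; [move=> t; exact: hp|exact: ccont_horner].
have cdV : ccont (fun t => d.[z t]^-1).
  by apply: ccontV; [move=> t; exact: d0|exact: ccont_horner].
have cG : ccont (G \o z).
  apply: ccontD; first apply: ccontD.
  - by apply: ccontM; [exact: ccont_cst|exact: ccontM].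
  - by apply: ccontM; [exact: ccont_horner|].
  - by apply: ccontM; [exact: ccont_horner|].
have -> : c / p.[z0] = G 0.
  have p00 : p.[0] != 0 by apply: hp; rewrite nc0.
  have q0 : z0 * q.[0] = p.[z0] - p.[0].
    by rewrite -[RHS]opprB (qE 0); ring.
  rewrite /G dE mulr0 subr0 invr1 !hornerM !hornerC hornerX !mulr1 mulr0 addr0 /g0.
  have -> : c / p.[0] + - z0 * (c / p.[z0]) * q.[0] / p.[0] =
     c / p.[0] - (z0 * q.[0]) * (c / (p.[z0] * p.[0])) by field; rewrite p0 p00.
  rewrite q0; field; by rewrite p0 p00.
rewrite -(circle_mean_disc hG cG); apply: eq_sint => t.
set w := z t.
have ww : w * cj w = 1.
  by rewrite mul_cj nc_cexp expr1n; apply: cxP.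
set s := cj z0 * w.
have sE : s = cx rho 0 * cexp (kappa * (t - x)).
  have -> : kappa * (t - x) = kappa * t + - (kappa * x) by ring.
  rewrite cexpD /s /z0 /w /z; apply: cxP; rewrite !reimE ?cosN ?sinN; ring.
have hr : 0 <= rho < 1 by rewrite (ltW r0) r1.
have PE := poisson_cexp hr sE.
have pw : p.[w] != 0 by apply: hp; exact: z1.
have dw : 1 - s != 0 by rewrite /s -dE; apply: d0; exact: z1.
have dw' : 1 - cj s != 0.
  by rewrite -nc_eq0 -nc_cj cjD cjN cj1 cjK nc_eq0.
have wz : w - z0 = w * (1 - cj s).
  by rewrite /s cjM cjK mulrBr mulr1 mulrCA ww mulr1.
have w0 : w != 0 by rewrite -nc_gt0 nc_cexp.
(* [cj Y - Y] is purely imaginary, so it disappears on taking real parts. *)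
pose Y := g0 * (cj s / (1 - cj s)).
have -> : G w = cx (poisson rho (kappa * (t - x))) 0 * (c / p.[w]) + (cj Y - Y).
  have YE : cj Y = cj g0 * (s / (1 - s)).
    rewrite /Y cjM; congr (_ * _).
    apply: (mulIf dw); rewrite divfK //.
    have -> : 1 - s = cj (1 - cj s) by rewrite cjD cjN cj1 cjK.
    by rewrite -cjM divfK // cjK.
  rewrite YE -PE /G dE -/s !hornerM !hornerC hornerX -(mulrA (cj g0)) -/s.
  have qw : q.[w] = (p.[w] - p.[z0]) / (w - z0).
    by rewrite qE mulfK // wz mulf_neq0.
  have z0E : z0 = w * cj s by rewrite /s cjM cjK mulrCA ww mulr1.
  rewrite qw wz /Y /g0 {1}z0E.
  move: dw'; generalize (cj s), (cj (c / p.[z0])) => cs cg dw'.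
  by field; rewrite w0 p0 pw dw dw'.
by rewrite !reimE; ring.
Qed.

End CircleMean.

(** * Estimates for the Poisson kernel and for 1/p - 1 *)

Section PoissonEstimates.
Context {R : realType}.
Context (kappa : R) (kappa0 : 0 < kappa).
Implicit Types (p : {poly Cx R}).

Let A : R := pi / kappa.
Let z (t : R) : Cx R := cexp (kappa * t).

Let A0 : 0 < A.
Proof. by rewrite divr_gt0 // pi_gt0. Qed.

Lemma continuous_poisson (rho x : R) : 0 <= rho < 1 ->
  continuous (fun t => poisson rho (kappa * (t - x))).
Proof.
move=> hr t; rewrite /poisson; apply: cvgM; first exact: cvg_cst.
apply: cvgV; first by rewrite gt_eqF // poisson_den_gt0.
apply: cvgD; last exact: cvg_cst.
apply: cvgB; first exact: cvg_cst.
apply: cvgM; first exact: cvg_cst.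
apply: (@continuous_comp _ _ _ (fun t => kappa * (t - x)) cos);
  last exact: continuous_cos.
apply: cvgM; first exact: cvg_cst.
by apply: cvgB; [exact: cvg_id|exact: cvg_cst].
Qed.

Lemma poisson_mean (rho x : R) : 0 < rho < 1 ->
  sint (- A) A (fun t => poisson rho (kappa * (t - x))) = 2 * A.
Proof.
move=> hr; have h w : nc w <= 1 -> (1 : {poly Cx R}).[w] != 0.
  by rewrite hornerC oner_eq0.
have := poisson_formula kappa0 1 x h hr.
rewrite hornerC invr1 mulr1 re1 mulr1 => <-; apply: eq_sint => t.
by rewrite hornerC invr1 mulr1 re1 mulr1.
Qed.

(** Subharmonicity of |1/p - 1|^2. With [a] the value at the interior point, the Poisson formula for
    cj a * (1/p - 1) returns |a|^2, and re (cj a * w) <= (|a|^2 + |w|^2) / 2 together with Poisson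
    mean 1 absorbs half of it. *)
Lemma poisson_sqr p (rho x : R) : (forall w, nc w <= 1 -> p.[w] != 0) ->
  0 < rho < 1 ->
  2 * A * nc (p.[cx rho 0 * z x]^-1 - 1) ^+ 2 <=
  sint (- A) A (fun t => poisson rho (kappa * (t - x)) *
    nc (p.[z t]^-1 - 1) ^+ 2).
Proof.
move=> hp hr; set z0 := cx rho 0 * z x.
have hr' : 0 <= rho < 1 by case/andP: hr => /ltW -> ->.
set a := p.[z0]^-1 - 1; pose P t := poisson rho (kappa * (t - x)).
have cP : continuous P by exact: continuous_poisson.
have cz : ccont z by exact: ccont_cexp.
have cF : ccont (fun t => p.[z t]^-1).
  apply: ccontV; last exact: ccont_horner.
  by move=> t; apply: hp; rewrite nc_cexp.
have cF1 : ccont (fun t => p.[z t]^-1 - 1).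
  by apply: ccontD => //; exact: ccont_cst.
have cPM f : continuous f -> continuous (fun t => P t * f t).
  by move=> cf t; apply: cvgM; [exact: cP|exact: cf].
have cn := ccont_nc2 cF1.
have E1 : sint (- A) A (fun t => P t * re (cj a * (p.[z t]^-1 - 1))) =
    2 * A * nc a ^+ 2.
  have E0 := poisson_formula kappa0 (cj a) x hp hr.
  have Em := poisson_mean x hr.
  rewrite (@eq_sint _ _ (fun t => P t * re (cj a / p.[z t]) +
    (- re (cj a)) * P t)); last first.
    by move=> t; rewrite mulrBr mulr1 !reimE; ring.
  have cc : ccont (fun t => cj a / p.[z t]).
    by apply: ccontM => //; exact: ccont_cst.
  rewrite sintD; [|exact: cPM cc.1|]; last first.
    by move=> t; apply: cvgM; [exact: cvg_cst|exact: cP].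
  rewrite sintZ // Em E0 -/z0 -/A.
  have -> : 2 * A * re (cj a / p.[z0]) + - re (cj a) * (2 * A) =
    2 * A * re (cj a * a) by rewrite {2}/a mulrBr mulr1 !reimE; ring.
  by congr (_ * _); rewrite mulrC mul_cj re_cx.
have E2 : sint (- A) A (fun t => P t * re (cj a * (p.[z t]^-1 - 1))) <=
    2^-1 * nc a ^+ 2 * (2 * A) +
    2^-1 * sint (- A) A (fun t => P t * nc (p.[z t]^-1 - 1) ^+ 2).
  rewrite -(poisson_mean x hr) -/P -!sintZ //; last exact: cPM.
  rewrite -sintD; last 2 first.
  - by move=> t; apply: cvgM; [exact: cvg_cst|exact: cP].
  - by move=> t; apply: cvgM; [exact: cvg_cst|exact: cPM].
  apply: le_sint => [||t].
  - apply: cPM; apply: (ccontM _ cF1).1; exact: ccont_cst.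
  - move=> t; apply: cvgD; apply: cvgM; [exact: cvg_cst|exact: cP|exact: cvg_cst|].
    exact: cPM.
  - set w := p.[z t]^-1 - 1; have P0 : 0 <= P t by exact: poisson_ge0.
    have -> : 2^-1 * nc a ^+ 2 * P t + 2^-1 * (P t * nc w ^+ 2) =
      P t * (2^-1 * (nc a ^+ 2 + nc w ^+ 2)) by ring.
    apply: ler_wpM2l => //; apply: le_trans (re_le_nc _) _.
    rewrite ncM nc_cj; have := sqr_ge0 (nc a - nc w); nra.
rewrite E1 in E2; lra.
Qed.

(** Expand |w - 1|^2 = |w|^2 + 1 - 2 re w with w = 1/p: the first term is at most 1 / delta, and re
    w has mean exactly 1 by the mean value property, so the bound vanishes as delta tends to 1. *)
Lemma circle_L2 p (delta : R) : p.[0] = 1 -> 0 < delta ->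
  (forall w, nc w <= 1 -> delta <= nc p.[w] ^+ 2) ->
  sint (- A) A (fun t => nc (p.[z t]^-1 - 1) ^+ 2) <= 2 * A * (delta^-1 - 1).
Proof.
move=> p0 d0 hd.
have hp w : nc w <= 1 -> p.[w] != 0.
  by move=> /hd h; rewrite -nc_eq0 -sqrf_eq0 gt_eqF // (lt_le_trans d0).
have cz : ccont z by exact: ccont_cexp.
have cF : ccont (fun t => p.[z t]^-1).
  apply: ccontV; last exact: ccont_horner.
  by move=> t; apply: hp; rewrite nc_cexp.
have cF1 : ccont (fun t => p.[z t]^-1 - 1).
  by apply: ccontD => //; exact: ccont_cst.
have E := circle_mean_disc kappa0 (disc_approxV hp) cF.
rewrite p0 invr1 re1 mulr1 -/A in E.
have c2 : continuous (fun t => - 2 * re (p.[z t]^-1)).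
  by move=> t; apply: cvgM; [exact: cvg_cst|exact: cF.1].
apply: (@le_trans _ _ (sint (- A) A
    (fun t => (delta^-1 + 1) + - 2 * re (p.[z t]^-1)))).
  apply: le_sint => [||t].
  - exact: ccont_nc2.
  - by move=> t; apply: cvgD; [exact: cvg_cst|exact: c2].
  - set w := p.[z t]^-1.
    have -> : nc (w - 1) ^+ 2 = nc w ^+ 2 + 1 + -2 * re w.
      by rewrite !nc_sqr !reimE; ring.
    rewrite lerD2r lerD2r /w ncV exprVn lef_pV2 ?posrE ?exprn_gt0 ?nc_gt0 //.
      by apply: hd; rewrite nc_cexp.
    by apply: hp; rewrite nc_cexp.
rewrite sintD //; last exact: cst_continuous.
rewrite sint_cst ?sintZ ?E; [|exact: cF.1|by rewrite ge0_cp // ltW].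
by rewrite opprK; lra.
Qed.

Lemma sin_ge_lin (w : R) : 0 <= w <= pi * 3 / 8 ->
  cos (pi * 3 / 8) * w <= sin w /\ cos (pi * 3 / 8) <= cos w.
Proof.
move=> /andP[w0 w1]; have pi0 := @pi_gt0 R.
have hcos (x : R) : 0 <= x <= w -> cos (pi * 3 / 8) <= cos x.
  move=> /andP[x0 x1]; rewrite leNgt ltr_cos ?in_itv /= -?leNgt.
  - lra.
  - by apply/andP; split; lra.
  - by apply/andP; split; lra.
split; last by apply: hcos; rewrite w0 lexx.
have [c] := @MVT_segment R sin cos 0 w w0 (fun x _ => is_derive_sin x)
  (continuous_subspaceT (@continuous_sin R)).
rewrite in_itv /= sin0 !subr0 => /hcos h ->.
by apply: ler_wpM2r.
Qed.

(** The fourth power comes from 1 - cos theta >= c^4 theta^2 / 2 on |theta| <= 3 pi / 2, with c the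
    cosine of a quarter of that range. *)
Definition poisson_const : R := 4 / cos (pi * 3 / 8) ^+ 4.

Lemma cos38 : 0 < cos (pi * 3 / 8 : R) <= 1.
Proof.
rewrite cos_le1 andbT; apply: cos_gt0_pihalf.
by have := @pi_gt0 R => ?; apply/andP; split; lra.
Qed.

Lemma poisson_const_gt0 : 0 < poisson_const.
Proof. by case/andP: cos38 => h _; rewrite divr_gt0 // exprn_gt0. Qed.

(** The range 3 pi / 2 is what arises when t runs over a full period and x over its middle half; it
    stays away from the next peak of the kernel at 2 pi. There the denominator is at least a
    multiple of r^2 + theta^2, with r = 1/(2n), and the numerator is at most 2 r. *)
Lemma poisson_le (theta : R) (n : nat) : (0 < n)%N ->
  `|theta| <= 3 / 2 * pi ->
  let P := poisson (1 - (2 * n%:R)^-1) theta in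
  P <= poisson_const * n%:R /\ P * theta ^+ 2 <= poisson_const / n%:R.
Proof.
move=> n0 ht; have /andP[c0 c1] := cos38.
set c := cos (pi * 3 / 8) in c0 c1.
have nR : 1 <= n%:R :> R by rewrite ler1n.
rewrite /=; set r := (2 * n%:R)^-1.
have rn : r * (2 * n%:R) = 1 by rewrite mulVf // lt0r_neq0 //; lra.
have r0 : 0 < r by rewrite invr_gt0; lra.
have r1 : r <= 2^-1 by rewrite lef_pV2 ?posrE //; lra.
have hr : 0 <= 1 - r < 1 by apply/andP; split; lra.
have c4 : 0 < c ^+ 4 by rewrite exprn_gt0.
have c41 : c ^+ 4 <= 1 by rewrite expr_le1 // ltW.
(* Double the angle twice: with theta = 4 w, 1 - cos theta = 8 sin^2 w cos^2 w, and w lies in the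
   range of [sin_ge_lin]. *)
have hcos : c ^+ 4 * theta ^+ 2 / 2 <= 1 - cos theta.
  set w := `|theta| / 4.
  have w0 : 0 <= w by rewrite divr_ge0.
  have hw : 0 <= w <= pi * 3 / 8.
    by rewrite w0 /=; rewrite /w; lra.
  have [h1 h2] := sin_ge_lin hw; rewrite -/c in h1 h2.
  have -> : cos theta = cos (w *+ 2 *+ 2).
    by rewrite -cos_norm; congr cos; rewrite /w !mulr2n; field.
  rewrite cos_mulr2n cos2sin2 sin_mulr2n.
  have h3 : c * w * c <= sin w * cos w.
    by apply: ler_pM => //; rewrite ?mulr_ge0 // ltW.
  have h4 : (c * w * c) ^+ 2 <= (sin w * cos w) ^+ 2.
    have h5 : 0 <= c * w * c by rewrite !mulr_ge0 // ltW.
    by rewrite ler_pXn2r // nnegrE // (le_trans h5).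
  have -> : theta ^+ 2 = 16 * w ^+ 2.
    by rewrite /w exprMn real_normK ?num_real //; field.
  move: h4; rewrite [cos w * sin w]mulrC; set S := sin w * cos w.
  have -> : c ^+ 4 * (16 * w ^+ 2) / 2 = 8 * (c * w * c) ^+ 2 by field.
  rewrite !mulr2n (_ : 1 - _ = 8 * S ^+ 2); first by rewrite ler_pM2l.
  by ring.
set D := 1 - 2 * (1 - r) * cos theta + (1 - r) ^+ 2.
have DE : D = r ^+ 2 + 2 * (1 - r) * (1 - cos theta) by rewrite /D; ring.
have t2 : 0 <= c ^+ 4 * theta ^+ 2 by rewrite mulr_ge0 ?sqr_ge0 // ltW.
have hD : r ^+ 2 + c ^+ 4 * theta ^+ 2 / 2 <= D by rewrite DE; nra.
have D0 : 0 < D.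
  apply: lt_le_trans hD; have : 0 < r ^+ 2 by rewrite exprn_gt0.
  by lra.
have hP : poisson (1 - r) theta * D <= 2 * r.
  rewrite /poisson -/D divfK ?gt_eqF //; nra.
have P0 : 0 <= poisson (1 - r) theta by exact: poisson_ge0.
set P := poisson _ _ in hP P0 *.
have ri : n%:R = (2 * r)^-1.
  by apply: (mulfI (lt0r_neq0 r0)); rewrite /r; field; rewrite lt0r_neq0 //; lra.
have Pr : P * r ^+ 2 <= 2 * r.
  apply: le_trans hP; apply: ler_wpM2l => //; lra.
have Pt : P * (c ^+ 4 * theta ^+ 2 / 2) <= 2 * r.
  apply: le_trans hP; apply: ler_wpM2l => //.
  by apply: le_trans hD; rewrite lerDr sqr_ge0.
have K4 : 4 <= poisson_const by rewrite /poisson_const ler_pdivlMr // -/c; lra.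
split.
  apply: (@le_trans _ _ (4 * n%:R)); last by apply: ler_wpM2r => //; lra.
  rewrite -(@ler_pM2r _ r) //.
  have -> : 4 * n%:R * r = 2 by lra.
  rewrite -(@ler_pM2r _ r) //; lra.
have -> : poisson_const / n%:R = 8 * r / c ^+ 4.
  by rewrite /poisson_const -/c ri invrK; ring.
rewrite ler_pdivlMr //; lra.
Qed.

End PoissonEstimates.

(** * The exceptional set of the Szego recursion *)

Section MaximalFunction.
Context {R : realType}.
Local Notation mu := (@lebesgue_measure R).

Lemma HL_maximal_ball (f : R -> R) (x r s : R) : 0 < r ->
  (HL_maximal f x <= s%:E)%E ->
  (\int[mu]_(y in ball x r) `|f y|%:E <= (s * (2 * r))%:E)%E.
Proof.
move=> r0 hs; set I := (X in (X <= _)%E).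
have h : (iavg f (ball x r) <= s%:E)%E.
  apply: le_trans hs; apply: ereal_sup_ubound; exists r => //.
  by rewrite /= in_itv /= r0.
move: h; rewrite /iavg (lebesgue_measure_ball _ (ltW r0)) -/I.
have r2 : 0 < r *+ 2 by rewrite pmulrn_lgt0.
rewrite inver (gt_eqF r2) => h.
have := lee_wpmul2l (_ : (0 <= (r *+ 2)%:E)%E) h.
rewrite lee_fin (ltW r2) => /(_ isT); rewrite muleA -EFinM mulfV ?gt_eqF // mul1e.
by rewrite -EFinM mulr_natl mulrC.
Qed.

Context (kappa : R) (kappa0 : 0 < kappa).
Let A : R := pi / kappa.

Let A0 : 0 < A.
Proof. by rewrite divr_gt0 // pi_gt0. Qed.

(** Dyadic decomposition about [x] at the natural width 1/(kappa n) of the kernel. On the j-th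
    annulus the kernel is O(n 4^(-j)) while the integral of [phi] is O(s 2^j / (kappa n)), so the
    contributions form a geometric series whose sum does not depend on n. *)
Lemma poisson_le_maximal (phi : R -> R) (x s : R) (n : nat) :
  continuous phi -> (forall t, 0 <= phi t) -> (0 < n)%N -> `|x| <= A / 2 ->
  0 <= s -> (HL_maximal (phi \_ `[(- A)%R, A%R]) x <= s%:E)%E ->
  sint (- A) A (fun t => poisson (1 - (2 * n%:R)^-1) (kappa * (t - x)) * phi t)
    <= 10 * (@poisson_const R) / kappa * s.
Proof.
move=> cphi phi0 n0 hx s0 hHL.
have nR : 1 <= n%:R :> R by rewrite ler1n.
set rho := 1 - _.
have hr : 0 <= rho < 1.
  have h1 : 0 < (2 * n%:R)^-1 :> R by rewrite invr_gt0; lra.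
  have h2 : (2 * n%:R)^-1 <= 1 :> R by rewrite invf_le1; lra.
  by rewrite /rho; apply/andP; split; lra.
set C := @poisson_const R.
have C0 : 0 < C by exact: poisson_const_gt0.
pose P (t : R) : R := poisson rho (kappa * (t - x)).
have P0 t : 0 <= P t by exact: poisson_ge0.
have cP : continuous P by exact: continuous_poisson.
pose W : R -> R := phi \_ `[(- A)%R, A%R].
have W0 t : 0 <= W t by rewrite /W patchE; case: ifP.
have mphi : measurable_fun setT phi by exact: continuous_measurable_fun.
have mP : measurable_fun setT P by exact: continuous_measurable_fun.
have mW : measurable_fun setT W.
  by apply/(measurable_restrictT _ _).1 => //; exact: measurable_funTS.
pose tau := (kappa * n%:R)^-1.
have kn0 : 0 < kappa * n%:R by rewrite mulr_gt0 //; lra.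
have tau0 : 0 < tau by rewrite invr_gt0.
pose D j : set R := ball x (2 ^+ j * tau).
have D0 j : 0 < 2 ^+ j * tau by rewrite mulr_gt0 // exprn_gt0.
have mD j : measurable (D j) by exact: measurable_ball.
pose H t := (P t * W t)%:E.
have H0 t : (0 <= H t)%E by rewrite lee_fin mulr_ge0.
have mH (B : set R) : measurable_fun B H.
  by apply/measurable_EFinP; apply: measurable_funTS; exact: measurable_funM.
have mWE (B : set R) : measurable_fun B (EFin \o W).
  by apply/measurable_EFinP; exact: measurable_funTS.
have theta_le t : W t != 0 -> `|kappa * (t - x)| <= 3 / 2 * pi.
  rewrite /W patchE; case: ifPn => [|_]; last by rewrite eqxx.
  rewrite inE /= in_itv /= => /andP[t1 t2] _.
  rewrite normrM (gtr0_norm kappa0).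
  have -> : 3 / 2 * pi = kappa * (3 / 2 * A).
    by rewrite /A; field; rewrite gt_eqF.
  rewrite ler_pM2l // ler_norml; move: hx; rewrite ler_norml => /andP[x1 x2].
  by apply/andP; split; lra.
have int_bound (B : set R) j (c : R) : measurable B -> B `<=` D j -> 0 <= c ->
    (forall t, B t -> W t != 0 -> P t <= c) ->
    (\int[mu]_(t in B) H t <= (c * (s * (2 * (2 ^+ j * tau))))%:E)%E.
  move=> mB BD c0 hc.
  apply: (@le_trans _ _ (\int[mu]_(t in B) (c%:E * (W t)%:E))%E).
    apply: (@ge0_le_integral _ _ _ mu B mB H (fun t => c%:E * (W t)%:E)%E).
    - by move=> t _; exact: H0.
    - exact: mH.
    - by apply: measurable_funeM; exact: mWE.
    - move=> t Bt; rewrite -EFinM lee_fin.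
      have [->|Wt] := eqVneq (W t) 0; first by rewrite !mulr0.
      by apply: ler_wpM2r => //; exact: hc.
  rewrite ge0_integralZl_EFin //; last 2 first.
  - by move=> t _; rewrite lee_fin.
  - exact: mWE.
  rewrite EFinM; apply: lee_wpmul2l; first by rewrite lee_fin.
  have hb : (\int[mu]_(t in D j) (W t)%:E <=
      (s * (2 * (2 ^+ j * tau)))%:E)%E.
    have := HL_maximal_ball (D0 j) hHL; congr (_ <= _)%E.
    by apply: eq_integral => t _; rewrite ger0_norm // W0.
  apply: le_trans hb.
  have W0E t : D j t -> (0 <= (EFin \o W) t)%E by move=> _; rewrite lee_fin.
  exact: (ge0_subset_integral mu mB (mD j) (mWE _) W0E BD).
(* In units of C s / kappa the central ball contributes 2 and the annulus from D_j to D_(j+1)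
   contributes 4 * 2^(-j); 10 - 8 * 2^(-j) is the partial sum. *)
have ind j : (\int[mu]_(t in D j) H t <=
    (C / kappa * s * (10 - 8 * 2^-1 ^+ j))%:E)%E.
  elim: j => [|j IH].
    apply: le_trans (int_bound (D 0%N) 0%N (C * n%:R) _ _ _ _) _ => //.
    - by rewrite mulr_ge0 // ltW.
    - by move=> t _ /theta_le /(poisson_le n0)[].
    - rewrite lee_fin !expr0 /tau; apply/eqP/eqP.
      by rewrite le_eqVlt; apply/orP; left; apply/eqP; field;
        rewrite !gt_eqF //; lra.
  have -> : D j.+1 = D j `|` (D j.+1 `\` D j).
    rewrite setDUK //; apply: le_ball.
    by rewrite ler_pM2r // ler_eXn2l //; lra.
  have mDD : measurable (D j.+1 `\` D j) by exact: measurableD.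
  rewrite (ge0_integral_setU mu (mD j) mDD (mH _)); last 2 first.
  - by move=> t _; exact: H0.
  - by apply/disj_setPS => t [? []].
  have c0 : 0 <= C * n%:R * (4^-1) ^+ j.
    by rewrite mulr_ge0 ?exprn_ge0 // mulr_ge0 // ltW.
  have hb : forall t, (D j.+1 `\` D j) t -> W t != 0 ->
      P t <= C * n%:R * 4^-1 ^+ j.
    move=> t [_ /= nD] /theta_le /(poisson_le n0)[_].
    rewrite -/rho -/(P t) => hP.
    have th2 : (2 ^+ j / n%:R) ^+ 2 <= (kappa * (t - x)) ^+ 2.
      rewrite -[leRHS]real_normK ?num_real //.
      apply: lerXn2r; rewrite ?nnegrE ?divr_ge0 ?exprn_ge0 //.
      move: nD; rewrite /D /ball /= => /negP; rewrite -leNgt => h.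
      rewrite normrM (gtr0_norm kappa0) distrC.
      rewrite (_ : _ / _ = kappa * (2 ^+ j * tau)); first by rewrite ler_pM2l.
      by rewrite /tau; field; rewrite !gt_eqF //; lra.
    have pj : 0 < (2 ^+ j / n%:R) ^+ 2 :> R.
      by rewrite exprn_gt0 // divr_gt0 ?exprn_gt0 //; lra.
    rewrite -(ler_pM2r pj); apply: (@le_trans _ _ (C / n%:R)).
      by apply: le_trans hP; apply: ler_wpM2l.
    rewrite expr_div_n -exprM mulnC exprM.
    rewrite (_ : 4^-1 ^+ j = ((2 ^+ 2) ^+ j)^-1); last first.
      by rewrite -exprVn; congr (_ ^+ _); rewrite expr2; lra.
    rewrite le_eqVlt; apply/orP; left; apply/eqP; field.
    by rewrite expf_neq0 ?gt_eqF //; lra.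
  have hI := int_bound _ j.+1 _ mDD (@subDsetl _ _ _) c0 hb.
  apply: le_trans (leeD IH hI) _.
  rewrite -EFinD lee_fin !exprS.
  have -> : (4^-1 : R) ^+ j = 2^-1 ^+ j * 2^-1 ^+ j.
    by rewrite -exprMn; congr (_ ^+ _); lra.
  have e : 2^-1 ^+ j * 2 ^+ j = 1 :> R by rewrite -exprMn mulVf ?expr1n.
  rewrite le_eqVlt; apply/orP; left; apply/eqP.
  have -> : C * n%:R * (2^-1 ^+ j * 2^-1 ^+ j) * (s * (2 * (2 * 2 ^+ j * tau))) =
     (C / kappa * s * 4 * 2^-1 ^+ j) * (2^-1 ^+ j * 2 ^+ j) * (kappa * n%:R * tau).
    by rewrite /tau; field; rewrite !gt_eqF //; lra.
  by rewrite e mulfV ?gt_eqF //; field; rewrite gt_eqF.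
have [J hJ] : exists J, `[(- A)%R, A%R] `<=` D J.
  have h2 : 0 <= (2^-1 : R) < 1 by apply/andP; split; lra.
  have A2 : 0 < 2 * A by exact: mulr_gt0.
  have [J hJ] := exprn_small h2 (divr_gt0 tau0 A2).
  exists J => t; rewrite /= in_itv /= => /andP[t1 t2].
  rewrite /D /ball /=; apply: (@lt_le_trans _ _ (2 * A)).
    move: hx; rewrite ler_norml => /andP[x1 x2].
    by rewrite ltr_norml; apply/andP; split; lra.
  rewrite ler_pdivlMr // in hJ.
  have J0 : 0 <= (2 : R) ^+ J by rewrite exprn_ge0.
  have := ler_wpM2l J0 hJ; rewrite mulrA -exprMn mulfV // expr1n mul1r.
  by [].
have E : ((sint (- A) A (fun t => P t * phi t))%:E <=
    (10 * C / kappa * s)%:E)%E.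
  rewrite /sint /Rintegral fineK; last first.
    apply: integrable_fin_num => //; apply: continuous_itv_integrable.
    by move=> t; apply: cvgM; [exact: cP|exact: cphi].
  apply: (@le_trans _ _ (\int[mu]_(t in D J) H t)%E).
    have mI : measurable (`[(- A)%R, A%R] : set R) by exact: measurable_itv.
    have -> : (\int[mu]_(t in `[(- A)%R, A%R]) (P t * phi t)%:E =
        \int[mu]_(t in `[(- A)%R, A%R]) H t)%E.
      by apply: eq_integral => t ht; rewrite /H /W patchE ht.
    exact: (ge0_subset_integral mu mI (mD J) (mH _) (fun t _ => H0 t) hJ).
  apply: le_trans (ind J) _; rewrite lee_fin.
  have h : 0 <= C / kappa * s by rewrite mulr_ge0 // divr_ge0 // ltW.
  have e : 0 <= (2^-1 : R) ^+ J by rewrite exprn_ge0.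
  have -> : 10 * C / kappa * s = 10 * (C / kappa * s) by rewrite !mulrA.
  by have := mulr_ge0 h e; set q := C / kappa * s; rewrite mulrBr; lra.
by rewrite lee_fin in E.
Qed.

End MaximalFunction.

(** * Measure of the bad set of spectral parameters *)

Section ExceptionalSet.
Context {R : realType}.
Local Notation mu := (@lebesgue_measure R).

(** The product of the constant 3 of the maximal inequality, the inverse 20 C of the threshold [s]
    chosen below, and the bound 2 pi eps for the integral of [phi], with eps left out. *)
Definition exceptional_const : R := 6 * pi * (20 * @poisson_const R).

(* [alpha = (szego g zeta (0, 1) N).2] is a zero-free polynomial in [zeta] with
   [alpha 0 = 1], so [1 / alpha - 1] is small in mean square on the circle; the
   maximal function bounds its Poisson integral, and hence [alpha] at the
   interior points [(1 - 1/(2n)) zeta], outside a small set of [zeta]. *)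
Lemma szego_exceptional (g : nat -> Cx R) (h eps : R) (N : nat) : 0 < h ->
  (forall k, nc (g k) <= 1) -> h * eps <= 2^-1 ->
  \sum_(k < N) nc (g k) ^+ 2 <= h * eps ->
  exists E, [/\ measurable E, (mu E <= (exceptional_const * eps)%:E)%E &
    forall x, ~ E x -> `|x| <= pi / (4 * h) -> forall n x0, (0 < n <= N)%N ->
      \sum_(k < n) msize (szego g (cexp (2 * h * x)) x0 k) ^+ 2 <=
      @cesaro_const R * msize x0 ^+ 2 * n%:R].
Proof.
move=> h0 hg he hsum; pose kappa := 2 * h.
have kappa0 : 0 < kappa by rewrite mulr_gt0.
have [p [p0 pE]] := szego_poly g N.
have d1 : 1 - h * eps <= defect g N.
  by apply: le_trans (defect_ge N hg); rewrite lerD2l lerN2.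
have d2 : 2^-1 <= defect g N by apply: le_trans d1; lra.
have d0 : 0 < defect g N by apply: lt_le_trans d2.
have pd w : nc w <= 1 -> defect g N <= nc p.[w] ^+ 2.
  by move=> hw; rewrite pE; exact: szego_alpha_ge.
have pn0 w : nc w <= 1 -> p.[w] != 0.
  by move=> /pd hw; rewrite -nc_eq0 -sqrf_eq0 gt_eqF // (lt_le_trans d0).
pose A : R := pi / kappa.
have A0 : 0 < A by rewrite divr_gt0 // pi_gt0.
pose phi t := nc (p.[cexp (kappa * t)]^-1 - 1) ^+ 2.
have cphi : continuous phi.
  apply: ccont_nc2; apply: ccontD; last exact: ccont_cst.
  apply: ccontV; last by apply: ccont_horner; exact: ccont_cexp.
  by move=> t; apply: pn0; rewrite nc_cexp.
have phi0 t : 0 <= phi t by exact: sqr_ge0.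
have iphi : mu.-integrable `[(- A)%R, A%R] (EFin \o phi).
  exact: continuous_itv_integrable.
pose W : R -> R := phi \_ `[(- A)%R, A%R].
have lW : locally_integrable [set: R] W by exact: integrable_locally.
(* The period 2 A = pi / h times the mean 2 h eps: this is where [h] cancels. *)
have hphi : sint (- A) A phi <= 2 * pi * eps.
  apply: le_trans (circle_L2 kappa0 p0 d0 pd) _.
  have hd : (defect g N)^-1 - 1 <= 2 * (h * eps).
    have : (defect g N)^-1 <= 2 by rewrite -[leRHS]invrK lef_pV2 ?posrE.
    have : (defect g N)^-1 * defect g N = 1 by rewrite mulVf // gt_eqF.
    have : 0 < (defect g N)^-1 by rewrite invr_gt0.
    have : 0 <= h * eps.
      by apply: le_trans hsum; apply: sumr_ge0 => k _; exact: sqr_ge0.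
    move: d1; set t := h * eps; set y := _^-1; set d := defect g N.
    move=> d1 t0 y0 yd y2; have := mulr_ge0 (ltW y0) (_ : 0 <= d - (1 - t)).
    have := mulr_ge0 t0 (_ : 0 <= 2 - y).
    by rewrite !subr_ge0 => /(_ y2) h1 /(_ d1) h2; lra.
  apply: (@le_trans _ _ (2 * (pi / kappa) * (2 * (h * eps)))).
    by apply: ler_wpM2l => //; rewrite mulr_ge0 // ltW.
  rewrite le_eqVlt; apply/orP; left; apply/eqP; rewrite /kappa; field.
  by rewrite gt_eqF.
pose C := @poisson_const R.
have C0 : 0 < C by exact: poisson_const_gt0.
(* With this threshold the Poisson integral is at most 1 / (2 kappa); divided by 2 A = 2 pi / kappa
   it gives |1/alpha - 1|^2 <= 1 / (4 pi) <= 1/4, hence |alpha| <= 2. *)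
pose s := (20 * C)^-1 : R.
have s0 : 0 < s by rewrite invr_gt0 mulr_gt0.
exists [set x | (s%:E < HL_maximal W x)%E]; split.
- rewrite -[X in measurable X]setTI; apply: emeasurable_fun_o_infty => //.
  exact: measurable_HL_maximal.
- apply: le_trans (maximal_inequality lW s0) _ => /=.
  have -> : (\int[mu]_(y in [set: R]) `|(W y)%:E| = (sint (- A) A phi)%:E)%E.
    rewrite /sint /Rintegral fineK; last exact: integrable_fin_num.
    rewrite [RHS]integral_mkcond; apply: eq_integral => t _.
    rewrite /W !patchE; case: ifP => _ /=; last by rewrite normr0.
    by rewrite ger0_norm.
  rewrite -EFinM lee_fin.
  have -> : exceptional_const * eps = 3 / s * (2 * pi * eps).
    by rewrite /exceptional_const /s invrK -/C; ring.
  by apply: ler_wpM2l => //; rewrite divr_ge0 // ltW.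
move=> x /negP; rewrite -leNgt => hx xA n x0 nN.
have n0 : (0 < n)%N by case/andP: nN.
have nR : 1 <= n%:R :> R by rewrite ler1n.
pose r : R := (2 * n%:R)^-1; pose rho : R := 1 - r.
have hn2 : r <= 2^-1 by rewrite lef_pV2 ?posrE //; lra.
have hn0 : 0 < r by rewrite invr_gt0; lra.
have hr : 0 < rho < 1 by rewrite /rho; apply/andP; split; lra.
have xA' : `|x| <= A / 2.
  apply: le_trans xA _; rewrite le_eqVlt; apply/orP; left; apply/eqP.
  by rewrite /A /kappa; field; rewrite gt_eqF.
have h1 := poisson_sqr kappa0 x pn0 hr.
have h2 := poisson_le_maximal kappa0 cphi phi0 n0 xA' (ltW s0) hx.
apply: (@szego_cesaro R g (cexp (2 * h * x)) x0 n N) => //; first exact: nc_cexp.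
rewrite -pE; move: (le_trans h1 h2).
have hz : nc (cx rho 0 * cexp (2 * h * x)) <= 1.
  rewrite ncM nc_real nc_cexp mulr1 ger0_norm; case/andP: hr => ? ?; exact: ltW.
have := pn0 _ hz; rewrite -/kappa; set w := cx _ _ * _ => pw0 hw.
have hq : nc (p.[w]^-1 - 1) ^+ 2 <= 4^-1.
  have A2 : 0 < 2 * (pi / kappa) by exact: mulr_gt0.
  rewrite -(ler_pM2l A2); apply: le_trans hw _.
  have -> : 10 * C / kappa * s = (2 * kappa)^-1.
    by rewrite /s; field; rewrite !gt_eqF.
  have := @pi_ge2 R => pi2.
  have -> : 2 * (pi / kappa) / 4 = pi * (2 * kappa)^-1.
    by field; rewrite !gt_eqF.
  by rewrite ler_peMl ?invr_ge0 ?mulr_ge0 // ?ltW //; lra.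
have hq' : nc (p.[w]^-1 - 1) <= 2^-1.
  rewrite -(@ler_pXn2r _ 2) ?nnegrE ?nc_ge0 ?invr_ge0 //.
  by apply: le_trans hq _; rewrite expr2; lra.
have hV : 2^-1 <= (nc p.[w])^-1.
  have := ncD (p.[w]^-1) (1 - p.[w]^-1).
  by rewrite subrKC nc1 ncV ncC; lra.
by rewrite -[leLHS]invrK -[leRHS]invrK lef_pV2 ?posrE ?invr_gt0 ?nc_gt0.
Qed.

End ExceptionalSet.

(** * Absolutely continuous functions *)

Section AbsoluteContinuity.
Context {R : realType}.
Local Notation mu := (@lebesgue_measure R).
Implicit Types (g k : R -> R) (a b x t : R) (L : seq (R * R)) (O : set R).

Definition ac_on a b g := forall e : R, 0 < e -> exists2 d : R, 0 < d &
  forall (n : nat) (s t : 'I_n -> R),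
    (forall i, [/\ a <= s i, s i < t i & t i <= b]) ->
    trivIset setT (fun i : 'I_n => `]s i, t i[%classic) ->
    \sum_(i < n) (t i - s i) < d -> \sum_(i < n) `|g (t i) - g (s i)| < e.

(** Differentiability as a remainder estimate free of division, so that h = 0 needs no exception and
    increments on both sides of [t] can be added. *)
Definition strong_diff g t v := forall e : R, 0 < e -> exists2 d : R, 0 < d &
  forall h, `|h| < d -> `|g (t + h) - g t - h * v| <= e * `|h|.

(* The intervals of [L] are disjoint, listed from right to left. *)
Fixpoint chain O a x L : Prop :=
  if L is (s, t) :: L' then
    [/\ s < t, t <= x, `]s, t[ `<=` O & chain O a s L']
  else a <= x.

Lemma chain_le O a x L : chain O a x L -> a <= x.
Proof.
elim: L x => [//|[s t] L IH] x /= [st tx _ /IH h].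
by rewrite (le_trans h) // (le_trans (ltW st)).
Qed.

Lemma chain_widen O a x y L : x <= y -> chain O a x L -> chain O a y L.
Proof.
case: L => [|[s t] L] xy /=; first by move=> h; exact: le_trans xy.
by move=> [st tx h1 h2]; split => //; exact: le_trans xy.
Qed.

Lemma chain_nth O a x L (i : 'I_(size L)) : chain O a x L ->
  [/\ a <= (nth (0, 0) L i).1, (nth (0, 0) L i).1 < (nth (0, 0) L i).2 &
      (nth (0, 0) L i).2 <= x].
Proof.
case: i => i /=; elim: L i x => [//|[s t] L IH] [|i] x /=.
  by move=> _ [st tx _ /chain_le].
rewrite ltnS => iL [st tx _ hL]; have [h1 h2 h3] := IH i s iL hL.
by split => //; rewrite (le_trans h3) // (le_trans (ltW st)).
Qed.

Lemma chain_disjoint O a x L (i j : nat) : chain O a x L ->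
  (i < j)%N -> (j < size L)%N -> (nth (0, 0) L j).2 <= (nth (0, 0) L i).1.
Proof.
elim: L i j x => [//|[s t] L IH] [|i] [|j] x //= [st tx _ hL].
  move=> _ jL; by have [] := @chain_nth _ _ _ _ (@Ordinal (size L) j jL) hL.
by rewrite !ltnS => ij jL; exact: IH hL ij jL.
Qed.

Lemma chain_trivIset O a x L : chain O a x L ->
  trivIset setT (fun i : 'I_(size L) =>
    `](nth (0, 0) L i).1, (nth (0, 0) L i).2[%classic).
Proof.
move=> hL i j _ _ [y [/=]]; rewrite !in_itv /= => /andP[i1 i2] /andP[j1 j2].
apply/val_inj => /=; case: (ltngtP i j) => // ij.
  have := chain_disjoint hL ij (ltn_ord j).
  by rewrite leNgt (lt_trans i1 j2).
have := chain_disjoint hL ij (ltn_ord i).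
by rewrite leNgt (lt_trans j1 i2).
Qed.

(** Stated for any monotone finitely additive [nu], because it is applied both to Lebesgue measure
    and to the integral of |k|. *)
Lemma chain_sum (nu : set R -> \bar R) O a x L : open O ->
  (forall A, 0 <= nu A)%E ->
  (forall A B, measurable A -> measurable B -> A `<=` B -> nu A <= nu B)%E ->
  (forall A B, measurable A -> measurable B -> [disjoint A & B] ->
    nu (A `|` B) = nu A + nu B)%E ->
  chain O a x L ->
  (\sum_(p <- L) nu `]p.1, p.2[%classic <= nu (O `&` `]-oo, x[%classic))%E.
Proof.
move=> oO nu0 nuS nuU; elim: L x => [x _|[s t] L IH x [st tx sO hL]].
  by rewrite big_nil.
have mO y : measurable (O `&` `]-oo, y[%classic : set R).
  by apply: measurableI; [exact: open_measurable|exact: measurable_itv].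
rewrite big_cons /=; apply: le_trans (leeD (lexx _) (IH _ hL)) _.
rewrite -nuU //; last first.
  apply/disj_setPS => y [/=]; rewrite !in_itv /= => /andP[y1 _] [_].
  by rewrite ltNge (ltW y1).
apply: nuS => //; first exact: measurableU.
move=> y [|[Oy]] /=.
  by move=> hy; split; [exact: sO|]; move: hy;
    rewrite /= !in_itv /= => /andP[_ h]; exact: lt_le_trans tx.
by rewrite !in_itv /= => ys; split => //; rewrite (lt_trans ys) // (lt_le_trans st).
Qed.

(** Continuous induction along [a, b], in the manner of Cousin's lemma. Around each point an
    interval either has a small increment of [H] or lies in [O]; intervals of the second kind are
    recorded in the chain. The supremum of the points reached is itself reached and cannot be
    smaller than b. *)
Lemma gauge_chain (H : R -> R) a b O (eta : R) : a <= b -> 0 <= eta ->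
  (forall t, a <= t <= b -> exists2 d : R, 0 < d &
     forall x y, x <= t <= y -> t - d < x -> y < t + d -> a <= x -> y <= b ->
       H y - H x <= eta * (y - x) \/ `]x, y[ `<=` O) ->
  exists2 L, chain O a b L &
    H b - H a <= eta * (b - a) + \sum_(p <- L) `|H p.2 - H p.1|.
Proof.
move=> ab eta0 gauge.
pose Q x := exists2 L, chain O a x L &
    H x - H a <= eta * (x - a) + \sum_(p <- L) `|H p.2 - H p.1|.
have Qa : Q a.
  by exists [::] => /=; rewrite ?lexx // big_nil !subrr mulr0 addr0.
have step x y : x <= y -> Q x -> 
    H y - H x <= eta * (y - x) \/ `]x, y[ `<=` O -> Q y.
  rewrite le_eqVlt => /predU1P[<- //|xy] [L cL hL] [h|h].
    by exists L; [exact: (chain_widen (ltW xy) cL)|lra].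
  exists ((x, y) :: L) => //=; rewrite big_cons /=.
  have := ler_norm (H y - H x); have := mulr_ge0 eta0 (_ : 0 <= y - x).
  by rewrite subr_ge0 (ltW xy) => /(_ isT); lra.
pose S := [set x | a <= x <= b /\ Q x].
have Sa : S a by rewrite /S /= lexx.
have Sub : ubound S b by move=> x [/andP[]].
have supS : has_sup S by split; [exists a|exists b].
set c := sup S.
have ac : a <= c by apply: ub_le_sup => //; exists b.
have cb : c <= b by apply: ge_sup => //; exists a.
have [d d0 hd] : exists2 d : R, 0 < d & forall x y, x <= c <= y ->
    c - d < x -> y < c + d -> a <= x -> y <= b ->
    H y - H x <= eta * (y - x) \/ `]x, y[ `<=` O.
  by apply: gauge; rewrite ac.
have [x [/andP[ax xb] Qx] cx] := sup_adherent d0 supS.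
rewrite -/c in cx.
have xc : x <= c.
  by apply: ub_le_sup; [exists b|split => //; rewrite ax].
have Qy y : c <= y -> y < c + d -> y <= b -> Q y.
  move=> cy yd yb; apply: (step x y (le_trans xc cy) Qx).
  by apply: hd => //; rewrite xc.
have [cltb|bc] := ltP c b; last first.
  by apply: Qy => //; rewrite (le_lt_trans bc) // ltrDl.
pose y := Num.min b (c + d / 2).
have cy : c < y by rewrite lt_min cltb /= ltrDl divr_gt0.
have yb : y <= b by rewrite ge_min lexx.
have yd : y < c + d.
  have : y <= c + d / 2 by rewrite ge_min lexx orbT.
  by move=> h; apply: le_lt_trans h _; rewrite ltrD2l ltr_pdivrMr // ltr_pMr // ltr1n.
have Sy : S y.
  by split; [rewrite (le_trans ac (ltW cy))|apply: Qy => //; exact: ltW].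
have : y <= c by apply: ub_le_sup => //; exists b.
by rewrite leNgt cy.
Qed.

Lemma strong_diff_derive (f : R -> R) x (l : R) : derivable f x 1 -> derive1 f x = l ->
  strong_diff f x l.
Proof.
move=> df dl e e0.
have : h^-1 *: (f (h *: 1 + x) - f x) @[h --> 0^'] --> l.
  by rewrite -dl derive1E; exact: df.
move=> /cvgrPdist_le /(_ e e0); rewrite near_withinE => -[d /= d0 hd].
exists d => // h hh.
have [->|h0] := eqVneq h 0.
  by rewrite addr0 subrr mul0r subr0 normr0 mulr0.
have := hd h; rewrite /ball_ /= sub0r normrN => /(_ hh h0).
rewrite scaler1 [h + x]addrC => hle.
have -> : f (x + h) - f x - h * l = - h * (l - h^-1 *: (f (x + h) - f x)).
  by rewrite /GRing.scale /=; field.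
by rewrite normrM normrN mulrC; apply: ler_wpM2r.
Qed.

(* The exceptional null set is covered by an open set of small measure, on which
   absolute continuity makes the increments of [g] negligible. *)
Lemma ac_increment_le g k a b : a <= b -> ac_on a b g ->
  mu.-integrable `[a, b] (EFin \o k) ->
  {ae mu, forall t, a < t < b -> exists2 v, v <= k t & strong_diff g t v} ->
  g b - g a <= \int[mu]_(t in `[a, b]) k t.
Proof.
move=> ab acg ik aeg.
have mab : measurable (`[a, b]%classic : set R) by exact: measurable_itv.
pose kk := k \_ `[a, b].
have ikk : mu.-integrable setT (EFin \o kk).
  by rewrite -restrict_EFin; apply/integrable_restrict => //=; rewrite setTI.
have lkk : locally_integrable [set: R] kk by exact: integrable_locally.
have ikS (B : set R) : measurable B -> mu.-integrable B (EFin \o kk).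
  by move=> mB; exact: integrableS ikk.
pose K y : R := (\int[mu]_(t in `]-oo, y]) kk t)%R.
have Kae : {ae mu, forall x, derivable K x 1 /\ derive1 K x = kk x}.
  by apply: FTC1Ny => // y; exact: ikS.
have KB s t : s <= t -> K t - K s = (\int[mu]_(y in `]s, t]) kk y)%R.
  by move=> st; rewrite /K Rintegral_itvB //; exact: ikS.
have Kab : K b - K a = (\int[mu]_(t in `[a, b]) k t)%R.
  rewrite KB // Rintegral_itv_obnd_cbnd; last first.
    exact: ikS.
  by apply: eq_Rintegral => t ht; rewrite /kk patchE ht.
rewrite -Kab -subr_ge0 -opprB oppr_ge0.
pose H x := g x - K x.
have -> : g b - g a - (K b - K a) = H b - H a by rewrite /H; ring.
apply/ler_addgt0Pr => e e0; rewrite add0r.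
have e3 : 0 < e / 3 by rewrite divr_gt0.
have [d1 d10 hd1] := acg _ e3.
have [d2 [d20 hd2]] := integral_normr_continuous ikk e3.
have [N [mN N0 hN]] : mu.-negligible (~` [set t | (a < t < b ->
      exists2 v, v <= k t & strong_diff g t v) /\
      (derivable K t 1 /\ derive1 K t = kk t)]).
  exact: (@filterI _ _ (ae_filter_ringOfSetsType mu) _ _ aeg Kae).
(* The endpoints join the null set because the derivative of [g] is controlled only in the open
   interval. *)
pose N' : set R := N `|` [set a; b].
have mN' : measurable N'.
  by apply: measurableU => //; apply: measurableU.
have muN' : mu N' = 0%E.
  apply/eqP; rewrite eq_le measure_ge0 andbT.
  have m2 : measurable ([set a; b] : set R) by exact: measurableU.
  apply: le_trans (measureU2 mu mN m2) _.
  rewrite [X in (X + _)%E](_ : _ = 0%E) ?add0e //.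
  apply: le_trans (measureU2 mu (measurable_set1 a) (measurable_set1 b)) _.
  have e1 (y : R) : mu [set y] = 0%E by exact: lebesgue_measure_set1.
  by rewrite [X in (X + _)%E](e1 a) [X in (_ + X)%E](e1 b) adde0.
pose d := Num.min d1 d2.
have d0 : 0 < d by rewrite lt_min d10.
have [G [oO NO muO]] : exists G : set R,
    [/\ open G, N' `<=` G & (mu G < d%:E)%E].
  have muNy : (mu N' < +oo)%E by rewrite muN' ltry.
  have [U [oU NU hU]] := lebesgue_regularity_outer mN' muNy d0.
  exists U; split => //; apply: le_lt_trans hU.
  have mU : measurable (U `\` N').
    by apply: measurableD => //; exact: open_measurable.
  have UE : (U `\` N') `|` N' = U by rewrite setUC setDUK.
  rewrite -[X in (mu X <= _)%E]UE; apply: le_trans (measureU2 mu mU mN') _.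
  by rewrite [X in (_ + X)%E]muN' adde0.
have eta0 : 0 < e / 3 / (b - a + 1) by rewrite !divr_gt0 // ltr_wpDl // subr_ge0.
set eta := e / 3 / _ in eta0.
have [] := @gauge_chain H a b G eta ab (ltW eta0).
  move=> t /andP[ta tb].
  have [tN|tN] := pselect (N' t).
    have /NO Ot := tN; move: oO; rewrite openE => /(_ t Ot).
    move=> [r /= r0 hr]; exists r => // x y /andP[xt ty] xr yr _ _; right.
    move=> z; rewrite /= in_itv /= => /andP[xz zy]; apply: hr.
    rewrite /ball_ /= ltr_norml; clear -xt ty xr yr xz zy.
    by apply/andP; split; lra.
  have /not_orP[tN1 /not_orP[tna tnb]] := tN.
  have ta' : a < t by rewrite lt_neqAle ta andbT; apply/eqP => h; exact: tna.
  have tb' : t < b by rewrite lt_neqAle tb andbT; apply/eqP => h; exact: tnb.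
  have [] : (a < t < b -> exists2 v, v <= k t & strong_diff g t v) /\
      (derivable K t 1 /\ derive1 K t = kk t).
    by apply: contrapT => h; apply: tN1; apply: hN.
  rewrite ta' tb' => /(_ isT)[v vk hv] [dK dK'].
  have kkt : kk t = k t.
    by rewrite /kk patchE mem_set //= in_itv /= ta tb.
  have hK := strong_diff_derive dK dK'; rewrite kkt in hK.
  (* An interval straddling t splits at t. The remainders of [g] and [K] cost eta / 2 each, and v <=
     k t makes the linear terms nonpositive, so [H] increases by at most eta times the length. *)
  have eta2 : 0 < eta / 2 by rewrite divr_gt0.
  have [r1 r10 hr1] := hv _ eta2; have [r2 r20 hr2] := hK _ eta2.
  exists (Num.min r1 r2); first by rewrite lt_min r10.
  move=> x y /andP[xt ty] xr yr _ _; left.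
  have lmin (q : R) : q < Num.min r1 r2 -> q < r1 /\ q < r2.
    by rewrite lt_min => /andP[].
  have [x1 x2] := lmin (t - x) (ltac:(clear -xr; lra)).
  have [y1 y2] := lmin (y - t) (ltac:(clear -yr; lra)).
  have hx0 : `|x - t| = t - x by rewrite ler0_norm ?opprB ?subr_le0.
  have hy0 : `|y - t| = y - t by rewrite ger0_norm ?subr_ge0.
  have gx := hr1 (x - t); rewrite hx0 in gx; have {}gx := gx x1.
  have gy := hr1 (y - t); rewrite hy0 in gy; have {}gy := gy y1.
  have Kx := hr2 (x - t); rewrite hx0 in Kx; have {}Kx := Kx x2.
  have Ky := hr2 (y - t); rewrite hy0 in Ky; have {}Ky := Ky y2.
  rewrite !subrKC in gx gy Kx Ky.
  move: gx gy Kx Ky; rewrite !ler_norml => /andP[g1 g2] /andP[g3 g4].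
  move=> /andP[K1 K2] /andP[K3 K4]; rewrite /H.
  have hv1 : (y - t) * v <= (y - t) * k t.
    by apply: ler_wpM2l; rewrite ?subr_ge0.
  have hv2 : (t - x) * v <= (t - x) * k t.
    by apply: ler_wpM2l; rewrite ?subr_ge0.
  by clear -g1 g2 g3 g4 K1 K2 K3 K4 hv1 hv2; lra.
move=> L cL hL.
have mO : measurable G by exact: open_measurable.
have mOb : measurable (G `&` `]-oo, b[%classic : set R).
  by apply: measurableI => //; exact: measurable_itv.
have lenL : \sum_(p <- L) (p.2 - p.1) < d.
  have hs : (\sum_(p <- L) (p.2 - p.1)%:E < d%:E)%E.
    apply: le_lt_trans muO; apply: (@le_trans _ _ (mu (G `&` `]-oo, b[%classic))).
      apply: le_trans (@chain_sum mu G a b L oO _ _ _ cL) => //.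
      - rewrite big_seq [leRHS]big_seq; apply: lee_sum => p pL.
        rewrite lebesgue_measure_itv /= lte_fin.
        have [i ->] : exists i : 'I_(size L), p = nth (0, 0) L i.
          by have /(nthP (0, 0))[i iL <-] := pL; exists (Ordinal iL).
        by have [_ -> _] := chain_nth i cL; rewrite EFinB.
      - by move=> A B mA mB AB; apply: le_measure; rewrite ?inE.
      - by move=> A B mA mB; rewrite disj_set2E => /eqP AB; exact: measureU.
    by apply: le_measure; rewrite ?inE.
  by move: hs; rewrite sumEFin lte_fin.
have sumg : \sum_(p <- L) `|g p.2 - g p.1| < e / 3.
  rewrite (big_nth (0, 0)) big_mkord.
  apply: hd1; [by move=> i; exact: chain_nth cL|exact: chain_trivIset cL|].
  have : \sum_(p <- L) (p.2 - p.1) < d1.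
    by apply: lt_le_trans lenL _; rewrite ge_min lexx.
  by rewrite (big_nth (0, 0)) big_mkord.
have sumK : \sum_(p <- L) `|K p.2 - K p.1| <= e / 3.
  pose nu (A : set R) := (\int[mu]_(x in A) `|kk x|%:E)%E.
  have mkk (A : set R) : measurable_fun A (fun x => `|kk x|%:E).
    apply/measurable_EFinP; apply: measurableT_comp => //.
    by apply: measurable_funTS; have /measurable_EFinP := measurable_int mu ikk.
  have kk0 x : (0 <= `|kk x|%:E)%E by rewrite lee_fin.
  have EN (A : set R) : measurable A -> ((\int[mu]_(x in A) `|kk x|)%R)%:E = nu A.
    move=> mA; rewrite /Rintegral fineK //; apply: integrable_fin_num => //.
    exact: (integrable_norm (ikS _ mA)).
  have muOb : (mu (G `&` `]-oo, b[%classic) < d2%:E)%E.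
    apply: (@le_lt_trans _ _ (mu G)); first by apply: le_measure; rewrite ?inE.
    by apply: lt_le_trans muO _; rewrite lee_fin ge_min lexx orbT.
  have nuO : (nu (G `&` `]-oo, b[%classic) <= (e / 3)%:E)%E.
    by have := hd2 _ mOb muOb => /ltW; rewrite -lee_fin EN.
  rewrite -lee_fin -sumEFin; apply: le_trans nuO.
  apply: le_trans (@chain_sum nu G a b L oO _ _ _ cL).
  - rewrite big_seq [leRHS]big_seq; apply: lee_sum => p pL.
    have [i ->] : exists i : 'I_(size L), p = nth (0, 0) L i.
      by have /(nthP (0, 0))[i iL <-] := pL; exists (Ordinal iL).
    have [_ pp _] := chain_nth i cL; rewrite KB ?(ltW pp) //.
    apply: (@le_trans _ _ (nu `](nth (0, 0) L i).1, (nth (0, 0) L i).2]%classic)).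
      rewrite -EN //.
      by rewrite lee_fin; apply: le_normr_Rintegral => //; exact: ikS.
    rewrite /nu -integral_itv_bndo_bndc; [exact: lexx|exact: mkk].
  - by move=> A; apply: integral_ge0 => x _; exact: kk0.
  - move=> A B mA mB AB.
    exact: (ge0_subset_integral mu mA mB (mkk _) (fun x _ => kk0 x) AB).
  - move=> A B mA mB AB.
    exact: (ge0_integral_setU mu mA mB (mkk _) (fun x _ => kk0 x) AB).
have sumH : \sum_(p <- L) `|H p.2 - H p.1| <= e / 3 + e / 3.
  apply: (@le_trans _ _ (\sum_(p <- L) (`|g p.2 - g p.1| + `|K p.2 - K p.1|))).
    apply: ler_sum => p _; rewrite /H.
    have -> : g p.2 - K p.2 - (g p.1 - K p.1) = (g p.2 - g p.1) - (K p.2 - K p.1).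
      by ring.
    exact: ler_normB.
  by rewrite big_split /=; apply: lerD => //; exact: ltW.
have : eta * (b - a) <= e / 3.
  rewrite /eta mulrAC ler_pdivrMr; last by rewrite ltr_wpDl // subr_ge0.
  by apply: ler_wpM2l; [exact: ltW|rewrite lerDl].
lra.
Qed.

End AbsoluteContinuity.

(** * Discretisation of the Dirac system *)

Section Duhamel.
Context {R : realType}.
Local Notation mu := (@lebesgue_measure R).
Implicit Types (Y Z : R -> Cx R) (p q : R -> R) (a b s t : R).

(* Absolute continuity and differentiability of complex functions are tested on
   the real parts of all their rotations. *)
Definition cac_on a b Y :=
  forall c : Cx R, nc c = 1 -> ac_on a b (fun t => re (c * Y t)).

Definition cdiff Y t (v : Cx R) :=
  forall c : Cx R, strong_diff (fun s => re (c * Y s)) t (re (c * v)).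

Lemma nc_le_re (z : Cx R) (B : R) :
  (forall c, nc c = 1 -> re (c * z) <= B) -> 0 <= B -> nc z <= B.
Proof.
move=> h B0; have [->|z0] := eqVneq z 0; first by rewrite nc0.
have nz : nc z != 0 by rewrite nc_eq0.
have nz0 : 0 < nc z by rewrite nc_gt0.
have := h (cx (nc z)^-1 0 * cj z).
rewrite ncM nc_real nc_cj ger0_norm ?invr_ge0 ?nc_ge0 // mulVf // => /(_ erefl).
rewrite -mulrA (mulrC (cj z)) mul_cj reM re_cx !im_cx re_cx mulr0 subr0.
by rewrite expr2 mulrA mulVf // mul1r.
Qed.

Lemma duhamel_step Y Z (m : Cx R) p q s t (w : R) : s <= t -> cac_on s t Y ->
  mu.-integrable `[s, t] (EFin \o p) -> mu.-integrable `[s, t] (EFin \o q) ->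
  {ae mu, forall x, s < x < t ->
    cdiff Y x (m * Y x + cx (p x) (q x) * Z x)} ->
  (forall x, s <= x <= t -> nc (Y x - Y s) <= w) ->
  (forall x, s <= x <= t -> nc (Z x - Z s) <= w) ->
  nc (Y t - Y s - (m * cx (t - s) 0 * Y s +
    cx (\int[mu]_(x in `[s, t]) p x) (\int[mu]_(x in `[s, t]) q x) * Z s)) <=
  w * (nc m * (t - s) +
       (\int[mu]_(x in `[s, t]) `|p x| + \int[mu]_(x in `[s, t]) `|q x|)).
Proof.
move=> st acY ip iq aeY hY hZ.
have ss : s <= s <= t by rewrite lexx.
have w0 : 0 <= w by apply: le_trans (hY s ss); exact: nc_ge0.
have mst : measurable (`[s, t]%classic : set (measurableTypeR R)).
  exact: measurable_itv.
have ip' : mu.-integrable `[s, t] (EFin \o (fun x => `|p x|)).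
  exact: integrable_norm.
have iq' : mu.-integrable `[s, t] (EFin \o (fun x => `|q x|)).
  exact: integrable_norm.
have Ip : 0 <= \int[mu]_(x in `[s, t]) `|p x| by apply: Rintegral_ge0.
have Iq : 0 <= \int[mu]_(x in `[s, t]) `|q x| by apply: Rintegral_ge0.
apply: nc_le_re => [c c1|]; last first.
  by rewrite mulr_ge0 // !addr_ge0 // mulr_ge0 ?nc_ge0 // subr_ge0.
pose k0 : R := re (c * m * Y s) + w * nc m.
pose k1 : R := re (c * Z s). pose k2 : R := - im (c * Z s).
pose k x : R := k0 + k1 * p x + k2 * q x + w * `|p x| + w * `|q x|.
have icst (r : R) : mu.-integrable `[s, t] (EFin \o (fun=> r)).
  by apply: continuous_itv_integrable; exact: cst_continuous.
have iZ (r : R) (f : R -> R) : mu.-integrable `[s, t] (EFin \o f) ->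
    mu.-integrable `[s, t] (EFin \o (fun x => r * f x)).
  move=> jf; rewrite (_ : _ \o _ = (fun x => r%:E * (EFin \o f) x)%E).
    exact: integrableZl.
  by apply/funext => x /=; rewrite EFinM.
have iD (f g : R -> R) : mu.-integrable `[s, t] (EFin \o f) ->
    mu.-integrable `[s, t] (EFin \o g) ->
    mu.-integrable `[s, t] (EFin \o (fun x => f x + g x)).
  by move=> jf jg; rewrite (_ : _ \o _ = (EFin \o f) \+ (EFin \o g)) //;
    exact: integrableD.
have i1 := iD _ _ (icst k0) (iZ k1 _ ip).
have i2 := iD _ _ i1 (iZ k2 _ iq).
have i3 := iD _ _ i2 (iZ w _ ip').
have i4 := iD _ _ i3 (iZ w _ iq').
have Ik : \int[mu]_(x in `[s, t]) k x = k0 * (t - s) +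
    k1 * (\int[mu]_(x in `[s, t]) p x) + k2 * (\int[mu]_(x in `[s, t]) q x) +
    w * (\int[mu]_(x in `[s, t]) `|p x|) + w * (\int[mu]_(x in `[s, t]) `|q x|).
  rewrite /k (RintegralD mst i3 (iZ w _ iq')) (RintegralD mst i2 (iZ w _ ip')).
  rewrite (RintegralD mst i1 (iZ k2 _ iq)) (RintegralD mst (icst k0) (iZ k1 _ ip)).
  rewrite (RintegralZl _ mst ip) (RintegralZl _ mst iq).
  rewrite (RintegralZl _ mst ip') (RintegralZl _ mst iq').
  by rewrite -/(sint s t (fun=> k0)) sint_cst.
have aek : {ae mu, forall x, s < x < t -> exists2 v, v <= k x &
    strong_diff (fun x => re (c * Y x)) x v}.
  apply: filterS aeY; first exact: (ae_filter_ringOfSetsType mu).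
  move=> x hx sxt; exists (re (c * (m * Y x + cx (p x) (q x) * Z x))).
    have sx : s <= x <= t by case/andP: sxt => /ltW -> /ltW ->.
    have -> : c * (m * Y x + cx (p x) (q x) * Z x) =
      c * m * Y s + c * Z s * cx (p x) (q x) +
      (c * m * (Y x - Y s) + c * cx (p x) (q x) * (Z x - Z s)) by ring.
    rewrite reD; have := re_le_nc (c * m * (Y x - Y s) +
      c * cx (p x) (q x) * (Z x - Z s)).
    have h1 : nc (c * m * (Y x - Y s)) <= nc m * w.
      by rewrite !ncM c1 mul1r; apply: ler_wpM2l; rewrite ?nc_ge0 ?hY.
    have h2 : nc (c * cx (p x) (q x) * (Z x - Z s)) <= (`|p x| + `|q x|) * w.
      rewrite !ncM c1 mul1r; apply: ler_pM; rewrite ?nc_ge0 ?hZ //.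
      exact: nc_cx_le.
    have h3 := ncD (c * m * (Y x - Y s)) (c * cx (p x) (q x) * (Z x - Z s)).
    rewrite /k /k0 /k1 /k2 => h4.
    have -> : re (c * m * Y s + c * Z s * cx (p x) (q x)) = re (c * m * Y s) +
      re (c * Z s) * p x - im (c * Z s) * q x.
      by rewrite reD (reM _ (cx _ _)) re_cx im_cx addrA.
    move: (le_trans h4 h3) h1 h2; clear; lra.
  exact: hx.
have := ac_increment_le st (acY c c1) i4 aek; rewrite -/k Ik /k0 /k1 /k2.
set Ip1 := \int[mu]_(x in _) p x; set Iq1 := \int[mu]_(x in _) q x => h.
have -> : re (c * (Y t - Y s - (m * cx (t - s) 0 * Y s + cx Ip1 Iq1 * Z s))) =
    re (c * Y t) - re (c * Y s) - (re (c * m * Y s) * (t - s) +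
      re (c * Z s) * Ip1 - im (c * Z s) * Iq1).
  have -> : c * (Y t - Y s - (m * cx (t - s) 0 * Y s + cx Ip1 Iq1 * Z s)) =
    c * Y t - c * Y s - (c * m * Y s * cx (t - s) 0 + c * Z s * cx Ip1 Iq1).
    by ring.
  rewrite reD reN reD reN reD (reM _ (cx (t - s) 0)) (reM _ (cx Ip1 Iq1)).
  by rewrite !re_cx !im_cx mulr0 subr0 !addrA.
by move: h; clear; lra.
Qed.

Lemma cexp_expansion (x : R) :
  nc (cexp x - 1) <= 2 * `|x| /\ nc (cexp x - 1 - cx 0 x) <= 2 * x ^+ 2.
Proof.
have S (y : R) : 0 <= y -> `|sin y| <= y.
  move=> y0; have [c _] := @MVT_segment R sin cos 0 y y0
    (fun x _ => is_derive_sin x) (continuous_subspaceT (@continuous_sin R)).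
  by rewrite sin0 !subr0 => ->; rewrite normrM (ger0_norm y0) ler_piMl // cos_max.
have C (y : R) : 0 <= y -> exists2 c, 0 <= c <= y & `|cos y - 1| = `|sin c| * y.
  move=> y0; have [c] := @MVT_segment R cos (fun t => - sin t) 0 y y0
    (fun x _ => is_derive_cos x) (continuous_subspaceT (@continuous_cos R)).
  rewrite in_itv /= cos0 subr0 => cy ->.
  by exists c => //; rewrite normrM normrN (ger0_norm y0).
have C1 (y : R) : 0 <= y -> `|cos y - 1| <= y.
  by move=> y0; have [c _ ->] := C y y0; rewrite ler_piMl // sin_max.
have C2 (y : R) : 0 <= y -> `|cos y - 1| <= y ^+ 2.
  move=> y0; have [c /andP[c0 cy] ->] := C y y0.
  by rewrite expr2 ler_wpM2r // (le_trans (S c c0)).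
have D (y : R) : 0 <= y -> `|sin y - y| <= y ^+ 2.
  move=> y0.
  have dd (z : R) : is_derive z 1 (fun t => sin t - t) (cos z - 1).
    by apply: is_derive_eq.
  have cc : continuous (fun t : R => sin t - t).
    by move=> z; apply: cvgB; [exact: continuous_sin|exact: cvg_id].
  have [c] := @MVT_segment R (fun t => sin t - t) (fun t => cos t - 1) 0 y y0
    (fun x _ => dd x) (continuous_subspaceT cc).
  rewrite in_itv /= sin0 !subr0 => /andP[c0 cy] ->.
  by rewrite normrM (ger0_norm y0) expr2 ler_wpM2r // (le_trans (C1 c c0)).
have [x0|x0] := leP 0 x.
  rewrite (ger0_norm x0); split.
    rewrite (_ : cexp x - 1 = cx (cos x - 1) (sin x)); last first.
      by apply: cxP; rewrite !reimE ?oppr0 ?addr0.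
    by apply: le_trans (nc_cx_le _ _) _; have := C1 x x0; have := S x x0; lra.
  rewrite (_ : cexp x - 1 - _ = cx (cos x - 1) (sin x - x)); last first.
    by apply: cxP; rewrite !reimE /=; ring.
  by apply: le_trans (nc_cx_le _ _) _; have := C2 x x0; have := D x x0; lra.
have y0 : 0 <= - x by rewrite oppr_ge0 ltW.
rewrite (ltr0_norm x0); split.
  rewrite (_ : cexp x - 1 = cx (cos (- x) - 1) (- sin (- x))); last first.
    by apply: cxP; rewrite !reimE ?cosN ?sinN ?opprK ?oppr0 ?addr0.
  apply: le_trans (nc_cx_le _ _) _; rewrite (normrN (sin _)).
  by have := C1 _ y0; have := S _ y0; lra.
rewrite (_ : cexp x - 1 - _ = cx (cos (- x) - 1) (- (sin (- x) - - x))); last first.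
  by apply: cxP; rewrite !reimE /= ?cosN ?sinN; ring.
apply: le_trans (nc_cx_le _ _) _; rewrite (normrN (sin _ - _)) -(sqrrN x).
by have := C2 _ y0; have := D _ y0; lra.
Qed.

(** Relative to [duhamel_step], 1 + i l (t - s) is replaced by [xi] and [gam] by gam / xi. Both
    changes are of second order over a cell and make the step conjugate to a Szego step. The signs
    of [l] and [q] are free so that it serves both components. *)
Lemma scheme_step Y Z (l : R) p q s t (w B : R) : s <= t -> cac_on s t Y ->
  mu.-integrable `[s, t] (EFin \o p) -> mu.-integrable `[s, t] (EFin \o q) ->
  {ae mu, forall x, s < x < t ->
    cdiff Y x (cx 0 l * Y x + cx (p x) (q x) * Z x)} ->
  (forall x, s <= x <= t -> nc (Y x - Y s) <= w) ->
  (forall x, s <= x <= t -> nc (Z x - Z s) <= w) ->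
  nc (Y s) <= B -> nc (Z s) <= B -> forall (xi gam : Cx R) (G : R),
  xi = cexp (l * (t - s)) ->
  gam = cx (\int[mu]_(x in `[s, t]) p x) (\int[mu]_(x in `[s, t]) q x) ->
  G = \int[mu]_(x in `[s, t]) `|p x| + \int[mu]_(x in `[s, t]) `|q x| ->
  nc (Y t - (xi * Y s + gam * xi^-1 * Z s)) <=
  w * (`|l| * (t - s) + G) + 2 * (l * (t - s)) ^+ 2 * B +
  2 * (`|l| * (t - s)) * G * B.
Proof.
move=> st acY ip iq aeY hY hZ YB ZB xi gam G xiE gamE GE.
have := duhamel_step st acY ip iq aeY hY hZ; rewrite -gamE -GE.
have -> : nc (cx 0 l) = `|l|.
  rewrite (_ : cx 0 l = cx l 0 * cx 0 1); last first.
    by apply: cxP; rewrite !reimE; ring.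
  by rewrite ncM nc_real nc_i mulr1.
have [e1 e2] := cexp_expansion (l * (t - s)); rewrite -xiE in e1 e2.
have x1 : nc xi = 1 by rewrite xiE nc_cexp.
have xi0 : xi != 0 by rewrite xiE cexp_neq0.
have hl : `|l * (t - s)| = `|l| * (t - s).
  by rewrite normrM (@ger0_norm _ (t - s)) // subr_ge0.
have e3 : nc (xi^-1 - 1) <= 2 * (`|l| * (t - s)).
  have -> : xi^-1 - 1 = - (xi^-1 * (xi - 1)) by rewrite mulrBr mulVf // mulr1 opprB.
  by rewrite ncN ncM ncV x1 invr1 mul1r -hl.
have gG : nc gam <= G.
  rewrite gamE GE; apply: le_trans (nc_cx_le _ _) _.
  by apply: lerD; apply: le_normr_Rintegral.
have -> : Y t - (xi * Y s + gam * xi^-1 * Z s) =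
    (Y t - Y s - (cx 0 l * cx (t - s) 0 * Y s + gam * Z s)) -
    ((xi - 1 - cx 0 (l * (t - s))) * Y s + gam * (xi^-1 - 1) * Z s).
  have -> : cx 0 (l * (t - s)) = cx 0 l * cx (t - s) 0.
    by apply: cxP; rewrite !reimE; ring.
  by ring.
move=> h; apply: le_trans (ncB _ _) _; rewrite -[leRHS]addrA; apply: lerD => //.
apply: le_trans (ncD _ _) _; rewrite !ncM; apply: lerD.
  by apply: ler_pM; rewrite ?nc_ge0.
apply: ler_pM; rewrite ?mulr_ge0 ?nc_ge0 //.
by rewrite mulrC; apply: ler_pM; rewrite ?nc_ge0.
Qed.

End Duhamel.

(** * Convergence of the discrete scheme as h tends to 0 *)

Section SchemeConvergence.
Context {R : realType}.
Local Notation mu := (@lebesgue_measure R).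
Implicit Types (Y P M : R -> Cx R) (p q f : R -> R) (a b s t T h l : R).

(** The rotations 1 and i recover the real and the imaginary part, each to within w / 2. *)
Lemma cac_uniform b Y (w : R) : cac_on 0 b Y -> 0 < w ->
  exists2 d : R, 0 < d & forall s t, 0 <= s -> s <= t -> t <= b ->
    t - s < d -> nc (Y t - Y s) <= w.
Proof.
move=> acY w0; have w2 : 0 < w / 2 by rewrite divr_gt0.
have acc c : nc c = 1 -> exists2 d : R, 0 < d & forall s t, 0 <= s -> s < t ->
    t <= b -> t - s < d -> `|re (c * (Y t - Y s))| < w / 2.
  move=> c1; have [d d0 hd] := acY c c1 _ w2; exists d => // s t s0 st tb sd.
  have := hd 1%N (fun=> s) (fun=> t); rewrite !big_ord1 mulrBr reD reN; apply => //.
  by move=> i j _ _ _; rewrite (ord1 i) (ord1 j).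
have [d1 d10 h1] := acc 1 nc1; have [d2 d20 h2] := acc (cx 0 1) nc_i.
exists (Num.min d1 d2); first by rewrite lt_min d10.
move=> s t s0; rewrite le_eqVlt => /predU1P[<- _ _|st tb].
  by rewrite subrr nc0 ltW.
rewrite lt_min => /andP[sd1 sd2].
have := h1 s t s0 st tb sd1; have := h2 s t s0 st tb sd2.
set z := Y t - Y s; rewrite mul1r reM re_cx im_cx mul0r mul1r sub0r normrN => e1 e2.
rewrite (cxE z); apply: le_trans (nc_cx_le _ _) _; lra.
Qed.

Lemma cac_bounded b Y : 0 <= b -> cac_on 0 b Y -> exists2 B : R, 0 <= B &
  forall t, 0 <= t <= b -> nc (Y t) <= B.
Proof.
move=> b0 acY; have [d d0 hd] := cac_uniform acY ltr01.
have step (n : nat) t : 0 <= t <= b -> t <= n%:R * (d / 2) ->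
    nc (Y t) <= nc (Y 0) + n%:R.
  elim: n t => [|n IH] t /andP[t0 tb] ht.
    have -> : t = 0 by apply/eqP; rewrite eq_le t0 andbT; move: ht; rewrite mul0r.
    by rewrite addr0.
  have [tn|tn] := leP t (n%:R * (d / 2)).
    apply: le_trans (IH t _ tn) _; first by rewrite t0.
    by rewrite lerD2l ler_nat.
  pose s := Num.max 0 (t - d / 2).
  have s0 : 0 <= s by rewrite le_max lexx.
  have st : s <= t by rewrite ge_max t0 gerBl divr_ge0 // ltW.
  have sd : t - s < d.
    have : t - d / 2 <= s by rewrite le_max lexx orbT.
    by lra.
  have sn : s <= n%:R * (d / 2).
    rewrite ge_max mulr_ge0 ?divr_ge0 ?(ltW d0) //= lerBlDr.
    by move: ht; rewrite -natr1 mulrDl mul1r.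
  have sb : 0 <= s <= b by rewrite s0 (le_trans st).
  have := ncD (Y s) (Y t - Y s); rewrite subrKC => h.
  have := IH s sb sn; have := hd s t s0 st tb sd; rewrite -natr1; lra.
have d20 : 0 < d / 2 by rewrite divr_gt0.
have [n hn] : exists n : nat, b <= n%:R * (d / 2).
  exists (Num.truncn (b / (d / 2))).+1; rewrite -ler_pdivrMr //.
  by rewrite ltW // truncnS_gt.
exists (nc (Y 0) + n%:R); first by rewrite addr_ge0 // nc_ge0.
by move=> t tb; apply: step => //; case/andP: tb => _ h; exact: le_trans hn.
Qed.

(** The diagonalised system for P = f_1 + i f_2 and M = f_1 - i f_2, with the off-diagonal
    coefficient p + i q and its conjugate. *)
Definition dirac_pair p q l P M :=
  [/\ forall b, 0 < b -> cac_on 0 b P, forall b, 0 < b -> cac_on 0 b M,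
      {ae mu, forall t, 0 < t ->
        cdiff P t (cx 0 l * P t + cx (p t) (q t) * M t)} &
      {ae mu, forall t, 0 < t ->
        cdiff M t (cx 0 (- l) * M t + cx (p t) (- q t) * P t)}].

Definition locally_int f := forall a b, mu.-integrable `[a, b] (EFin \o f).

Definition grid T h (k : nat) : R := T + k%:R * h.

Lemma gridS T h k : grid T h k.+1 = grid T h k + h.
Proof. by rewrite /grid -natr1 mulrDl mul1r addrA. Qed.

Lemma grid_mono T h k j : 0 <= h -> (k <= j)%N -> grid T h k <= grid T h j.
Proof. by move=> h0 kj; rewrite lerD2l ler_wpM2r // ler_nat. Qed.

Definition cell T h k : set R := `[grid T h k, grid T h k.+1].

Definition gam p q T h k : Cx R :=
  cx (\int[mu]_(x in cell T h k) p x) (\int[mu]_(x in cell T h k) q x).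

Lemma cell_sum f T h n : 0 <= h -> locally_int f ->
  \sum_(k < n) (\int[mu]_(x in cell T h k) f x) =
  \int[mu]_(x in `[T, T + n%:R * h]) f x.
Proof.
move=> h0 lf; elim: n => [|n IH].
  by rewrite big_ord0 mul0r addr0 set_itv1 Rintegral_set1.
rewrite big_ord_recr /= IH -/(grid T h n) -/(grid T h n.+1).
have g1 : T <= grid T h n by rewrite lerDl mulr_ge0.
have g2 : grid T h n <= grid T h n.+1 by rewrite gridS lerDl.
have := @Rintegral_itvB R f (BLeft T) (BRight (grid T h n.+1)) (grid T h n).
move=> /(_ (lf _ _)); rewrite !bnd_simp => /(_ g1 g2).
rewrite Rintegral_itv_obnd_cbnd; last first.
  apply: integrableS (lf (grid T h n) (grid T h n.+1)) => //.
  by apply: subset_itvr; rewrite bnd_simp.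
by move=> <-; rewrite addrC subrK.
Qed.

Lemma locally_int_norm f : locally_int f -> locally_int (fun x => `|f x|).
Proof. by move=> lf a b; exact: (integrable_norm (lf a b)). Qed.

Lemma ac_on_sub g a b s t : a <= s -> t <= b -> ac_on a b g -> ac_on s t g.
Proof.
move=> as_ tb h e e0; have [d d0 hd] := h e e0; exists d => // n s' t' hi.
apply: hd => i; have [h1 h2 h3] := hi i.
by split => //; [exact: le_trans h1|exact: le_trans tb].
Qed.

Lemma cac_on_sub Y a b s t : a <= s -> t <= b -> cac_on a b Y -> cac_on s t Y.
Proof. by move=> as_ tb h c /h; exact: ac_on_sub. Qed.

Lemma gam_conj p q T h k : locally_int q ->
  cj (gam p q T h k) = gam p (fun x => - q x) T h k.
Proof.
move=> lq; apply: cxP => //; rewrite im_cj /=.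
rewrite -mulN1r -RintegralZl //; [|exact: measurable_itv|exact: lq].
by apply: eq_Rintegral => x _; rewrite mulN1r.
Qed.

(* One step multiplies [P] by [xi = e^{ilh}] and [M] by [xi^-1]; factoring out
   [xi^-1] leaves the Szego step at [xi ^+ 2 = e^{2ihl}]. *)
Lemma scheme_error p q l P M T h (w B : R) (n : nat) :
  dirac_pair p q l P M -> locally_int p -> locally_int q ->
  0 <= T -> 0 < h -> 0 <= w -> 0 <= B ->
  (forall t, T <= t <= grid T h n -> nc (P t) <= B /\ nc (M t) <= B) ->
  (forall s t, T <= s -> s <= t -> t <= grid T h n -> t <= s + h ->
    nc (P t - P s) <= w /\ nc (M t - M s) <= w) ->
  forall G : nat -> R,
  (forall k, G k = \int[mu]_(x in cell T h k) `|p x| +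
                   \int[mu]_(x in cell T h k) `|q x|) ->
  forall k, (k <= n)%N ->
  nc (P (grid T h k) - cexp (l * h) ^- k *
       (szego (gam p q T h) (cexp (2 * h * l)) (P T, M T) k).1) +
  nc (M (grid T h k) - cexp (l * h) ^- k *
       (szego (gam p q T h) (cexp (2 * h * l)) (P T, M T) k).2) <=
  expR (\sum_(j < k) G j) * \sum_(j < k) (2 * (w * (`|l| * h + G j) +
     2 * (l * h) ^+ 2 * B + 2 * (`|l| * h) * G j * B)).
Proof.
move=> [acP acM aeP aeM] lp lq T0 h0 w0 B0 hB hw G hG.
pose err j := w * (`|l| * h + G j) + 2 * (l * h) ^+ 2 * B +
  2 * (`|l| * h) * G j * B.
set xi := cexp (l * h); set y := szego _ _ _.
have xi1 : nc xi = 1 by exact: nc_cexp.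
have xi0 : xi != 0 by exact: cexp_neq0.
have G0 j : 0 <= G j by rewrite hG addr_ge0 //; apply: Rintegral_ge0.
have err0 j : 0 <= err j.
  have lh0 : 0 <= `|l| * h by rewrite mulr_ge0 // ltW.
  rewrite /err; apply: addr_ge0; first apply: addr_ge0.
  - by rewrite mulr_ge0 // addr_ge0.
  - by rewrite mulr_ge0 // mulr_ge0 // sqr_ge0.
  - by rewrite mulr_ge0 // mulr_ge0 // mulr_ge0.
have lnq : locally_int (fun x => - q x).
  move=> a b; rewrite (_ : _ \o _ = -%E \o (EFin \o q)) //; exact: integrableN.
have gG k : nc (gam p q T h k) <= G k.
  rewrite hG; apply: le_trans (nc_cx_le _ _) _; apply: lerD;
    apply: le_normr_Rintegral; by [exact: measurable_itv|exact: lp|exact: lq].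
elim=> [_|k IH kn].
  rewrite !big_ord0 mulr0 /grid mul0r addr0 expr0 invr1 !mul1r !subrr.
  by rewrite nc0 addr0.
have {}IH := IH (ltnW kn).
set s := grid T h k in IH *; set t := grid T h k.+1.
have tE : t = s + h by rewrite /t gridS.
have ts : t - s = h by rewrite tE addrC addKr.
have st : s <= t by rewrite tE lerDl ltW.
have Ts : T <= s by rewrite /s lerDl mulr_ge0 // ltW.
have tn : t <= grid T h n by exact: grid_mono (ltW h0) kn.
have t0 : 0 < t by rewrite tE ltr_wpDl // (le_trans T0).
have sB : nc (P s) <= B /\ nc (M s) <= B by apply: hB; rewrite Ts (le_trans st).
have osc x : s <= x <= t -> nc (P x - P s) <= w /\ nc (M x - M s) <= w.
  by move=> /andP[sx xt]; apply: hw => //; [exact: le_trans tn|rewrite -tE].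
have inside x : s < x < t -> 0 < x.
  by move=> /andP[sx _]; apply: le_lt_trans sx; exact: le_trans Ts.
have s0 : 0 <= s by exact: le_trans Ts.
have hP : nc (P t - (xi * P s + gam p q T h k * xi^-1 * M s)) <= err k.
  have := @scheme_step R P M l p q s t w B st
    (cac_on_sub s0 (lexx t) (acP t t0)) (lp s t) (lq s t) _
    (fun x hx => (osc x hx).1) (fun x hx => (osc x hx).2) sB.1 sB.2.
  rewrite ts; apply => //.
  apply: filterS aeP; first exact: (ae_filter_ringOfSetsType mu).
  by move=> x hx sxt; apply: hx; exact: inside sxt.
(* The equation of M is that of P with [l] and [q] negated; [xi] is then replaced by its inverse and
   [gam] by its conjugate. *)
have hM : nc (M t - (xi^-1 * M s + cj (gam p q T h k) * xi * P s)) <= err k.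
  have := @scheme_step R M P (- l) p (fun x => - q x) s t w B st
    (cac_on_sub s0 (lexx t) (acM t t0)) (lp s t) (lnq s t) _
    (fun x hx => (osc x hx).2) (fun x hx => (osc x hx).1) sB.2 sB.1.
  rewrite ts normrN => step.
  rewrite -[X in _ * X * P s](invrK xi) /err -(sqrrN (l * h)) -mulNr.
  apply: step.
  - apply: filterS aeM; first exact: (ae_filter_ringOfSetsType mu).
    by move=> x hx sxt; apply: hx; exact: inside sxt.
  - apply: (mulfI xi0); rewrite mulfV // mulNr /xi -cexpD subrr cexp0 //.
  - by rewrite gam_conj.
  - rewrite hG; congr (_ + _); apply: eq_Rintegral => x _; by rewrite normrN.
pose a := P s - xi ^- k * (y k).1; pose b := M s - xi ^- k * (y k).2.
rewrite -/a -/b in IH.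
have zE : cexp (2 * h * l) = xi * xi by rewrite -cexpD; congr cexp; ring.
have E1 : P t - xi ^- k.+1 * (y k.+1).1 =
   (P t - (xi * P s + gam p q T h k * xi^-1 * M s)) +
   (xi * a + gam p q T h k * xi^-1 * b).
  rewrite /y /= -/(y k) zE /a /b exprS invfM.
  have -> : xi^-1 * xi ^- k * (xi * xi * (y k).1 + gam p q T h k * (y k).2) =
    xi ^- k * ((xi^-1 * xi) * xi * (y k).1 + gam p q T h k * xi^-1 * (y k).2).
    by ring.
  by rewrite mulVf // mul1r; ring.
have E2 : M t - xi ^- k.+1 * (y k.+1).2 =
   (M t - (xi^-1 * M s + cj (gam p q T h k) * xi * P s)) +
   (xi^-1 * b + cj (gam p q T h k) * xi * a).
  rewrite /y /= -/(y k) zE /a /b exprS invfM.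
  have -> : xi^-1 * xi ^- k *
      ((y k).2 + cj (gam p q T h k) * (xi * xi * (y k).1)) =
    xi ^- k * (xi^-1 * (y k).2 + cj (gam p q T h k) * ((xi^-1 * xi) * xi) * (y k).1).
    by ring.
  by rewrite mulVf // mul1r; ring.
rewrite E1 E2 !big_ord_recr /= -/(err k).
have b1 : nc (xi * a + gam p q T h k * xi^-1 * b) <= nc a + G k * nc b.
  apply: le_trans (ncD _ _) _; rewrite !ncM ncV xi1 invr1 mulr1 mul1r lerD2l.
  by apply: ler_wpM2r => //; exact: nc_ge0.
have b2 : nc (xi^-1 * b + cj (gam p q T h k) * xi * a) <= nc b + G k * nc a.
  apply: le_trans (ncD _ _) _; rewrite !ncM ncV xi1 invr1 nc_cj mulr1 mul1r lerD2l.
  by apply: ler_wpM2r => //; exact: nc_ge0.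
have c1 := ncD (P t - (xi * P s + gam p q T h k * xi^-1 * M s))
  (xi * a + gam p q T h k * xi^-1 * b).
have c2 := ncD (M t - (xi^-1 * M s + cj (gam p q T h k) * xi * P s))
  (xi^-1 * b + cj (gam p q T h k) * xi * a).
set S := \sum_(j < k) G j in IH *.
move: IH; rewrite (eq_bigr (fun j : 'I_k => 2 * err j)) // => IH.
rewrite (eq_bigr (fun j : 'I_k => 2 * err j)) //.
set V := \sum_(j < k) 2 * err j in IH *.
have S0 : 0 <= S by apply: sumr_ge0 => j _.
have V0 : 0 <= V by apply: sumr_ge0 => j _; rewrite mulr_ge0.
apply: (@le_trans _ _ (2 * err k + (1 + G k) * (nc a + nc b))).
  by move: c1 c2 b1 b2 hP hM; clear; lra.
have eS : 1 <= expR (S + G k) by rewrite -expR0 ler_expR addr_ge0.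
have e1 : 1 + G k <= expR (G k) by exact: expR_ge1Dx.
have ab0 : 0 <= nc a + nc b by rewrite addr_ge0 // nc_ge0.
have h1 : (1 + G k) * (nc a + nc b) <= expR (G k) * (expR S * V).
  by apply: ler_pM => //; rewrite addr_ge0.
have h2 : 2 * err k <= expR (S + G k) * (2 * err k).
  by apply: ler_peMl => //; rewrite mulr_ge0.
apply: (@le_trans _ _ (expR (S + G k) * (2 * err k) + expR (S + G k) * V));
  last by rewrite -mulrDr (addrC _ V).
apply: lerD => //.
by rewrite expRD (mulrC (expR S)) -mulrA.
Qed.

(** Summed over the cells, the local errors are at most a constant times w plus a constant times h:
    w is a modulus of continuity of P and M, and the number of cells times h stays below r. Only
    local integrability of the coefficients enters. *)
Lemma scheme_cvg p q l P M T (r eta : R) :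
  dirac_pair p q l P M -> locally_int p -> locally_int q ->
  0 <= T -> 0 < r -> 0 < eta ->
  exists2 h0 : R, 0 < h0 & forall h, 0 < h < h0 -> forall k, k%:R * h <= r ->
  nc (P (grid T h k) - cexp (l * h) ^- k *
       (szego (gam p q T h) (cexp (2 * h * l)) (P T, M T) k).1) +
  nc (M (grid T h k) - cexp (l * h) ^- k *
       (szego (gam p q T h) (cexp (2 * h * l)) (P T, M T) k).2) <= eta.
Proof.
move=> dir lp lq T0 r0 eta0; have [acP acM _ _] := dir.
have b0 : 0 < T + r by rewrite ltr_wpDl.
have [B1 B10 hB1] := cac_bounded (ltW b0) (acP _ b0).
have [B2 B20 hB2] := cac_bounded (ltW b0) (acM _ b0).
pose B := B1 + B2; have B0 : 0 <= B by rewrite addr_ge0.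
pose g : R := \int[mu]_(x in `[T, T + r]) `|p x| +
              \int[mu]_(x in `[T, T + r]) `|q x|.
have g0 : 0 <= g by rewrite addr_ge0 //; apply: Rintegral_ge0.
pose c1 : R := 2 * expR g * (`|l| * r + g).
pose c2 : R := 2 * expR g * (2 * l ^+ 2 * r * B + 2 * `|l| * g * B).
have eg0 : 0 < expR g by exact: expR_gt0.
have r0' := ltW r0; have eg0' := ltW eg0.
have c10 : 0 <= c1.
  by apply: mulr_ge0; [rewrite mulr_ge0|apply: addr_ge0 => //; rewrite mulr_ge0].
have c20 : 0 <= c2.
  apply: mulr_ge0; first by rewrite mulr_ge0.
  apply: addr_ge0; apply: mulr_ge0 => //; apply: mulr_ge0 => //.
  by rewrite mulr_ge0 // sqr_ge0.
pose w := eta / 2 / (c1 + 1).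
have w0 : 0 < w by rewrite !divr_gt0 // ltr_wpDl.
have [d1 d10 hd1] := cac_uniform (acP _ b0) w0.
have [d2 d20 hd2] := cac_uniform (acM _ b0) w0.
pose h0 := Num.min (Num.min d1 d2) (eta / 2 / (c2 + 1)).
exists h0; first by rewrite !lt_min d10 d20 !divr_gt0 // ltr_wpDl.
move=> h /andP[hp]; rewrite !lt_min => /andP[/andP[hd1' hd2'] hc2] k kr.
pose G k := \int[mu]_(x in cell T h k) `|p x| + \int[mu]_(x in cell T h k) `|q x|.
have gT : grid T h k <= T + r by rewrite lerD2l.
have := @scheme_error p q l P M T h w B k dir lp lq T0 hp (ltW w0) B0 _ _ G
  (fun=> erefl) k (leqnn k).
have hb t : T <= t <= grid T h k -> nc (P t) <= B /\ nc (M t) <= B.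
  move=> /andP[Tt tg]; have t0 : 0 <= t <= T + r.
    by rewrite (le_trans T0 Tt) (le_trans tg).
  by have := hB1 t t0; have := hB2 t t0; rewrite /B; lra.
have ho s t : T <= s -> s <= t -> t <= grid T h k -> t <= s + h ->
    nc (P t - P s) <= w /\ nc (M t - M s) <= w.
  move=> Ts st tg tsh; have s0 : 0 <= s by exact: le_trans Ts.
  have tb : t <= T + r by exact: le_trans gT.
  have th : t - s <= h by rewrite lerBlDl.
  split; [apply: hd1|apply: hd2] => //; exact: le_lt_trans th _.
move=> /(_ hb ho) h1; apply: le_trans h1 _.
have SG : \sum_(j < k) G j <= g.
  rewrite big_split /= !cell_sum ?(ltW hp) //; try exact: locally_int_norm.
  have mono f : locally_int f -> \int[mu]_(x in `[T, T + k%:R * h]) `|f x| <=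
      \int[mu]_(x in `[T, T + r]) `|f x|.
    move=> lf; have lf' := locally_int_norm lf.
    have := @Rintegral_itvB R (fun x => `|f x|) (BLeft T) (BRight (T + r))
      (T + k%:R * h).
    move=> /(_ (lf' _ _)); rewrite !bnd_simp lerDl lerD2l kr mulr_ge0 ?(ltW hp) //.
    move=> /(_ isT isT) E; rewrite -subr_ge0 E; exact: Rintegral_ge0.
  by apply: lerD; exact: mono.
have SG0 : 0 <= \sum_(j < k) G j.
  by apply: sumr_ge0 => j _; rewrite addr_ge0 //; apply: Rintegral_ge0.
have -> : \sum_(j < k) (2 * (w * (`|l| * h + G j) + 2 * (l * h) ^+ 2 * B +
     2 * (`|l| * h) * G j * B)) =
  2 * (w * (`|l| * (k%:R * h) + \sum_(j < k) G j)) +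
  2 * h * (2 * l ^+ 2 * (k%:R * h) * B + 2 * `|l| * (\sum_(j < k) G j) * B).
  rewrite (eq_bigr (fun j : 'I_k => (2 * w * `|l| * h + 2 * 2 * (l * h) ^+ 2 * B) +
     (2 * w + 2 * 2 * (`|l| * h) * B) * G j)); last by move=> j _; ring.
  rewrite big_split /= -mulr_sumr sumr_const card_ord -mulr_natl; ring.
set S := \sum_(j < k) G j in SG SG0 *; set kh := k%:R * h in kr *.
have kh0 : 0 <= kh by rewrite mulr_ge0 // ltW.
have eS : expR S <= expR g by rewrite ler_expR.
have eS0 : 0 <= expR S by exact: expR_ge0.
have i1 : w * (`|l| * kh + S) <= w * (`|l| * r + g).
  by apply: ler_wpM2l; [exact: ltW|apply: lerD => //; exact: ler_wpM2l].
have i2 : 2 * l ^+ 2 * kh * B + 2 * `|l| * S * B <=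
    2 * l ^+ 2 * r * B + 2 * `|l| * g * B.
  apply: lerD; apply: ler_wpM2r => //; apply: ler_wpM2l => //.
  by rewrite mulr_ge0 // sqr_ge0.
have i10 : 0 <= w * (`|l| * kh + S).
  by rewrite mulr_ge0 ?(ltW w0) // addr_ge0 // mulr_ge0.
have i20 : 0 <= 2 * l ^+ 2 * kh * B + 2 * `|l| * S * B.
  apply: addr_ge0; apply: mulr_ge0 => //; apply: mulr_ge0 => //.
  by rewrite mulr_ge0 // sqr_ge0.
apply: (@le_trans _ _ (c1 * w + c2 * h)).
  have -> : c1 * w + c2 * h = expR g * (2 * (w * (`|l| * r + g)) +
     2 * h * (2 * l ^+ 2 * r * B + 2 * `|l| * g * B)) by rewrite /c1 /c2; ring.
  apply: ler_pM => //.
    by apply: addr_ge0; apply: mulr_ge0 => //; rewrite mulr_ge0 // ltW.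
  apply: lerD; first by rewrite ler_pM2l.
  by apply: ler_wpM2l => //; rewrite mulr_ge0 // ltW.
rewrite [leRHS]splitr; apply: lerD.
  rewrite /w mulrA ler_pdivrMr ?ltr_wpDl // mulrC ler_wpM2l ?lerDl //.
  by rewrite divr_ge0 // ltW.
apply: (@le_trans _ _ (c2 * (eta / 2 / (c2 + 1)))).
  by apply: ler_wpM2l => //; exact: ltW.
rewrite mulrA ler_pdivrMr ?ltr_wpDl // mulrC ler_wpM2l ?lerDl //.
by rewrite divr_ge0 // ltW.
Qed.

End SchemeConvergence.

(** * Cesaro bounds on a half-line with small coefficients *)

Section SquareIntegrable.
Context {R : realType}.
Local Notation mu := (@lebesgue_measure R).
Implicit Types (Y P M : R -> Cx R) (p q f : R -> R) (a b s t T h l : R).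

Lemma cauchy_schwarz f a b : a <= b -> mu.-integrable `[a, b] (EFin \o f) ->
  mu.-integrable `[a, b] (EFin \o (fun x => f x ^+ 2)) ->
  (\int[mu]_(x in `[a, b]) f x) ^+ 2 <=
  (b - a) * \int[mu]_(x in `[a, b]) (f x ^+ 2).
Proof.
rewrite le_eqVlt => /predU1P[<- _ _|ab jf jf2].
  by rewrite subrr mul0r set_itv1 Rintegral_set1 expr0n.
have mab : measurable (`[a, b]%classic : set (measurableTypeR R)).
  exact: measurable_itv.
set If := \int[mu]_(x in _) f x; set If2 := \int[mu]_(x in _) (f x ^+ 2).
(* The integral of (f - m)^2, with m the mean of f, is nonnegative. *)
pose m := If / (b - a).
have ba0 : 0 < b - a by rewrite subr_gt0.
have icst (r : R) : mu.-integrable `[a, b] (EFin \o (fun=> r)).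
  by apply: continuous_itv_integrable; exact: cst_continuous.
have iZ (r : R) g : mu.-integrable `[a, b] (EFin \o g) ->
    mu.-integrable `[a, b] (EFin \o (fun x => r * g x)).
  move=> jg; rewrite (_ : _ \o _ = (fun x => r%:E * (EFin \o g) x)%E).
    exact: integrableZl.
  by apply/funext => x /=; rewrite EFinM.
have i1 : mu.-integrable `[a, b] (EFin \o (fun x => f x ^+ 2 + - 2 * m * f x)).
  by rewrite (_ : _ \o _ = (EFin \o (fun x => f x ^+ 2)) \+
    (EFin \o (fun x => - 2 * m * f x))) //; apply: integrableD => //; exact: iZ.
have E : \int[mu]_(x in `[a, b]) (f x ^+ 2 + - 2 * m * f x + m ^+ 2) =
    If2 + - 2 * m * If + m ^+ 2 * (b - a).
  rewrite (RintegralD mab i1 (icst _)) (RintegralD mab jf2 (iZ _ _ jf)).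
  rewrite (RintegralZl _ mab jf) -/(sint a b (fun=> m ^+ 2)) sint_cst //.
  exact: ltW.
have : 0 <= \int[mu]_(x in `[a, b]) (f x ^+ 2 + - 2 * m * f x + m ^+ 2).
  apply: Rintegral_ge0 => x _.
  by rewrite (_ : _ + _ = (f x - m) ^+ 2) ?sqr_ge0 //; ring.
rewrite E (_ : _ + _ = If2 - If ^+ 2 / (b - a)).
  by rewrite subr_ge0 ler_pdivrMr // mulrC.
by rewrite /m; field; rewrite gt_eqF.
Qed.

Lemma cac_measurable b Y : 0 <= b -> cac_on 0 b Y ->
  measurable_fun `[0, b] (fun t => nc (Y t) : R).
Proof.
move=> b0 acY; pose cl t : R := Num.max 0 (Num.min t b).
have clE t : 0 <= t <= b -> cl t = t.
  by move=> /andP[t0 tb]; rewrite /cl (min_l tb) (max_r t0).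
have cl0 t : 0 <= cl t by rewrite le_max lexx.
have clb t : cl t <= b by rewrite ge_max b0 ge_min lexx orbT.
have clm s t : s <= t -> cl s <= cl t.
  move=> st; rewrite /cl ge_max le_max lexx /= le_max.
  by apply/orP; right; rewrite le_min !ge_min st lexx orbT.
have cld s t : s <= t -> cl t - cl s <= t - s.
  move=> st; rewrite /cl.
  case: (leP t b) => tb; case: (leP s b) => sb;
    case: (leP 0 t) => t0; case: (leP 0 s) => s0; case: (leP 0 b) => b0';
    rewrite ?subrr ?subr_ge0 //; lra.
apply: (@eq_measurable_fun _ _ _ _ _ (fun t => nc (Y (cl t)))).
  by move=> t; rewrite inE /= in_itv /= => /clE ->.
apply: measurable_funTS; apply: continuous_measurable_fun => t.
apply/cvgrPdist_le => /= e e0; have [d d0 hd] := cac_uniform acY e0.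
near=> s.
have st : `|t - s| < d by near: s; exact: cvgr_dist_lt.
have tri (z w : Cx R) : `|nc z - nc w| <= nc (z - w).
  have := ncD (z - w) w; have := ncD (w - z) z; rewrite !subrK ncC => h1 h2.
  by rewrite ler_norml; apply/andP; split; lra.
apply: le_trans (tri _ _) _; have [ts|ts] := leP t s.
  rewrite ncC; apply: hd => //; first exact: clm.
  apply: le_lt_trans (cld _ _ ts) _.
  by move: st; rewrite distrC ger0_norm // subr_ge0.
apply: hd => //; first exact: clm (ltW ts).
apply: le_lt_trans (cld _ _ (ltW ts)) _.
by move: st; rewrite gtr0_norm // subr_gt0.
Unshelve. all: by end_near. Qed.

Lemma int_step_bound f T h (c : nat -> R) n : 0 <= h ->
  measurable_fun `[T, grid T h n] f -> (forall t, 0 <= f t) ->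
  (forall k, (k < n)%N -> forall t, cell T h k t -> f t <= c k) ->
  (\int[mu]_(t in `[T, grid T h n]) (f t)%:E <= (\sum_(k < n) h * c k)%:E)%E.
Proof.
move=> h0 + f0; elim: n => [_ _|n IH mf hc].
  by rewrite big_ord0 /grid mul0r addr0 set_itv1 integral_set1.
have g1 : T <= grid T h n by rewrite lerDl mulr_ge0.
have g2 : grid T h n <= grid T h n.+1 by rewrite gridS lerDl.
have mIf (B : set R) : measurable B -> B `<=` `[T, grid T h n.+1] ->
    measurable_fun B (EFin \o f).
  by move=> mB BT; apply/measurable_EFinP; exact: measurable_funS mf.
have sub1 : `[T, grid T h n] `<=` `[T, grid T h n.+1].
  by apply: subset_itvl; rewrite bnd_simp.
have sub2 : `]grid T h n, grid T h n.+1] `<=` `[T, grid T h n.+1].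
  by apply: subset_itvr; rewrite bnd_simp.
have -> : `[T, grid T h n.+1]%classic =
    `[T, grid T h n] `|` `]grid T h n, grid T h n.+1].
  by rewrite -itv_bndbnd_setU // bnd_simp.
rewrite ge0_integral_setU //; last 3 first.
- apply: mIf; first by apply: measurableU; exact: measurable_itv.
  by move=> x []; [exact: sub1|exact: sub2].
- by move=> x _; rewrite lee_fin.
- apply/disj_setPS => x [/=]; rewrite !in_itv /= => /andP[_ h1] /andP[h2 _].
  by move: h2; rewrite ltNge h1.
rewrite big_ord_recr /= EFinD; apply: leeD.
  apply: IH; first exact: measurable_funS mf.
  by move=> k kn; apply: hc; exact: ltnW.
apply: (@le_trans _ _ (\int[mu]_(t in `]grid T h n, grid T h n.+1]) (c n)%:E)%E).
  apply: ge0_le_integral => //.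
  - by move=> x _; rewrite lee_fin.
  - by apply: mIf => //; exact: measurable_itv.
  - move=> x /= xc; rewrite lee_fin; apply: (hc n) => //.
    by move: xc; rewrite /cell /= !in_itv /= => /andP[/ltW -> ->].
rewrite integral_cst //= lebesgue_measure_itv /= lte_fin gridS ltrDl.
case: ifP => [_|/negbT]; first by rewrite -EFinD addrAC subrr add0r -EFinM mulrC.
rewrite -leNgt => h0'; rewrite mule0 lee_fin.
by have -> : h = 0; [apply/eqP; rewrite eq_le h0 h0'|rewrite mul0r].
Qed.

(* [E] is the lower limit of the exceptional sets of the schemes of step
   [h j -> 0]: off [E], infinitely many of the schemes satisfy the bound. *)
Lemma tail_exceptional p q T (eps : R) : locally_int p -> locally_int q ->
  locally_int (fun x => p x ^+ 2) -> locally_int (fun x => q x ^+ 2) ->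
  0 <= T -> 0 <= eps ->
  (forall b, T <= b -> \int[mu]_(x in `[T, b]) (p x ^+ 2) +
    \int[mu]_(x in `[T, b]) (q x ^+ 2) <= eps) ->
  exists E, [/\ measurable E, (mu E <= (@exceptional_const R * eps)%:E)%E &
    forall l, ~ E l -> forall P M, dirac_pair p q l P M -> forall r, 0 < r ->
      (\int[mu]_(t in `[T, (T + r)%R]) (msize (P t, M t) ^+ 2)%:E <=
       (4 * r * (@cesaro_const R * msize (P T, M T) ^+ 2 + 1))%:E)%E].
Proof.
move=> lp lq lp2 lq2 T0 eps0 heps.
(* This makes h_j eps <= 1/2 for every j. The number of cells N_j = (j+1)^2 gives N_j h_j = (j+1) /
   c, so the grids eventually cover any bounded interval. *)
pose c := 1 + 2 * eps; have c1 : 1 <= c.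
  by rewrite lerDl mulr_ge0.
pose h (j : nat) : R := (j.+1%:R * c)^-1.
pose N (j : nat) : nat := (j.+1 * j.+1)%N.
have jc j : 1 <= j.+1%:R * c.
  by apply: (@le_trans _ _ j.+1%:R); rewrite ?ler1n // ler_peMr.
have h0 j : 0 < h j by rewrite invr_gt0 (lt_le_trans _ (jc j)).
have h1 j : h j <= 1 by rewrite invf_le1 // (lt_le_trans _ (jc j)).
have he j : h j * eps <= 2^-1.
  rewrite mulrC ler_pdivrMr ?(lt_le_trans _ (jc j)) //.
  have : 1 <= j.+1%:R :> R by rewrite ler1n.
  have : 0 <= j.+1%:R * eps by rewrite mulr_ge0.
  rewrite /c; nra.
have g2 j k : nc (gam p q T (h j) k) ^+ 2 <= h j *
    (\int[mu]_(x in cell T (h j) k) (p x ^+ 2) +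
     \int[mu]_(x in cell T (h j) k) (q x ^+ 2)).
  rewrite nc_sqr re_cx im_cx mulrDr.
  have gg : grid T (h j) k <= grid T (h j) k.+1 by rewrite gridS lerDl ltW.
  have gh : grid T (h j) k.+1 - grid T (h j) k = h j by rewrite gridS addrC addKr.
  have cs f : locally_int f -> locally_int (fun x => f x ^+ 2) ->
      (\int[mu]_(x in cell T (h j) k) f x) ^+ 2 <=
      h j * \int[mu]_(x in cell T (h j) k) (f x ^+ 2).
    by move=> lf lf2; have := cauchy_schwarz gg (lf _ _) (lf2 _ _); rewrite gh.
  by apply: lerD; exact: cs.
have gs j n : \sum_(k < n) nc (gam p q T (h j) k) ^+ 2 <= h j * eps.
  apply: (@le_trans _ _ (\sum_(k < n) (h j *
    (\int[mu]_(x in cell T (h j) k) (p x ^+ 2) +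
     \int[mu]_(x in cell T (h j) k) (q x ^+ 2))))).
    by apply: ler_sum.
  rewrite -mulr_sumr; apply: ler_wpM2l; first exact: ltW.
  rewrite big_split /= !cell_sum ?(ltW (h0 j)) //; apply: heps.
  by rewrite lerDl mulr_ge0 // ltW.
have g1 j k : nc (gam p q T (h j) k) <= 1.
  rewrite -(@expr_le1 _ 2) ?nc_ge0 //.
  apply: (@le_trans _ _ (h j * eps)); last by have := he j; lra.
  apply: le_trans (gs j k.+1); rewrite big_ord_recr /= lerDr.
  by apply: sumr_ge0 => i _; exact: sqr_ge0.
have /choice[E hE] : forall j, exists E, [/\ measurable E,
    (mu E <= (@exceptional_const R * eps)%:E)%E &
    forall x, ~ E x -> `|x| <= pi / (4 * h j) -> forall n x0, (0 < n <= N j)%N ->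
      \sum_(k < n) msize (szego (gam p q T (h j)) (cexp (2 * h j * x)) x0 k) ^+ 2
      <= @cesaro_const R * msize x0 ^+ 2 * n%:R].
  by move=> j; exact: szego_exceptional (h0 j) (g1 j) (he j) (gs j (N j)).
have mE j : measurable (E j) by have [] := hE j.
pose F J := \bigcap_(j in [set j | (J <= j)%N]) E j.
have mF J : measurable (F J).
  by apply: bigcap_measurable => //; exists J => /=.
exists (\bigcup_J F J); split.
- exact: bigcupT_measurable.
(* The sets F_J increase and F_J is contained in E_J, so continuity from below carries the bound to
   their union. *)
- have ndF : nondecreasing_seq F.
    move=> i j ij; apply/subsetPset => x Fx k /= jk; apply: Fx => /=.
    exact: leq_trans jk.
  have cvgF := nondecreasing_cvg_mu mF (bigcupT_measurable _ mF) ndF.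
  have <- : limn (mu \o F) = mu (\bigcup_J F J) by apply/cvg_lim => //; exact: cvgF.
  apply: lime_le; first by apply/cvg_ex; eexists; exact: cvgF.
  near=> J; have [_ hJ _] := hE J; apply: le_trans hJ.
  apply: le_measure; rewrite ?inE //.
  by move=> x; apply => /=.
move=> l nE P M dir r r0; have [acP acM _ _] := dir.
have cpos : 0 < c by exact: lt_le_trans c1.
have b0 : 0 < T + 2 * r by rewrite ltr_wpDl // mulr_gt0.
have r20 : 0 < 2 * r by rewrite mulr_gt0.
have half0 : 0 < 2^-1 :> R by [].
have quart0 : 0 < 4^-1 :> R by [].
have [hs hs0 hcvg] := scheme_cvg dir lp lq T0 r20 half0.
have [d1 d10 hd1] := cac_uniform (acP _ b0) quart0.
have [d2 d20 hd2] := cac_uniform (acM _ b0) quart0.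
pose dd := Num.min (Num.min hs r) (Num.min d1 d2).
have dd0 : 0 < dd by rewrite !lt_min hs0 r0 d10 d20.
(* An index above X provides what the chosen scheme needs: the first term makes the step smaller
   than [dd], the second makes N_j cells long enough to cover 2 r, and the third puts [l] in the
   range |l| <= pi / (4 h_j). *)
pose X := dd^-1 + 2 * r * c + 2 * `|l|.
have [j Jj nEj] : exists2 j, X < j.+1%:R & ~ E j l.
  pose J := Num.truncn X.
  have : ~ F J l by move=> h'; apply: nE; exists J.
  move=> /existsNP[j /not_implyP[/= Jj nEj]]; exists j => //.
  apply: (@lt_le_trans _ _ J.+1%:R); last by rewrite ler_nat.
  exact: truncnS_gt.
have [_ _ hEj] := hE j; move: Jj; set H := h j in hEj *.
have H0 : 0 < H by exact: h0.
have ddi : 0 < dd^-1 by rewrite invr_gt0.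
have rc0 : 0 < 2 * r * c by rewrite !mulr_gt0.
have l0 := normr_ge0 l.
rewrite /X => jX.
have HE : H * (j.+1%:R * c) = 1.
  by rewrite mulVf // gt_eqF // (lt_le_trans _ (jc j)).
have Hdd : H < dd.
  have j1 : dd^-1 < j.+1%:R by move: jX rc0 l0; clear; lra.
  have j2 : dd^-1 < j.+1%:R * c.
    by apply: lt_le_trans j1 _; rewrite ler_peMr.
  by rewrite -[ltRHS]invrK /H /h ltf_pV2 ?posrE // (lt_le_trans _ (jc j)).
move: Hdd; rewrite !lt_min => /andP[/andP[Hhs Hr] /andP[Hd1 Hd2]].
have lH : `|l| <= pi / (4 * H).
  rewrite ler_pdivlMr ?mulr_gt0 //; have := @pi_ge2 R => pi2.
  have j2 : 2 * `|l| <= j.+1%:R by move: jX ddi rc0; clear; lra.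
  have : 2 * `|l| * H <= j.+1%:R * H by apply: ler_wpM2r => //; exact: ltW.
  have : j.+1%:R * H <= 1.
    by rewrite -[leRHS]HE [leLHS]mulrC; apply: ler_wpM2l; [exact: ltW|rewrite ler_peMr].
  by move: pi2; clear; lra.
(* Rounding up makes n cells cover length r; since H < r, they cover at most 2 r. *)
pose n := (Num.truncn (r / H)).+1.
have rn : r <= n%:R * H.
  by rewrite -ler_pdivrMr // ltW // truncnS_gt.
have nr : n%:R * H <= 2 * r.
  have : (Num.truncn (r / H))%:R <= r / H.
    by rewrite truncn_le // divr_ge0 // ltW.
  by rewrite ler_pdivlMr // /n -natr1 mulrDl mul1r; move: Hr; clear; lra.
have nN : (0 < n <= N j)%N.
  rewrite /= -(@ler_nat R) -(ler_pM2r H0); apply: le_trans nr _.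
  have -> : (N j)%:R * H = j.+1%:R / c.
    rewrite /N natrM /H /h invfM; set a : R := j.+1%:R.
    have a0 : a != 0 by rewrite pnatr_eq0.
    by rewrite mulrA -(mulrA a) mulfV // mulr1.
  by rewrite ler_pdivlMr //; move: jX ddi l0; clear; lra.
set m0 := msize (P T, M T).
have sumn := hEj l nEj lH n (P T, M T) nN.
pose y k := szego (gam p q T H) (cexp (2 * H * l)) (P T, M T) k.
have H1 : 0 < H < hs by rewrite H0.
have gb k : (k < n)%N -> grid T H k.+1 <= T + 2 * r.
  move=> kn; rewrite lerD2l; apply: le_trans nr.
  by rewrite ler_pM2r // ler_nat.
(* Oscillation within the cell costs 1/4 for each component and the scheme error 1/2, in total 1;
   the powers of xi are unimodular. Then (m + 1)^2 <= 2 m^2 + 2. *)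
have cellb k : (k < n)%N -> forall t, cell T H k t ->
    msize (P t, M t) ^+ 2 <= 2 * msize (y k) ^+ 2 + 2.
  move=> kn t; rewrite /cell /= in_itv /= => /andP[t1 t2].
  have t2' : t - grid T H k <= H by rewrite lerBlDl -gridS.
  have g0 : 0 <= grid T H k by rewrite addr_ge0 // mulr_ge0 // ltW.
  have tb : t <= T + 2 * r by apply: le_trans t2 _; exact: gb.
  have e1 := hd1 _ _ g0 t1 tb (le_lt_trans t2' Hd1).
  have e2 := hd2 _ _ g0 t1 tb (le_lt_trans t2' Hd2).
  have kr : k%:R * H <= 2 * r.
    by apply: le_trans nr; rewrite ler_pM2r // ler_nat ltnW.
  have := hcvg H H1 k kr; rewrite -/(y k).
  set x1 := _ ^- k * (y k).1; set x2 := _ ^- k * (y k).2 => e3.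
  have n1 : nc x1 = nc (y k).1 by rewrite ncM ncV ncX nc_cexp expr1n invr1 mul1r.
  have n2 : nc x2 = nc (y k).2 by rewrite ncM ncV ncX nc_cexp expr1n invr1 mul1r.
  have f1 := ncD (P (grid T H k) - x1) x1; rewrite subrK n1 in f1.
  have f2 := ncD (M (grid T H k) - x2) x2; rewrite subrK n2 in f2.
  have f3 := ncD (P t - P (grid T H k)) (P (grid T H k)); rewrite subrK in f3.
  have f4 := ncD (M t - M (grid T H k)) (M (grid T H k)); rewrite subrK in f4.
  have F1 : msize (P t, M t) <= msize (y k) + 1 by rewrite /msize /=; move: e1 e2 e3 f1 f2 f3 f4; clear; lra.
  apply: (@le_trans _ _ ((msize (y k) + 1) ^+ 2)).
    by apply: lerXn2r; rewrite ?nnegrE ?msize_ge0 // addr_ge0 ?msize_ge0.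
  have := sqr_ge0 (msize (y k) - 1); set mm := msize (y k).
  by rewrite sqrrB1 sqrrD1; clear; lra.
have gn : grid T H n <= T + 2 * r by rewrite lerD2l.
have g0n : 0 <= grid T H n by rewrite addr_ge0 // mulr_ge0 // ltW.
have mF2 (b : R) : 0 < b -> measurable_fun `[T, b] (fun t => msize (P t, M t) ^+ 2).
  move=> bb; apply: (@measurable_funS _ _ _ _ `[0, b]) => //.
    by apply: subset_itvr; rewrite bnd_simp.
  have mP := cac_measurable (ltW bb) (acP _ bb).
  have mM := cac_measurable (ltW bb) (acM _ bb).
  by apply: measurable_funX; exact: measurable_funD.
have gpos : 0 < grid T H n by rewrite ltr_wpDl // mulr_gt0.
have sq0 t : 0 <= msize (P t, M t) ^+ 2 by exact: sqr_ge0.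
apply: (@le_trans _ _ (\int[mu]_(t in `[T, grid T H n])
    (msize (P t, M t) ^+ 2)%:E)%E).
  apply: ge0_subset_integral => //.
  - by apply/measurable_EFinP; exact: mF2.
  - by move=> x _; rewrite lee_fin.
  - by apply: subset_itvl; rewrite bnd_simp lerD2l.
apply: le_trans (int_step_bound (ltW H0) (mF2 _ gpos) sq0 cellb) _.
rewrite lee_fin -mulr_sumr big_split /= -mulr_sumr sumr_const card_ord.
have K0 := @cesaro_const_ge0 R.
set K := @cesaro_const R in K0 sumn *.
apply: (@le_trans _ _ (H * (2 * (K * m0 ^+ 2 * n%:R) + 2 *+ n))).
  by apply: ler_wpM2l; [exact: ltW|rewrite lerD2r ler_pM2l].
have -> : H * (2 * (K * m0 ^+ 2 * n%:R) + 2 *+ n) =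
  2 * (n%:R * H) * (K * m0 ^+ 2 + 1) by rewrite -mulr_natr; ring.
have -> : 4 * r = 2 * (2 * r) by ring.
apply: ler_wpM2r; last by rewrite ler_pM2l.
by rewrite addr_ge0 // mulr_ge0 // sqr_ge0.
Unshelve. all: by end_near. Qed.

End SquareIntegrable.

(** * The Dirac system with square integrable coefficients *)

Section BorelRepresentative.
Context {R : realType}.
Local Notation mu := (@lebesgue_measure R).
Local Notation cmu := (@completed_lebesgue_measure R).

Lemma completed_measurable_split (A : set R) :
  ((wlength (@idfun R))^*%mu).-cara.-measurable A ->
  exists B Z : set (measurableTypeR R),
    [/\ measurable B, measurable Z, mu Z = 0%E & A `\` Z = B `\` Z].
Proof.
rewrite -completed_caratheodory_measurable g_sigma_completed_algebra_genE.
move=> [B mB [N [Z [mZ Z0 NZ]]] <-]; exists B, Z; split => //.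
rewrite setDUl; apply/seteqP; split => x; last by left.
by case=> // -[Nx] /(_ (NZ _ Nx)).
Qed.

(** Lebesgue measure on Borel sets is the pushforward of its completion under the identity. *)
Lemma integral_completed (f : R -> \bar R) :
  measurable_fun (setT : set (measurableTypeR R)) f ->
  (forall x, 0 <= f x)%E ->
  (\int[mu]_x f x = \int[cmu]_x f x)%E.
Proof.
move=> mf f0.
have mid : measurable_fun setT (idfun : caratheodory_type (wlength (@idfun R))^*%mu
    -> measurableTypeR R).
  by move=> _ A mA; rewrite setTI; exact: sub_caratheodory.
have := ge0_integral_pushforward mid cmu measurableT mf (fun x _ => f0 x).
by rewrite preimage_setT => <-; exact: eq_measure_integral.
Qed.

(** Each superlevel set at a rational height is Borel off a Borel null set. Setting the function to
    0 on the union of these countably many null sets makes all its superlevel sets Borel. *)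
Lemma borel_representative (g : R -> R) : L2_Rplus g ->
  exists p : R -> R, [/\ measurable_fun (setT : set (measurableTypeR R)) p,
    {ae mu, forall t, 0 <= t -> p t = g t} &
    mu.-integrable setT (EFin \o (fun x => p x ^+ 2))].
Proof.
rewrite /L2_Rplus; set G := g \_ _ => hG.
have iG := Lfun2_integrable_sqr hG.
have mG : measurable_fun (setT : set (caratheodory_type (wlength (@idfun R))^*%mu)) G.
  by move: hG; rewrite inE => /andP[mf _]; move: mf; rewrite inE.
(* An enumeration of the rationals; codes that decode to nothing give 0, a harmless repetition. *)
pose c (n : nat) : R := ratr (odflt 0 (unpickle n : option rat)).
have /choice[B hB] : forall n, exists B : set (measurableTypeR R),
    exists Z : set (measurableTypeR R), [/\ measurable B, measurable Z,
      mu Z = 0%E & [set x | c n < G x] `\` Z = B `\` Z].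
  move=> n; apply: completed_measurable_split.
  have := mG measurableT `]c n, +oo[%classic (measurable_itv _).
  rewrite setTI; congr (_.-cara.-measurable _).
  by apply/seteqP; split => x; rewrite /= in_itv /= andbT.
have /choice[Z hZ] := hB.
pose Z0 := \bigcup_n Z n.
have mZ0 : measurable Z0 by apply: bigcupT_measurable => n; have [] := hZ n.
have Z00 : mu.-negligible Z0.
  apply: negligible_bigcup => n; exists (Z n); have [_ mz z0 _] := hZ n.
  by split.
pose p := G \_ (~` Z0).
have mB n : measurable (B n) by have [] := hZ n.
have pc n : measurable ([set x | c n < p x] : set (measurableTypeR R)).
  (* On [Z0] the function vanishes, so that set belongs to the superlevel set exactly when the
     height is negative. *)
  have E : [set x | c n < p x] = (B n `\` Z0) `|` (if c n < 0 then Z0 else set0).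
    apply/seteqP; split => x /=.
      rewrite /p patchE; have [|] := boolP (x \in ~` Z0).
        rewrite inE /= => nZ cG; left; split => //.
        have [_ _ _ hn] := hZ n.
        have : ([set x | c n < G x] `\` Z n) x.
          by split => // Zx; apply: nZ; exists n.
        by rewrite hn => -[].
      by rewrite notin_setE /= => /contrapT Zx c0; right; rewrite c0.
    case=> [[Bx nZ]|].
      rewrite /p patchE mem_set //; have [_ _ _ hn] := hZ n.
      have : (B n `\` Z n) x by split => // Zx; apply: nZ; exists n.
      by rewrite -hn => -[].
    have [c0|//] := boolP (c n < 0); move=> Zx; rewrite /p patchE memNset.
      exact: c0.
    by move=> h; exact: h.
  rewrite E; apply: measurableU; first exact: measurableD.
  by case: (c n < 0) => //; exact: measurable0.
have mp : measurable_fun (setT : set (measurableTypeR R)) p.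
  apply: (measurability _ (RGenOInfty.measurableE R)).
  move=> _ [_ [y ->] <-]; rewrite setTI.
  have -> : p @^-1` `]y, +oo[ = \bigcup_n (if y < c n then [set x | c n < p x] else set0).
    apply/seteqP; split => x /=; rewrite in_itv /= andbT.
      move=> /rat_in_itvoo[r]; rewrite in_itv /= => /andP[yr rp].
      have cE : c (pickle r) = ratr r by rewrite /c pickleK.
      by exists (pickle r) => //; rewrite cE yr /=; move: rp; rewrite -cE.
    by move=> [n _]; case: ifP => // yc /=; exact: lt_trans.
  by apply: bigcupT_measurable => n; case: (y < c n);
    [exact: pc|exact: measurable0].
exists p; split => //.
  apply: negligibleS Z00 => t /= /not_implyP[t0 npt].
  apply: contrapT => nZ; apply: npt.
  by rewrite /p patchE mem_set // /G patchE mem_set //= in_itv /= t0.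
have mp2 : measurable_fun (setT : set (measurableTypeR R))
    (EFin \o (fun x => p x ^+ 2)).
  by apply/measurable_EFinP; exact: measurable_funX.
pose T := caratheodory_type (wlength (@idfun R))^*%mu.
have mcp : measurable_fun (setT : set T) (EFin \o (fun x => p x ^+ 2)).
  move=> _ A mA; have := mp2 measurableT A mA; rewrite !setTI => h.
  exact: sub_caratheodory.
have icp : cmu.-integrable setT (EFin \o (fun x => p x ^+ 2)).
  apply: (@le_integrable _ T R cmu setT measurableT _ _ mcp _ iG) => x _ /=.
  rewrite lee_fin /p patchE; case: (x \in _) => //.
  by rewrite expr0n normr0.
have /integrableP[_ lt] := icp.
apply/integrableP; split; first exact: mp2.
apply: le_lt_trans lt; rewrite integral_completed; first exact: lexx.
  exact: measurableT_comp.
by move=> x; exact: abse_ge0.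
Qed.

End BorelRepresentative.

(** * From the vector equation to the diagonalised pair *)

Section Solutions.
Context {R : realType}.
Local Notation mu := (@lebesgue_measure R).
Implicit Types (p q : R -> R) (f : R -> 'cV[R[i]%C]_2) (v : 'cV[R[i]%C]_2).

Definition lincomb (a b : Cx R) v : Cx R :=
  a * (v ord0 ord0 : Cx R) + b * (v (lift ord0 ord0) ord0 : Cx R).

Lemma enorm_ge0 v : 0 <= enorm v.
Proof. exact: sqrtr_ge0. Qed.

Lemma enorm_sqr v : enorm v ^+ 2 =
  nc (v ord0 ord0 : Cx R) ^+ 2 + nc (v (lift ord0 ord0) ord0 : Cx R) ^+ 2.
Proof.
rewrite /enorm sqr_sqrtr; first by rewrite !big_ord_recl big_ord0 addr0.
by apply: sumr_ge0 => k _; exact: sqr_ge0.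
Qed.

Lemma lincomb_le a b v : nc a <= 1 -> nc b <= 1 ->
  nc (lincomb a b v) <= 2 * enorm v.
Proof.
move=> a1 b1; have E := enorm_sqr v; have e0 := enorm_ge0 v.
set x := nc (v ord0 ord0 : Cx R) in E.
set y := nc (v (lift ord0 ord0) ord0 : Cx R) in E.
have x0 : 0 <= x by exact: nc_ge0.
have y0 : 0 <= y by exact: nc_ge0.
have xe : x <= enorm v.
  by rewrite -(@ler_pXn2r _ 2) ?nnegrE // E lerDl sqr_ge0.
have ye : y <= enorm v.
  by rewrite -(@ler_pXn2r _ 2) ?nnegrE // E lerDr sqr_ge0.
apply: le_trans (ncD _ _) _; rewrite !ncM -/x -/y.
have : nc a * x <= x by rewrite ler_piMl.
have : nc b * y <= y by rewrite ler_piMl.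
by lra.
Qed.

Lemma lincombB a b v w : lincomb a b (v - w) = lincomb a b v - lincomb a b w.
Proof. by rewrite /lincomb !mxE; ring. Qed.

Lemma lincombZ a b (k : Cx R) v : lincomb a b (k *: v) = k * lincomb a b v.
Proof. by rewrite /lincomb !mxE; ring. Qed.

Lemma cac_lincomb f (a b : Cx R) c : nc a <= 1 -> nc b <= 1 ->
  abs_continuous_on 0 c f -> cac_on 0 c (fun t => lincomb a b (f t)).
Proof.
move=> a1 b1 acf k k1 e e0; have e2 : 0 < e / 2 by rewrite divr_gt0.
have [d d0 hd] := acf _ e2; exists d => // n s t hi ti hs.
have := hd n s t hi ti hs => h.
apply: (@le_lt_trans _ _ (\sum_(i < n) 2 * enorm (f (t i) - f (s i)))).
  apply: ler_sum => i _; rewrite -reN -reD -mulrBr -lincombB.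
  have := lincomb_le (f (t i) - f (s i)) a1 b1; apply: le_trans.
  rewrite ler_norml; apply/andP; split.
    by rewrite lerNl -reN; apply: le_trans (re_le_nc _) _; rewrite ncN ncM k1 mul1r.
  by apply: le_trans (re_le_nc _) _; rewrite ncM k1 mul1r.
by rewrite -mulr_sumr; lra.
Qed.

Lemma cdiff_lincomb f (a b : Cx R) t v : nc a <= 1 -> nc b <= 1 ->
  has_derivative f t v -> cdiff (fun t => lincomb a b (f t)) t (lincomb a b v).
Proof.
move=> a1 b1 df c e e0.
have c20 : 0 < 2 * (nc c + 1) by rewrite mulr_gt0 // ltr_wpDl // nc_ge0.
have e1 : 0 < e / (2 * (nc c + 1)) by rewrite divr_gt0.
move: df => /cvgrPdist_le /(_ _ e1); rewrite near_withinE => -[d /= d0 hd].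
exists d => // h hh.
have [->|h0] := eqVneq h 0.
  by rewrite addr0 subrr mul0r subr0 normr0 mulr0.
have := hd h; rewrite /ball_ /= sub0r normrN => /(_ hh h0).
rewrite sub0r normrN ger0_norm ?enorm_ge0 // => hle.
set w := ((h^-1)%:C)%C *: (f (t + h) - f t) - v in hle.
have E : re (c * lincomb a b (f (t + h))) - re (c * lincomb a b (f t)) -
    h * re (c * lincomb a b v) = re (cx h 0 * (c * lincomb a b w)).
  have -> : lincomb a b w = cx h^-1 0 *
      (lincomb a b (f (t + h)) - lincomb a b (f t)) - lincomb a b v.
    by rewrite /w lincombB (lincombZ a b (cx h^-1 0)) lincombB.
  by rewrite !reimE; field.
rewrite E.
have n1 : nc (cx h 0 * (c * lincomb a b w)) <= `|h| * (nc c * (2 * enorm w)).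
  rewrite !ncM nc_real; apply: ler_wpM2l => //; apply: ler_wpM2l; first exact: nc_ge0.
  exact: lincomb_le.
have n2 : `|re (cx h 0 * (c * lincomb a b w))| <= nc (cx h 0 * (c * lincomb a b w)).
  rewrite ler_norml; apply/andP; split; last exact: re_le_nc.
  by rewrite lerNl -reN; apply: le_trans (re_le_nc _) _; rewrite ncN.
apply: le_trans n2 _; apply: le_trans n1 _; rewrite mulrC; apply: ler_wpM2r => //.
have h1 := ler_wpM2l (nc_ge0 c) hle.
have h2 : e / (2 * (nc c + 1)) * (2 * (nc c + 1)) = e by rewrite divfK // gt_eqF.
move: h1 h2 e1; set e' := e / _; clear; lra.
Qed.

Lemma dirac_components p q (lam : R) f v t :
  (Jmx R *m v + Qmx p q t *m f t = (lam%:C)%C *: f t) ->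
  lincomb 1 (cx 0 1) v = cx 0 lam * lincomb 1 (cx 0 1) (f t) +
    cx (p t) (q t) * lincomb 1 (- cx 0 1) (f t) /\
  lincomb 1 (- cx 0 1) v = cx 0 (- lam) * lincomb 1 (- cx 0 1) (f t) +
    cx (p t) (- q t) * lincomb 1 (cx 0 1) (f t).
Proof.
move=> h.
have h0 := congr1 (fun m : 'cV[R[i]%C]_2 => m ord0 ord0 : Cx R) h.
have h1 := congr1 (fun m : 'cV[R[i]%C]_2 => m (lift ord0 ord0) ord0 : Cx R) h.
rewrite !mxE !big_ord_recl !big_ord0 !mxE /= in h0 h1.
rewrite /lincomb.
move: h0 h1; set x0 : Cx R := f t ord0 ord0; set x1 : Cx R := f t (lift ord0 ord0) ord0.
set v0 : Cx R := v ord0 ord0; set v1 : Cx R := v (lift ord0 ord0) ord0.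
move=> h0 h1.
have e0 : v1 = cx lam 0 * x0 - cx (p t) 0 * x1 + cx (q t) 0 * x0.
  rewrite -[cx lam 0 * x0]h0; clear; rewrite -/(cx (- q t) 0) -/(cx (p t) 0).
  by apply: cxP; rewrite !reimE; ring.
have e1 : v0 = cx (p t) 0 * x0 + cx (q t) 0 * x1 - cx lam 0 * x1.
  rewrite -[cx lam 0 * x1]h1; clear; rewrite -/(cx (q t) 0) -/(cx (p t) 0).
  by apply: cxP; rewrite !reimE; ring.
by rewrite e0 e1; clear; split; apply: cxP; rewrite !reimE; ring.
Qed.

(** Changing the coefficients on a null set is invisible to an equation that holds almost
    everywhere, so the Borel representatives may be used. *)
Lemma dirac_pair_solution p q p' q' lam f :
  {ae mu, forall t, 0 <= t -> p' t = p t} ->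
  {ae mu, forall t, 0 <= t -> q' t = q t} ->
  is_solution p q lam f ->
  dirac_pair p' q' lam (fun t => lincomb 1 (cx 0 1) (f t))
    (fun t => lincomb 1 (- cx 0 1) (f t)).
Proof.
move=> hp hq [acf df _].
have n1 : nc (1 : Cx R) <= 1 by rewrite nc1.
have ni : nc (cx 0 1 : Cx R) <= 1 by rewrite nc_i.
have nni : nc (- cx 0 1 : Cx R) <= 1 by rewrite ncN nc_i.
have F := ae_filter_ringOfSetsType mu.
split.
- by move=> b b0; apply: cac_lincomb => //; exact: acf.
- by move=> b b0; apply: cac_lincomb => //; exact: acf.
- apply: filterS (filterI hp (filterI hq df)) => t [pt [qt ft]] t0.
  have [v dv e] := ft (ltW t0); have [e1 _] := dirac_components e.
  by rewrite (pt (ltW t0)) (qt (ltW t0)) -e1; exact: cdiff_lincomb.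
- apply: filterS (filterI hp (filterI hq df)) => t [pt [qt ft]] t0.
  have [v dv e] := ft (ltW t0); have [_ e1] := dirac_components e.
  by rewrite (pt (ltW t0)) (qt (ltW t0)) -e1; exact: cdiff_lincomb.
Qed.

Lemma locally_int_sqr p : mu.-integrable setT (EFin \o (fun x => p x ^+ 2)) ->
  locally_int (fun x => p x ^+ 2).
Proof.
by move=> ip a b; apply: integrableS ip => //; exact: measurable_itv.
Qed.

Lemma locally_int_of_sqr p : measurable_fun (setT : set (measurableTypeR R)) p ->
  mu.-integrable setT (EFin \o (fun x => p x ^+ 2)) -> locally_int p.
Proof.
move=> mp ip a b.
have mab : measurable (`[a, b]%classic : set (measurableTypeR R)).
  exact: measurable_itv.
have i1 : mu.-integrable `[a, b] (EFin \o (fun x => 1 + p x ^+ 2)).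
  rewrite (_ : _ \o _ = (EFin \o (fun=> 1)) \+ (EFin \o (fun x => p x ^+ 2))) //.
  apply: integrableD => //; last exact: locally_int_sqr.
  by apply: continuous_itv_integrable; exact: cst_continuous.
apply: (le_integrable mab _ _ i1).
  by apply/measurable_EFinP; exact: measurable_funTS.
move=> x _ /=; rewrite lee_fin [leRHS]ger0_norm; last by rewrite addr_ge0 ?sqr_ge0.
rewrite ler_norml; apply/andP; split.
  by have := sqr_ge0 (p x + 1); rewrite sqrrD; have := sqr_ge0 (p x); lra.
by have := sqr_ge0 (p x - 1); rewrite sqrrB; have := sqr_ge0 (p x); lra.
Qed.

End Solutions.

(** * Tails of the coefficients and the passage back to the origin *)

Section Assembly.
Context {R : realType}.
Local Notation mu := (@lebesgue_measure R).
Implicit Types (p q g : R -> R) (f : R -> 'cV[R[i]%C]_2) (r T b eps : R).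

Lemma Rintegral_split g T b : locally_int g -> 0 <= T -> T <= b ->
  \int[mu]_(x in `[0, b]) g x =
  \int[mu]_(x in `[0, T]) g x + \int[mu]_(x in `[T, b]) g x.
Proof.
move=> lg T0 Tb; have := @Rintegral_itvB R g (BLeft 0) (BRight b) T.
move=> /(_ (lg _ _)); rewrite !bnd_simp => /(_ T0 Tb).
rewrite Rintegral_itv_obnd_cbnd; last first.
  apply: integrableS (lg T b) => //.
  by apply: subset_itvr; rewrite bnd_simp.
by move=> <-; rewrite addrC subrK.
Qed.

Lemma Rintegral_sqr_le g b : mu.-integrable setT (EFin \o (fun x => g x ^+ 2)) ->
  \int[mu]_(x in `[0, b]) (g x ^+ 2) <= \int[mu]_x (g x ^+ 2).
Proof.
move=> ig; have mg : measurable_fun setT (EFin \o (fun x => g x ^+ 2)).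
  by have /integrableP[] := ig.
apply: fine_le.
- apply: integrable_fin_num; first exact: measurable_itv.
  exact: locally_int_sqr.
- exact: integrable_fin_num.
- apply: (@ge0_subset_integral _ _ _ mu _ _ (measurable_itv _) measurableT _ mg) => //.
  by move=> x _; rewrite /= lee_fin sqr_ge0.
Qed.

(** The integrals over [0, b] are bounded by the total energy. Choosing T so that the value at T is
    within eps of their supremum leaves at most eps for any later interval. *)
Lemma tail_energy p q eps :
  mu.-integrable setT (EFin \o (fun x => p x ^+ 2)) ->
  mu.-integrable setT (EFin \o (fun x => q x ^+ 2)) -> 0 < eps ->
  exists2 T : R, 0 <= T & forall b, T <= b ->
    \int[mu]_(x in `[T, b]) (p x ^+ 2) + \int[mu]_(x in `[T, b]) (q x ^+ 2) <= eps.
Proof.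
move=> ip iq e0.
pose U b : R := \int[mu]_(x in `[0, b]) (p x ^+ 2) + \int[mu]_(x in `[0, b]) (q x ^+ 2).
pose S := [set U b | b in [set b | 0 <= b]].
have hS : has_sup S.
  split; first by exists (U 0); exists 0 => /=.
  exists (\int[mu]_x (p x ^+ 2) + \int[mu]_x (q x ^+ 2)) => _ [b _ <-].
  by apply: lerD; exact: Rintegral_sqr_le.
have [_ [T T0 <-] hT] := sup_adherent e0 hS.
exists T => // b Tb.
have : U b <= sup S.
  by apply: sup_upper_bound => //; exists b => //=; exact: le_trans Tb.
rewrite /U (Rintegral_split (locally_int_sqr ip) T0 Tb).
rewrite (Rintegral_split (locally_int_sqr iq) T0 Tb).
by move: hT; rewrite /U; lra.
Qed.

(** By the parallelogram law |x + i y|^2 + |x - i y|^2 = 2 (|x|^2 + |y|^2). *)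
Lemma enorm_dirac (v : 'cV[R[i]%C]_2) :
  enorm v ^+ 2 <= msize (lincomb 1 (cx 0 1) v, lincomb 1 (- cx 0 1) v) ^+ 2.
Proof.
rewrite enorm_sqr /msize /=; set x : Cx R := v ord0 ord0.
set y : Cx R := v (lift ord0 ord0) ord0.
have -> : lincomb 1 (cx 0 1) v = x + cx 0 1 * y by rewrite /lincomb mul1r.
have -> : lincomb 1 (- cx 0 1) v = x - cx 0 1 * y by rewrite /lincomb mul1r mulNr.
have h1 := nc_sqr (x + cx 0 1 * y); have h2 := nc_sqr (x - cx 0 1 * y).
have := mulr_ge0 (nc_ge0 (x + cx 0 1 * y)) (nc_ge0 (x - cx 0 1 * y)).
move: h1 h2; rewrite !(nc_sqr x) !(nc_sqr y) sqrrD !reimE => -> ->.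
set c := _ * _ => c0.
have := sqr_ge0 (re x); have := sqr_ge0 (re y).
have := sqr_ge0 (im x); have := sqr_ge0 (im y).
by move: c0; nra.
Qed.

Lemma enorm_measurable f b : 0 <= b -> abs_continuous_on 0 b f ->
  measurable_fun `[0, b] (fun t => (enorm (f t) ^+ 2)%:E).
Proof.
move=> b0 acf.
have n1 : nc (1 : Cx R) <= 1 by rewrite nc1.
have n0 : nc (0 : Cx R) <= 1 by rewrite nc0.
have h1 := cac_measurable b0 (cac_lincomb n1 n0 acf).
have h2 := cac_measurable b0 (cac_lincomb n0 n1 acf).
apply/measurable_EFinP.
rewrite (_ : (fun t => _) = (fun t => nc (lincomb 1 0 (f t)) ^+ 2 +
   nc (lincomb 0 1 (f t)) ^+ 2)).
  by apply: measurable_funD; apply: measurable_funX.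
by apply/funext => t; rewrite enorm_sqr /lincomb !mul1r !mul0r addr0 add0r.
Qed.

Lemma enorm_bounded f b : 0 <= b -> abs_continuous_on 0 b f ->
  exists2 D : R, 0 <= D & forall t, 0 <= t -> t <= b -> enorm (f t) ^+ 2 <= D.
Proof.
move=> b0 acf.
have n1 : nc (1 : Cx R) <= 1 by rewrite nc1.
have n0 : nc (0 : Cx R) <= 1 by rewrite nc0.
have [A A0 hA] := cac_bounded b0 (cac_lincomb n1 n0 acf).
have [B B0 hB] := cac_bounded b0 (cac_lincomb n0 n1 acf).
exists (A ^+ 2 + B ^+ 2) => [|t t0 tb]; first by rewrite addr_ge0 ?sqr_ge0.
have ht : 0 <= t <= b by apply/andP.
have := hA t ht; have := hB t ht; rewrite /lincomb !mul1r !mul0r addr0 add0r => h1 h2.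
by rewrite enorm_sqr; apply: lerD; rewrite ler_pXn2r ?nnegrE ?nc_ge0.
Qed.


Lemma int_enorm_cst f b (D : R) : 0 <= b -> abs_continuous_on 0 b f ->
  (forall t, 0 <= t -> t <= b -> enorm (f t) ^+ 2 <= D) ->
  (\int[mu]_(t in `[0%R, b]) ((enorm (f t) ^+ 2)%R)%:E <= (D * b)%:E)%E.
Proof.
move=> b0 acf hD.
have mb : measurable (`[0, b]%classic : set (measurableTypeR R)).
  exact: measurable_itv.
apply: (@le_trans _ _ (\int[mu]_(t in `[0%R, b]) (cst D%:E t))%E).
  apply: (@ge0_le_integral _ _ _ mu _ mb).
  - by move=> t _; rewrite lee_fin sqr_ge0.
  - exact: enorm_measurable.
  - exact: measurable_cst.
  - by move=> t /=; rewrite in_itv /= => /andP[t0 tb]; rewrite lee_fin hD.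
rewrite integral_cst //= lebesgue_measure_itv /= lte_fin.
case: ifP => _; first by rewrite oppr0 adde0 -EFinM.
rewrite mule0 lee_fin mulr_ge0 //.
by apply: le_trans (hD 0 (lexx _) b0); exact: sqr_ge0.
Qed.

Lemma int_enorm_tail f T r (K : R) : 0 <= T -> 0 < r -> loc_abs_continuous f ->
  (\int[mu]_(t in `[T, (T + r)%R])
     (msize (lincomb 1 (cx 0 1) (f t), lincomb 1 (- cx 0 1) (f t)) ^+ 2)%:E
     <= K%:E)%E ->
  (\int[mu]_(t in `[T, (T + r)%R]) ((enorm (f t) ^+ 2)%R)%:E <= K%:E)%E.
Proof.
move=> T0 r0 acf; apply: le_trans.
have Tr : 0 < T + r by rewrite ltr_wpDl.
have n1 : nc (1 : Cx R) <= 1 by rewrite nc1.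
have ni : nc (cx 0 1 : Cx R) <= 1 by rewrite nc_i.
have nni : nc (- cx 0 1 : Cx R) <= 1 by rewrite ncN nc_i.
have mP := cac_measurable (ltW Tr) (cac_lincomb n1 ni (acf _ Tr)).
have mM := cac_measurable (ltW Tr) (cac_lincomb n1 nni (acf _ Tr)).
have mb : measurable (`[T, T + r]%classic : set (measurableTypeR R)).
  exact: measurable_itv.
have sub : `[T, T + r]%classic `<=` `[0, T + r]%classic.
  by apply: subset_itvr; rewrite bnd_simp.
apply: (@ge0_le_integral _ _ _ mu _ mb).
- by move=> t _; rewrite lee_fin sqr_ge0.
- apply: measurable_funS sub _; first exact: measurable_itv.
  exact: enorm_measurable (ltW Tr) (acf _ Tr).
- apply: measurable_funS sub _; first exact: measurable_itv.
  by apply/measurable_EFinP; apply: measurable_funX; exact: measurable_funD.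
- by move=> t _; rewrite lee_fin enorm_dirac.
Qed.

(** On [0, T] the solution is bounded. For r <= T this bound suffices; for r > T the integral over
    [0, r] is at most that over [0, T + r], and the contribution D T of [0, T] is at most D r. *)
Lemma cesaro_of_tail f T (K : R) : 0 <= T -> 0 <= K -> loc_abs_continuous f ->
  (forall r, 0 < r ->
    (\int[mu]_(t in `[T, (T + r)%R]) ((enorm (f t) ^+ 2)%R)%:E <= (K * r)%:E)%E) ->
  L2_cesaro_bounded f.
Proof.
move=> T0 K0 acf hK.
(* The endpoint T + 1 is used because T may be 0, while [loc_abs_continuous] speaks of positive
   endpoints. *)
have T1 : 0 < T + 1 by rewrite ltr_wpDl.
have [D D0 hD] := enorm_bounded (ltW T1) (acf _ T1).
have TT1 : T <= T + 1 by rewrite lerDl.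
apply: (@le_lt_trans _ _ (D + K)%:E); last exact: ltry.
apply: ge_ereal_sup => _ [r /= r0 <-].
suff h : (\int[mu]_(t in `[0%R, r]) ((enorm (f t) ^+ 2)%R)%:E <= ((D + K) * r)%:E)%E.
  have -> : (D + K)%:E = ((r^-1)%:E * ((D + K) * r)%:E)%E.
    by rewrite -EFinM; congr (_%:E); field; rewrite gt_eqF.
  by rewrite lee_pmul2l ?lte_fin ?invr_gt0.
have [rT|Tr] := leP r T.
  apply: (@le_trans _ _ (D * r)%:E).
    apply: int_enorm_cst (ltW r0) (acf _ r0) _ => t t0 tr; apply: hD => //.
    by rewrite (le_trans tr) // (le_trans rT).
  by rewrite lee_fin ler_wpM2r ?(ltW r0) // lerDl.
have Tr0 : 0 < T + r by rewrite ltr_wpDl.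
have m0 := enorm_measurable (ltW Tr0) (acf _ Tr0).
have mT : measurable (`[0, T]%classic : set (measurableTypeR R)).
  exact: measurable_itv.
have mTr : measurable (`]T, T + r]%classic : set (measurableTypeR R)).
  exact: measurable_itv.
have E : (`[0, T] `|` `]T, T + r] = `[0, T + r])%classic.
  by rewrite -itv_bndbnd_setU // bnd_simp ?lerDl ?ltW.
have e0 (t : R) : (0 <= (enorm (f t) ^+ 2)%:E)%E by rewrite lee_fin sqr_ge0.
apply: (@le_trans _ _ (\int[mu]_(t in `[0%R, (T + r)%R]) ((enorm (f t) ^+ 2)%R)%:E)%E).
  apply: (@ge0_subset_integral _ _ _ mu _ _ (measurable_itv _) (measurable_itv _) _ m0) => //.
  by apply: subset_itvl; rewrite bnd_simp lerDr.
rewrite -E (@ge0_integral_setU _ _ _ mu _ _ mT mTr (fun t => (enorm (f t) ^+ 2)%:E)); last 3 first.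
- by rewrite E.
- by move=> t _.
- apply/disj_setPS => x [/=]; rewrite !in_itv /= => /andP[_ h1] /andP[h2 _].
  by move: h2; rewrite ltNge h1.
apply: (@le_trans _ _ ((D * T)%:E + (K * r)%:E)%E).
  apply: leeD.
    have [T00|T00] := eqVneq T 0.
      by rewrite T00 set_itv1 integral_set1 mulr0.
    have T01 : 0 < T by rewrite lt_neqAle eq_sym T00.
    apply: int_enorm_cst T0 (acf _ T01) _.
    by move=> t t0 tT; apply: hD => //; exact: le_trans TT1.
  apply: le_trans (hK r r0).
  apply: (@ge0_subset_integral _ _ _ mu _ _ mTr (measurable_itv _)) => //.
  - apply: measurable_funS m0 => //.
    by apply: subset_itvr; rewrite bnd_simp.
  - by apply: subset_itvr; rewrite bnd_simp.
rewrite -EFinD lee_fin mulrDl lerD2r; apply: ler_wpM2l => //; exact: ltW.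
Qed.

End Assembly.

Theorem theorem1 (R : realType) (p q : R -> R)
    (hp : L2_Rplus p) (hq : L2_Rplus q)
    (f : R -> R -> 'cV[R[i]%C]_2)
    (hf : forall lam : R, is_solution p q lam (f lam)) :
  {ae @lebesgue_measure R, forall lam : R, L2_cesaro_bounded (f lam)}.
Proof.
have [p' [mp pp ip]] := borel_representative hp.
have [q' [mq qq iq]] := borel_representative hq.
pose mu := @lebesgue_measure R.
(* The starting point T varies with m, but the conclusion for lambda does not mention it. Hence
   every bad lambda lies in all the sets E_m, whose measures tend to 0. *)
pose eps (m : nat) : R := m.+1%:R^-1.
have hE (m : nat) : exists E : set (measurableTypeR R), [/\ measurable E,
    (mu E <= (@exceptional_const R * eps m)%:E)%E &
    forall l, ~ E l -> L2_cesaro_bounded (f l)].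
  have em : 0 < eps m by rewrite invr_gt0 ltr0n.
  have [T T0 hT] := tail_energy ip iq em.
  have [E [mE muE hE]] := tail_exceptional (locally_int_of_sqr mp ip)
    (locally_int_of_sqr mq iq) (locally_int_sqr ip) (locally_int_sqr iq)
    T0 (ltW em) hT.
  exists E; split => // l nEl.
  have dp := dirac_pair_solution pp qq (hf l); have [acf _ _] := hf l.
  set K := 4 * (@cesaro_const R *
    msize (lincomb 1 (cx 0 1) (f l T), lincomb 1 (- cx 0 1) (f l T)) ^+ 2 + 1).
  apply: (@cesaro_of_tail _ _ T K) => //.
    rewrite mulr_ge0 // addr_ge0 // mulr_ge0 ?cesaro_const_ge0 //; exact: sqr_ge0.
  move=> r r0; apply: int_enorm_tail => //.
  apply: le_trans (hE l nEl _ _ dp r r0) _.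
  by rewrite lee_fin /K mulrAC.
have /choice[E {}hE] := hE.
have mI : measurable (\bigcap_m E m).
  by apply: bigcapT_measurable => m; have [] := hE m.
exists (\bigcap_m E m); split => //; last first.
  move=> l /= nl m _; apply: contrapT => nE; apply: nl.
  by have [_ _] := hE m; apply.
apply/eqP; rewrite eq_le measure_ge0 andbT; apply/lee_addgt0Pr => e e0.
rewrite add0e; pose C := `|@exceptional_const R|.
have [n hn] : exists n : nat, C / e < n.+1%:R.
  by exists (Num.truncn (C / e)); exact: truncnS_gt.
apply: (@le_trans _ _ (mu (E n))).
  apply: le_measure; rewrite ?inE //; first by have [] := hE n.
  by apply: bigcap_inf.
have [_ h _] := hE n; apply: le_trans h _; rewrite lee_fin /eps ler_pdivrMr //.
apply: le_trans (ler_norm _) _; rewrite -/C mulrC -ler_pdivrMr //.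
exact: ltW.
Qed.
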